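(* Let $\gamma=\gamma(m,p)=\max(0,m-1/p)$. For $m\in\{0,1\}$ and $p\in[1,\infty]$, or for integer $m\geq 2$ and $p\in(1,\infty]$, we have $$\Big(\lbrace |u(t)|_{m,p}^{\kappa}\rbrace\Big)^{1/\kappa}\overset{m,p,\kappa}{\sim}\nu^{-\beta\gamma},\qquad \kappa>0, \qquad (A)$$ and for real $s>1/2$ we have $$\Big(\lbrace \|u(t)\|_{s}^{\kappa}\rbrace\Big)^{1/\kappa}\overset{s,\kappa}{\sim}\nu^{-\beta(s-1/2)},\qquad \kappa>1/2. \qquad (B)$$ The upper estimates in (A) hold without time-averaging, uniformly for $t$ separated from $0$: for the same values of $(m,p)$ as in (A) and all $t>0$, $$|u(t)|_{m,p}\overset{m,p}{\lesssim}\max(t^{-\gamma},\ \nu^{-\beta\gamma}).$$ On the other hand, the lower estimates in (A) hold for all integers $m\geq 0$ and all $p\in[1,\infty]$, and the lower estimate in (B) also holds for $s=1/2$.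
   Context: Setting. $S^1=\mathbb{R}/\mathbb{Z}$; $\alpha\in(1,2)$ is a fixed constant, $\beta=1/(\alpha-1)$, $\nu\in(0,1]$. $\Lambda=\sqrt{-\Delta}$, so $\Lambda^\alpha$ is the Fourier multiplier by $(2\pi|k|)^\alpha$, $k\in\mathbb{Z}$. The function $f:\mathbb{R}\to\mathbb{R}$ is $C^\infty$, satisfies $f''\geq\sigma>0$ on $\mathbb{R}$, and for each integer $m\geq0$ there are $h(m)\geq0$, $C_m>0$ with $|f^{(m)}(x)|\leq C_m(1+|x|)^{h(m)}$ for all $x\in\mathbb{R}$, where $1\leq h(1)<2$. The initial condition $u_0:S^1\to\mathbb{R}$ is $C^\infty$, has zero mean and is not identically zero; $u=u(t,x)$ is the (global, smooth, zero space average) solution of $$u_t+(f(u))_x+\nu\Lambda^\alpha u=0,\quad t\geq0,\ x\in S^1,\qquad u(0)=u_0.$$ Norms (for zero-mean functions $v$ on $S^1$). $|v|_p$ is the $L_p(S^1)$ norm; $|v|_{m,p}=|d^mv/dx^m|_p$ for integer $m\geq0$; $\|v\|_s=(2\pi)^s\big(\sum_{k\in\mathbb{Z}}|k|^{2s}|\hat v^k|^2\big)^{1/2}$ for real $s\geq0$, where $\hat v^k$ are the complex Fourier coefficients. $D=\max(|u_0|_1^{-1},|u_0|_{1,\infty})>1$. Constants. $X\overset{a_1,\dots,a_k}{\lesssim}Y$ means $X\leq CY$ with $C>0$ depending only on $f$, $D$, the fixed constant $\alpha$ and the parameters $a_1,\dots,a_k$ (in particular independent of $\nu$, $t$, and of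 $u_0$ except through $D$); $X\sim Y$ (with the same superscripts) means $X\lesssim Y$ and $Y\lesssim X$. Time average. Fix a constant $\tilde C>0$ depending only on $f,D,\alpha$ such that $\|u(t)\|_{\alpha/2}^2\leq\tilde C\nu^{-1}$ for all $t\geq0$ (such a constant exists). Put $T_1=\frac14D^{-2}\tilde C^{-1}$, $T_2=\max\big(\frac32T_1,\,2D\sigma^{-1}\big)$, and $\lbrace A(t)\rbrace=\frac1{T_2-T_1}\int_{T_1}^{T_2}A(s)\,ds$. *)

(* Defs.v *)
From mathcomp Require Import all_boot all_order all_algebra.
From mathcomp Require Import complex.
From mathcomp Require Import all_classical all_reals all_analysis.

Set Implicit Arguments.
Unset Strict Implicit.
Unset Printing Implicit Defensive.
Import Order.TTheory GRing.Theory Num.Theory.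
Import numFieldNormedType.Exports.

Local Open Scope classical_set_scope.
Local Open Scope ring_scope.

(* Functions on S^1 = R/Z are 1-periodic functions on R; integrals and L_p norms
   on S^1 are taken for Lebesgue measure on the fundamental domain [0, 1[. *)
Definition circle_measure (R : realType) :
    {measure set (measurableTypeR R) -> \bar R} :=
  mrestr (@lebesgue_measure R) (measurable_itv `[0, 1[).

Definition smooth (R : realType) (v : R -> R) : Prop :=
  forall n x, derivable (derive1n n v) x 1.

Definition zero_mean (R : realType) (v : R -> R) : Prop :=
  \int[circle_measure R]_x v x = 0.

Definition fourier_coef (R : realType) (v : R -> R) (k : int) : R[i] :=
  ((\int[circle_measure R]_x (v x * cos (2 * pi * k%:~R * x)))
   -i* (\int[circle_measure R]_x (v x * sin (2 * pi * k%:~R * x))))%C.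

Definition fourier_exp (R : realType) (k : int) (x : R) : R[i] :=
  (cos (2 * pi * k%:~R * x) +i* sin (2 * pi * k%:~R * x))%C.

(* Lambda^alpha v, the Fourier multiplier by (2 pi |k|)^alpha, as the limit of
   the sums over -N <= k <= N.  These sums are real since v is real-valued, and
   they converge when v is smooth. *)
Definition frac_lap (R : realType) (alpha : R) (v : R -> R) (x : R) : R :=
  lim ((fun N : nat =>
    complex.Re (\sum_(j < N.*2.+1)
      let k : int := j%:Z - N%:Z in
      real_complex R ((2 * pi * `|k%:~R|) `^ alpha)
        * fourier_coef v k * fourier_exp k x)) @ \oo).

Definition sobolevW (R : realType) (m : nat) (p : \bar R) (v : R -> R) : \bar R :=
  ('N[circle_measure R]_p[EFin \o derive1n m v])%E.

Definition sobolevH (R : realType) (s : R) (v : R -> R) : \bar R :=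
  (((2 * pi) `^ s)%:E *
   (\esum_(k in [set: int])
      (`|k%:~R| `^ (2 * s) * ComplexField.Normc.normc (fourier_coef v k) ^+ 2)%:E)
     `^ 2^-1)%E.

Definition flux (R : realType) (sigma : R) (f : R -> R) : Prop :=
  [/\ smooth f,
      0 < sigma,
      (forall x, sigma <= derive1n 2%N f x) &
      exists h C : nat -> R,
        [/\ (forall m, 0 <= h m),
            (forall m, 0 < C m),
            (forall m x, `|derive1n m f x| <= C m * (1 + `|x|) `^ h m) &
            1 <= h 1%N < 2]].

Definition initial_condition (R : realType) (u0 : R -> R) : Prop :=
  [/\ periodic u0 1, smooth u0, zero_mean u0 & exists x, u0 x != 0].

Definition initial_size (R : realType) (u0 : R -> R) : \bar R :=
  maxe (sobolevW 0%N 1%E u0)^-1%E (sobolevW 1%N +oo%E u0).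

(* Derivative of a function defined on [0, +oo[; it is one-sided at t = 0. *)
Definition derive_from0 (R : realType) (w : R -> R) (t l : R) : Prop :=
  (w s - w t) / (s - t) @[s --> within [set s | 0 <= s] t^'] --> l.

(* u is C^oo on [0, +oo[ x R, and g i j is its derivative of order i in t and j
   in x. *)
Definition smooth_jet (R : realType) (u : R -> R -> R)
    (g : nat -> nat -> R -> R -> R) : Prop :=
  [/\ (forall (t x : R), 0 <= t -> g 0%N 0%N t x = u t x),
      (forall i j (t x : R), 0 <= t -> derive_from0 (g i j ^~ x) t (g i.+1 j t x)),
      (forall i j (t x : R), 0 <= t ->
         is_derive x (1 : R) (g i j t) (g i j.+1 t x)) &
      (forall i j, {within [set z : R * R | 0 <= z.1],
                     continuous (fun z : R * R => g i j z.1 z.2)})].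

(* The values of u at negative times are irrelevant. *)
Definition solution (R : realType) (alpha nu : R) (f u0 : R -> R)
    (u : R -> R -> R) : Prop :=
  [/\ (forall t : R, 0 <= t -> periodic (u t) 1),
      (forall t : R, 0 <= t -> zero_mean (u t)),
      u 0 = u0 &
      exists g, smooth_jet u g /\
        forall (t x : R), 0 <= t ->
          g 1%N 0%N t x + derive1 (f \o u t) x + nu * frac_lap alpha (u t) x = 0].

Definition admissible (R : realType) (alpha : R) (f : R -> R) (D nu : R)
    (u : R -> R -> R) : Prop :=
  0 < nu <= 1 /\
  exists u0, [/\ initial_condition u0, initial_size u0 = D%:E &
                 solution alpha nu f u0 u].

(* The constant is chosen before nu and u (hence before u0). *)
Definition lesssim (R : realType) (alpha : R) (f : R -> R) (D : R)
    (X Y : R -> (R -> R -> R) -> \bar R) : Prop :=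
  exists2 C : R, 0 < C &
    forall nu u, admissible alpha f D nu u -> (X nu u <= C%:E * Y nu u)%E.

Definition comparable_upto (R : realType) (alpha : R) (f : R -> R) (D : R)
    (X Y : R -> (R -> R -> R) -> \bar R) : Prop :=
  lesssim alpha f D X Y /\ lesssim alpha f D Y X.

Definition energy_bound (R : realType) (alpha : R) (f : R -> R) (D Ct : R) : Prop :=
  forall nu u, admissible alpha f D nu u ->
    forall t : R, 0 <= t -> (sobolevH (alpha / 2) (u t) ^+ 2 <= (Ct * nu^-1)%:E)%E.

Definition avg_start (R : realType) (D Ct : R) : R := 4^-1 * D ^- 2 * Ct^-1.

Definition avg_end (R : realType) (sigma D Ct : R) : R :=
  Num.max (3 / 2 * avg_start D Ct) (2 * D * sigma^-1).

Definition time_avg (R : realType) (sigma D Ct : R) (A : R -> \bar R) : \bar R :=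
  (((avg_end sigma D Ct - avg_start D Ct)^-1)%:E *
   \int[lebesgue_measure]_(t in `[avg_start D Ct, avg_end sigma D Ct]) A t)%E.

Definition avg_moment (R : realType) (sigma D Ct kappa : R) (A : R -> \bar R) :
    \bar R :=
  (time_avg sigma D Ct (fun t => A t `^ kappa) `^ kappa^-1)%E.

Definition beta_exp (R : realType) (alpha : R) : R := (alpha - 1)^-1.

(* The extended inverse gives 1/p = 0 for p = +oo. *)
Definition gamma_exp (R : realType) (m : nat) (p : \bar R) : R :=
  Num.max 0 (m%:R - fine p^-1%E).

Definition upper_range (R : realType) (m : nat) (p : \bar R) : Prop :=
  ((m <= 1)%N /\ (1 <= p)%E) \/ ((2 <= m)%N /\ (1 < p)%E).

(* Main.v *)
(** Write [K = nu ^ (- beta)] (so that [nu K^(alpha - 1) = 1]) and [kappa = max (1 / t, K)].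

    Upper bounds. The maximum principle applied to [u_x] (where [f'' >= sigma] and the
    nonnegativity of [Lambda^alpha v] at a maximum of [v] enter) gives
    [u_x <= min (D, 1 / (sigma t))]; hence [|u| <= D], [|u_x|_1 <= 2 D] and
    [|u^_k| <= C / k]. If moreover [sum k^(2 r) |u^_k|^2 <= N^(2 r - 1)], splitting sums at
    [k = N] bounds every lower derivative by the corresponding power of [N], and the nonlinear
    term in the evolution of [y = |u|_{m,2}^2] is at most [C N^(2 m)].  Taking for [N] the
    value dictated by the dissipation, [y] decreases as soon as [y > C kappa^(2 m - 1)], so a
    barrier argument yields [y <= C kappa^(2 m - 1)] and then [|u|_{m,oo} <= C kappa^m].
    For [1 < p < oo] the sharper power [kappa^(m - 1/p)] comes from Landau's inequality on
    [[x, x + 1/kappa]], where the oscillation of [u] is controlled by a nonnegative function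
    of [x] of mean [C / kappa].

    Lower bounds. Since [|u|_2^2] drops by a fixed amount between [T1] and [T2], the dissipation
    [nu ||u||_{alpha/2}^2], which is bounded by [Ct], is bounded below on a set of times of
    measure bounded below. At such a time the upper bounds force the frequencies comparable to [K]
    to carry a fixed share of it. This gives the [H^s] bounds, and a point where
    [|u_x| >= c K]; Landau's inequality transfers this to every [|d^m u / dx^m|], on an interval
    of length comparable to [1 / K]. *)
Require Import Defs.
From mathcomp Require Import all_boot all_order all_algebra.
From mathcomp Require Import complex.
From mathcomp Require Import all_classical all_reals all_analysis.
From mathcomp Require Import measurable_realfun ess_sup_inf zify ring lra.

Set Implicit Arguments.
Unset Strict Implicit.
Unset Printing Implicit Defensive.
Import Order.TTheory GRing.Theory Num.Theory.
Import numFieldNormedType.Exports.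

Local Open Scope classical_set_scope.
Local Open Scope ring_scope.

(** * Derivatives and integrals over the circle *)

(** Every constant is fixed before [nu] and the solution, while [D] says nothing about the
    derivatives of the initial condition beyond the first. This is why the energies are compared
    with a barrier proportional to a negative power of time: close to t = 0 it lies above any given
    solution, from a time that depends on the solution but leaves no trace in the constant. The
    condition alpha > 1 enters as subcriticality. When the spectrum of order m + alpha/2 is
    normalised to a frequency N, the nonlinear term in the energy of order m is O(N^(2 m)) and the
    dissipation is nu N^(alpha - 1) N^(2 m); the latter wins once N exceeds a fixed multiple of K.
    In the L_p bounds for m >= 2 the nonnegative function of mean C / kappa occurs with exponent p
    (1 - m/n), where n is free. Its mean is of use only if this exponent is at least 1, which some n
    achieves exactly when p > 1. In the lower bounds, time is weighted by the continuous function
    max (0, dissipation - threshold), so that neither the measure of a set of times nor the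
    measurability of a norm in time has to be discussed. *)

Section Derivatives.
Context {R : realType}.
Implicit Types (F G : R -> R).

Lemma is_derive1M F G (x a b : R) : is_derive x (1 : R) F a -> is_derive x (1 : R) G b ->
  is_derive x (1 : R) (fun y => F y * G y) (a * G x + F x * b).
Proof.
move=> dF dG; have d : is_derive x (1 : R) (F * G) (F x *: b + G x *: a) by exact: is_deriveM.
by apply: (is_derive_eq d); rewrite /GRing.scale/= addrC [G x * _]mulrC.
Qed.

Lemma is_derive1D F G (x a b : R) : is_derive x (1 : R) F a -> is_derive x (1 : R) G b ->
  is_derive x (1 : R) (fun y => F y + G y) (a + b).
Proof. by move=> dF dG; exact: is_deriveD. Qed.

Lemma is_derive1N F (x a : R) : is_derive x (1 : R) F a ->
  is_derive x (1 : R) (fun y => - F y) (- a).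
Proof. by move=> dF; exact: is_deriveN. Qed.

Lemma is_derive1B F G (x a b : R) : is_derive x (1 : R) F a -> is_derive x (1 : R) G b ->
  is_derive x (1 : R) (fun y => F y - G y) (a - b).
Proof. by move=> dF dG; exact: is_deriveB. Qed.

Lemma is_derive1Z F (c x a : R) : is_derive x (1 : R) F a ->
  is_derive x (1 : R) (fun y => c * F y) (c * a).
Proof. by move=> dF; exact: is_deriveZ. Qed.

Lemma is_derive1_chain F G (x a b : R) :
  is_derive (G x) (1 : R) F a -> is_derive x (1 : R) G b ->
  is_derive x (1 : R) (fun y => F (G y)) (a * b).
Proof. by move=> dF dG; exact: is_derive1_comp. Qed.

Lemma is_derive1_affine (c d x : R) : is_derive x (1 : R) (fun y => c * y + d) c.
Proof.
have := is_derive1D (is_derive1Z c (is_derive_id x (1:R))) (is_derive_cst d x (1:R)).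
by rewrite mulr1 addr0.
Qed.

Lemma is_derive1_sum (I : Type) (r : seq I) (P : pred I) (F : I -> R -> R) (f : I -> R)
    (x : R) : (forall i, is_derive x (1 : R) (F i) (f i)) ->
  is_derive x (1 : R) (fun y => \sum_(i <- r | P i) F i y) (\sum_(i <- r | P i) f i).
Proof.
move=> dF; elim: r => [|i r IH].
  rewrite big_nil; under eq_fun do rewrite big_nil.
  exact: is_derive_cst.
rewrite big_cons; under eq_fun do rewrite big_cons.
by case: (P i) => //; exact: is_derive1D.
Qed.

Lemma mvt_le F (f : R -> R) M (a b : R) : a <= b ->
  (forall x, a <= x <= b -> is_derive x (1 : R) F (f x)) ->
  (forall x, a <= x <= b -> `|f x| <= M) -> `|F b - F a| <= M * (b - a).
Proof.
rewrite le_eqVlt => /predU1P[->|ab] dF fM; first by rewrite !subrr normr0 mulr0.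
have [x||x] := @MVT _ F f a b ab.
- by rewrite in_itv/= => /andP[ax xb]; apply: dF; rewrite !ltW.
- apply: derivable_within_continuous => x; rewrite in_itv/= => xab.
  exact: (@ex_derive _ _ _ _ _ _ _ (dF x xab)).
- rewrite in_itv/= => /andP[ax xb] ->; rewrite normrM [`|b - a|]gtr0_norm ?subr_gt0//.
  by rewrite ler_wpM2r ?subr_ge0 ?(ltW ab)// fM// !ltW.
Qed.

Lemma taylor1_le F (f : R -> R) M (x y : R) : 0 <= M ->
  (forall z, Num.min x y <= z <= Num.max x y -> is_derive z (1 : R) F (f z)) ->
  (forall z, Num.min x y <= z <= Num.max x y -> `|f z - f x| <= M * `|z - x|) ->
  `|F y - F x - (y - x) * f x| <= M * `|y - x| ^+ 2.
Proof.
move=> M0 dF fM; pose phi z := F z - f x * z.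
have -> : F y - F x - (y - x) * f x = phi y - phi x by rewrite /phi; ring.
have dphi z : Num.min x y <= z <= Num.max x y -> is_derive z (1 : R) phi (f z - f x).
  move=> zI; have := is_derive1B (dF z zI) (is_derive1Z (f x) (is_derive_id z (1 : R))).
  by rewrite mulr1.
have [xy|/ltW yx] := leP x y.
  rewrite (_ : M * _ = M * `|y - x| * (y - x)); last first.
    by rewrite [`|y - x|]ger0_norm ?subr_ge0//; ring.
  have I z : x <= z <= y -> Num.min x y <= z <= Num.max x y.
    by rewrite (min_idPl xy) (max_idPr xy).
  apply: (mvt_le xy (fun z zI => dphi z (I z zI))) => z zI.
  apply: le_trans (fM z (I z zI)) _; case/andP: zI => xz zy.
  by rewrite ler_wpM2l// !ger0_norm ?subr_ge0// lerD2r.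
rewrite distrC (_ : M * _ = M * `|y - x| * (x - y)); last first.
  by rewrite [`|y - x|]ler0_norm ?subr_le0//; ring.
have I z : y <= z <= x -> Num.min x y <= z <= Num.max x y.
  by rewrite (min_idPr yx) (max_idPl yx).
apply: (mvt_le yx (fun z zI => dphi z (I z zI))) => z zI.
apply: le_trans (fM z (I z zI)) _; case/andP: zI => yz zx.
by rewrite ler_wpM2l// !ler0_norm ?subr_le0//; lra.
Qed.

Lemma lipschitz_within (F : R -> R) C (a b : R) : 0 <= C ->
  (forall s t, a <= s <= b -> a <= t <= b -> `|F s - F t| <= C * `|s - t|) ->
  {within `[a, b], continuous F}.
Proof.
move=> C0 lip; have C1 : 0 < C + 1 by rewrite ltr_wpDl.
apply/subspace_continuousP => t; rewrite /= in_itv/= => tI.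
apply/cvgrPdist_le => e e0; near=> s.
have sI : a <= s <= b by near: s; rewrite near_withinE; apply: nearW => s; rewrite /= in_itv.
apply: le_trans (lip t s tI sI) _; apply: (@le_trans _ _ ((C + 1) * `|t - s|)).
  by rewrite ler_wpM2r// lerDl.
rewrite -ler_pdivlMl// mulrC; near: s; rewrite near_withinE.
have : \forall s \near t, `|t - s| <= e / (C + 1).
  have cid : s @[s --> t] --> t by exact: cvg_id.
  exact: (@cvgr_dist_le _ _ _ _ _ _ _ cid _ (divr_gt0 e0 C1)).
by apply: filterS => s h _.
Unshelve. all: end_near. Qed.

End Derivatives.

Section CircleIntegral.
Context {R : realType}.
Implicit Types (v w f F : R -> R).

Lemma circle_measureE (A : set R) : A `<=` `[0, 1[ ->
  circle_measure R A = lebesgue_measure A.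
Proof. by move=> A1; rewrite /circle_measure/= /mrestr setIidl. Qed.

Lemma circle_measureT : circle_measure R setT = 1%E.
Proof.
rewrite /circle_measure/= /mrestr setTI lebesgue_measure_itv/= lte_fin ltr01.
by rewrite oppr0 addr0.
Qed.

Lemma circle_integralE (f : measurableTypeR R -> \bar R) :
  measurable_fun setT f ->
  (\int[circle_measure R]_x f x = \int[lebesgue_measure]_(x in `[0%R, 1%R[) f x)%E.
Proof.
move=> mf.
rewrite -(@eq_measure_integral _ _ _ _ lebesgue_measure (circle_measure R)); last first.
  by move=> A _ A1; rewrite circle_measureE.
rewrite [RHS]integral_mkcond; apply: ae_eq_integral => //.
  by apply/(measurable_restrictT _ _).1 => //; exact: measurable_funS mf.
exists (~` `[0, 1[%classic); split => //=.
- exact: measurableC.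
- by rewrite /circle_measure/= /mrestr setICl measure0.
- move=> x /= H; rewrite in_itv/= => x01; apply: H => _.
  by rewrite patchE ifT// inE/= in_itv/=.
Qed.

Lemma circle_integral_cc f : continuous f ->
  (\int[circle_measure R]_x (f x)%:E =
   \int[lebesgue_measure]_(x in `[0%R, 1%R]) (f x)%:E)%E.
Proof.
move=> cf.
have mf : measurable_fun setT f by exact: continuous_measurable_fun.
rewrite circle_integralE; last exact/measurable_EFinP.
rewrite integral_itv_bndo_bndc//; apply/measurable_EFinP.
exact: measurable_funS mf.
Qed.

Lemma circle_integrable f : continuous f ->
  (circle_measure R).-integrable setT (EFin \o f).
Proof.
move=> cf; have mf : measurable_fun setT f by exact: continuous_measurable_fun.
apply/integrableP; split; first exact/measurable_EFinP.
rewrite /=.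
rewrite (@circle_integral_cc (fun x => `|f x|)); last first.
  by move=> x; apply: cvg_norm; exact: cf.
(* The circle lives on the half-open interval, but compactness needs the closed one; the endpoint is
   negligible. *)
have /integrableP[_] : lebesgue_measure.-integrable `[0, 1]%classic (EFin \o f).
  apply: continuous_compact_integrable; first exact: segment_compact.
  exact: continuous_subspaceT.
by [].
Qed.

Definition cint v : R := \int[circle_measure R]_x v x.

Lemma EFin_cint v : continuous v ->
  ((cint v)%:E = \int[circle_measure R]_x (v x)%:E)%E.
Proof. by move=> cv; rewrite fineK//; apply: integrable_fin_num; rewrite //; exact: circle_integrable. Qed.

Lemma eq_cint v w : v =1 w -> cint v = cint w.
Proof. by move=> vw; congr cint; exact/funext. Qed.

Lemma cintD v w : continuous v -> continuous w ->
  cint (fun x => v x + w x) = cint v + cint w.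
Proof. by move=> cv cw; rewrite /cint RintegralD//; exact: circle_integrable. Qed.

Lemma cintB v w : continuous v -> continuous w ->
  cint (fun x => v x - w x) = cint v - cint w.
Proof. by move=> cv cw; rewrite /cint RintegralB//; exact: circle_integrable. Qed.

Lemma cintZ r v : continuous v -> cint (fun x => r * v x) = r * cint v.
Proof. by move=> cv; rewrite /cint RintegralZl//; exact: circle_integrable. Qed.

Lemma cintN v : continuous v -> cint (fun x => - v x) = - cint v.
Proof.
move=> cv; rewrite -mulN1r -cintZ//; apply: eq_cint => x.
by rewrite mulN1r.
Qed.

Lemma cint_cst r : cint (fun=> r) = r.
Proof.
by rewrite /cint Rintegral_cst//= circle_measureT mulr1.
Qed.

Lemma le_cint v w : continuous v -> continuous w ->
  (forall x, v x <= w x) -> cint v <= cint w.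
Proof.
by move=> cv cw vw; rewrite /cint le_Rintegral//; exact: circle_integrable.
Qed.

Lemma cint_ge0 v : (forall x, 0 <= v x) -> 0 <= cint v.
Proof. by move=> v0; apply: Rintegral_ge0 => x _. Qed.

Lemma le_norm_cint v : continuous v -> `|cint v| <= cint (fun x => `|v x|).
Proof. by move=> cv; apply: le_normr_Rintegral => //; exact: circle_integrable. Qed.

Lemma norm_cint_le v M : continuous v -> (forall x, `|v x| <= M) -> `|cint v| <= M.
Proof.
move=> cv vM; apply: le_trans (le_norm_cint cv) _.
rewrite -[leRHS]cint_cst; apply: le_cint => //.
  by move=> x; apply: cvg_norm; exact: cv.
by move=> x; exact: cvg_cst.
Qed.

Lemma continuous_sum (I : Type) (r : seq I) (P : pred I) (v : I -> R -> R) :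
  (forall i, continuous (v i)) -> continuous (fun x => \sum_(i <- r | P i) v i x).
Proof.
move=> cv; elim: r => [|i r IH].
  under eq_fun do rewrite big_nil.
  by move=> x; exact: cvg_cst.
under eq_fun do rewrite big_cons.
case: (P i) => //.
by move=> x; apply: cvgD; [exact: cv|exact: IH].
Qed.

Lemma cint_sum (I : Type) (r : seq I) (P : pred I) (v : I -> R -> R) :
  (forall i, continuous (v i)) ->
  cint (fun x => \sum_(i <- r | P i) v i x) = \sum_(i <- r | P i) cint (v i).
Proof.
move=> cv; elim: r => [|i r IH].
  by rewrite big_nil -[RHS]cint_cst; apply: eq_cint => x; rewrite big_nil.
rewrite big_cons -IH.
case: ifPn => Pi; last by apply: eq_cint => x; rewrite big_cons (negbTE Pi).
rewrite -cintD//; last exact: continuous_sum.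
by apply: eq_cint => x; rewrite big_cons Pi.
Qed.

Lemma is_derive_continuous F f : (forall x : R, is_derive x (1 : R) F (f x)) -> continuous F.
Proof.
move=> dF x; apply: differentiable_continuous; apply/derivable1_diffP.
exact: (@ex_derive _ _ _ _ _ _ _ (dF x)).
Qed.

Lemma FTC_itv F f (a b : R) : a < b ->
  (forall x : R, is_derive x (1 : R) F (f x)) -> continuous f ->
  (\int[lebesgue_measure]_(x in `[a, b]) (f x)%:E = (F b - F a)%:E)%E.
Proof.
move=> ab dF cf.
rewrite (@continuous_FTC2 _ f F)//.
- exact: continuous_subspaceT.
- have cF := is_derive_continuous dF.
  split.
  + by move=> x _; exact: (@ex_derive _ _ _ _ _ _ _ (dF x)).
  + by apply: cvg_at_right_filter; exact: cF.
  + by apply: cvg_at_left_filter; exact: cF.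
- by move=> x _; rewrite derive1E; apply: derive_val.
Qed.

Lemma cint_FTC F f :
  (forall x : R, is_derive x (1 : R) F (f x)) -> continuous f ->
  cint f = F 1 - F 0.
Proof.
move=> dF cf; apply: EFin_inj; rewrite EFin_cint// circle_integral_cc//.
exact: FTC_itv.
Qed.

Lemma cint_ge_itv v (a b c : R) : continuous v -> 0 <= a -> a <= b -> b < 1 -> 0 <= c ->
  (forall x, 0 <= v x) -> (forall x, a <= x <= b -> c <= v x) ->
  (b - a) * c <= cint v.
Proof.
move=> cv a0 ab b1 c0 v0 vc; rewrite -lee_fin EFin_cint//.
have mv : measurable_fun setT (EFin \o v : measurableTypeR R -> \bar R).
  by apply/measurable_EFinP; exact: continuous_measurable_fun.
rewrite circle_integralE//.
have sub : `[a, b]%classic `<=` `[0, 1[%classic.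
  move=> x /=; rewrite !in_itv/= => /andP[ax xb].
  by rewrite (le_trans a0)//= (le_lt_trans xb).
apply: (@le_trans _ _ (\int[lebesgue_measure]_(x in `[a, b]) (v x)%:E)%E); last first.
  apply: ge0_subset_integral => //=; last by move=> x _; rewrite lee_fin.
  exact: measurable_funS mv.
apply: (@le_trans _ _ (\int[lebesgue_measure]_(x in `[a, b]) (cst c%:E) x)%E).
  rewrite integral_cst//= lebesgue_measure_itv/= lte_fin.
  case: ltP => ab'; first by rewrite -EFinB -EFinM mulrC.
  have -> : b = a by apply: le_anti; rewrite ab ab'.
  by rewrite subrr mul0r mule0.
apply: ge0_le_integral => //=.
exact: measurable_funS mv.
Qed.

Lemma cintM_parts F f G g :
  (forall x : R, is_derive x (1 : R) F (f x)) ->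
  (forall x : R, is_derive x (1 : R) G (g x)) ->
  continuous f -> continuous g -> periodic F 1 -> periodic G 1 ->
  cint (fun x => f x * G x) = - cint (fun x => F x * g x).
Proof.
move=> dF dG cf cg pF pG.
have cF := is_derive_continuous dF; have cG := is_derive_continuous dG.
have cfG : continuous (fun x => f x * G x).
  by move=> x; apply: cvgM; [exact: cf|exact: cG].
have cFg : continuous (fun x => F x * g x).
  by move=> x; apply: cvgM; [exact: cF|exact: cg].
apply/eqP; rewrite -subr_eq0 opprK; apply/eqP.
rewrite -cintD//.
have dFG (x : R) : is_derive x (1 : R) (fun x => F x * G x) (f x * G x + F x * g x).
  exact: is_derive1M.
rewrite (cint_FTC dFG).
- by have := pF 0; have := pG 0; rewrite !add0r => -> ->; rewrite subrr.
- by move=> x; apply: cvgD; [exact: cfG|exact: cFg].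
Qed.

End CircleIntegral.
Arguments continuous_sum {R} [I] r P v.
Arguments is_derive_continuous {R} [F f].

(** * Fourier series of smooth periodic functions *)

Section Trig.
Context {R : realType}.
Implicit Types (x y z d : R).

Definition omega (k : nat) : R := 2 * pi * k%:R.

Lemma omega_ge0 k : 0 <= omega k.
Proof. by rewrite /omega !mulr_ge0// ?pi_ge0. Qed.

Lemma omega_gt0 k : (0 < k)%N -> 0 < omega k.
Proof. by move=> k0; rewrite /omega !mulr_gt0// ?pi_gt0 ?ltr0n. Qed.

Lemma omega0 : omega 0 = 0.
Proof. by rewrite /omega mulr0. Qed.

Lemma omegaB i k : (k <= i)%N -> omega (i - k) = omega i - omega k.
Proof. by move=> ki; rewrite /omega natrB// mulrBr. Qed.

Lemma omegaE k : omega k = (pi *+ 2) *+ k.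
Proof. by rewrite /omega mulr_natr mulr_natl. Qed.

Lemma cos_omegaD k d : cos (d + omega k) = cos d.
Proof. by rewrite omegaE; apply: periodicn => u; exact: cosD2pi. Qed.

Lemma sin_omegaD k d : sin (d + omega k) = sin d.
Proof. by rewrite omegaE; apply: periodicn => u; exact: sinD2pi. Qed.

Lemma is_derive_cosl c d x :
  is_derive x (1 : R) (fun y => cos (c * y + d)) (- c * sin (c * x + d)).
Proof.
have := @is_derive1_chain R cos (fun y => c * y + d) x _ _ (is_derive_cos _) (is_derive1_affine c d x).
by rewrite mulrC mulrN -mulNr.
Qed.

Lemma is_derive_sinl c d x :
  is_derive x (1 : R) (fun y => sin (c * y + d)) (c * cos (c * x + d)).
Proof.
have := @is_derive1_chain R sin (fun y => c * y + d) x _ _ (is_derive_sin _) (is_derive1_affine c d x).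
by rewrite mulrC.
Qed.

Lemma is_derive_cosM c x : is_derive x (1 : R) (fun y => cos (c * y)) (- c * sin (c * x)).
Proof. by have := is_derive_cosl c 0 x; rewrite addr0; under eq_fun do rewrite addr0. Qed.

Lemma is_derive_sinM c x : is_derive x (1 : R) (fun y => sin (c * y)) (c * cos (c * x)).
Proof. by have := is_derive_sinl c 0 x; rewrite addr0; under eq_fun do rewrite addr0. Qed.

Lemma continuous_cosl c d : continuous (fun y : R => cos (c * y + d)).
Proof. exact: is_derive_continuous (is_derive_cosl c d). Qed.

Lemma continuous_cosM c : continuous (fun y : R => cos (c * y)).
Proof. exact: is_derive_continuous (is_derive_cosM c). Qed.

Lemma continuous_sinM c : continuous (fun y : R => sin (c * y)).
Proof. exact: is_derive_continuous (is_derive_sinM c). Qed.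

Lemma cint_cosl k d : (0 < k)%N -> cint (fun y : R => cos (omega k * y + d)) = 0.
Proof.
move=> k0; suff /eqP : omega k * cint (fun y : R => cos (omega k * y + d)) = 0.
  by rewrite mulf_eq0 gt_eqF ?omega_gt0// => /eqP.
rewrite -cintZ; last exact: continuous_cosl.
rewrite (cint_FTC (is_derive_sinl (omega k) d)).
  by rewrite mulr1 mulr0 add0r [omega k + d]addrC sin_omegaD subrr.
by move=> x; apply: cvgM; [exact: cvg_cst|exact: continuous_cosl].
Qed.

Definition dirichlet (n : nat) z : R := 1 + 2 * \sum_(i < n) cos (omega i.+1 * z).

(** Not divided by [n]: its mean over the circle is [n]. *)
Definition fejer (n : nat) z : R := \sum_(i < n) dirichlet i z.

(** The right-hand side is the squared modulus of the sum of the exponentials of frequencies below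
    [n]. Adding one exponential adds 1 and its cross terms with the others, and these make up the
    next Dirichlet kernel. *)
Lemma fejerE n z : fejer n z =
  (\sum_(i < n) cos (omega i * z)) ^+ 2 + (\sum_(i < n) sin (omega i * z)) ^+ 2.
Proof.
rewrite /fejer; elim: n => [|n IH]; first by rewrite !big_ord0 expr0n/= addr0.
rewrite !big_ord_recr/= IH /dirichlet.
set C := \sum_(i < n) cos _; set S := \sum_(i < n) sin _.
have -> : \sum_(i < n) cos (omega i.+1 * z) =
    C * cos (omega n * z) + S * sin (omega n * z).
  rewrite /C /S !mulr_suml -big_split/= [LHS](reindex_inj rev_ord_inj)/=.
  apply: eq_bigr => i _; rewrite -subSn//= subSS omegaB; last by rewrite ltnW.
  by rewrite mulrBl cosB mulrC [sin _ * _]mulrC.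
have := cos2Dsin2 (omega n * z).
set c := cos _; set s := sin _ => cs.
by rewrite -[X in _ + (X + _)]cs; ring.
Qed.

Lemma fejer_ge0 n z : 0 <= fejer n z.
Proof. by rewrite fejerE addr_ge0// sqr_ge0. Qed.

Lemma sin_mul_sumcos n z :
  2 * sin (pi * z) * (\sum_(i < n) cos (omega i * z)) =
  sin (omega n * z - pi * z) + sin (pi * z).
Proof.
elim: n => [|n IH].
  by rewrite big_ord0 mulr0 omega0 mul0r sub0r sinN addNr.
rewrite big_ord_recr/= mulrDr IH.
have -> : omega n.+1 * z - pi * z = omega n * z + pi * z.
  by rewrite /omega -[n.+1]addn1 natrD; ring.
by rewrite [in RHS]sinD sinB; ring.
Qed.

Lemma sin_mul_sumsin n z :
  2 * sin (pi * z) * (\sum_(i < n) sin (omega i * z)) =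
  cos (pi * z) - cos (omega n * z - pi * z).
Proof.
elim: n => [|n IH].
  by rewrite big_ord0 mulr0 omega0 mul0r sub0r cosN subrr.
rewrite big_ord_recr/= mulrDr IH.
have -> : omega n.+1 * z - pi * z = omega n * z + pi * z.
  by rewrite /omega -[n.+1]addn1 natrD; ring.
by rewrite [in RHS]cosD cosB; ring.
Qed.

Lemma cos_norm_le1 x : `|cos x| <= 1.
Proof. by rewrite ler_norml cos_geN1 cos_le1. Qed.

Lemma sin_norm_le1 x : `|sin x| <= 1.
Proof. by rewrite ler_norml sin_geN1 sin_le1. Qed.

(** Multiplied by 2 sin (pi z), the cosine and sine sums telescope to two terms of modulus at most 1
    each, so each square contributes at most 1. *)
Lemma sin2_fejer_le n z : sin (pi * z) ^+ 2 * fejer n z <= 2.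
Proof.
rewrite fejerE mulrDr -!exprMn.
have half (a b c e : R) : 2 * a * b = c + e -> `|c| <= 1 -> `|e| <= 1 -> (a * b) ^+ 2 <= 1.
  move=> H c1 e1; have -> : a * b = (c + e) / 2 by lra.
  rewrite -[leRHS](expr1n _ 2) -[leLHS]real_normK ?num_real// lerXn2r ?nnegrE//.
  by move: c1 e1; rewrite !ler_norml => /andP[? ?] /andP[? ?]; apply/andP; split; lra.
have -> : 2 = 1 + 1 :> R by [].
apply: lerD; first by apply: (half _ _ _ _ (sin_mul_sumcos n z)); exact: sin_norm_le1.
apply: (half _ _ _ _ (sin_mul_sumsin n z)); first exact: cos_norm_le1.
by rewrite normrN; exact: cos_norm_le1.
Qed.

Lemma sin_pi_ge z : 0 <= z <= 2^-1 -> z <= 2 * sin (pi * z).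
Proof.
move=> /andP[z0 z1].
have pi2 := @pi_ge2 R.
(* With c = cos (pi t / 2), the double angle formula gives 2 c^2 - 1 = cos (pi t) >= 0, which leaves
   ample room above 1/2. *)
have cosh t : 0 <= t <= z -> 2^-1 <= cos (pi * t / 2).
  move=> /andP[t0 tz].
  have c0 : 0 <= cos (pi * t).
    apply: cos_ge0_pihalf; apply/andP; split; nra.
  have c1 : 0 <= cos (pi * t / 2).
    apply: cos_ge0_pihalf; apply/andP; split; nra.
  have : cos ((pi * t / 2) *+ 2) = cos (pi * t) by congr cos; rewrite -mulr_natr; field.
  have := cos_le1 (pi * t / 2).
  move: (cos (pi * t / 2)) (cos (pi * t)) c0 c1 (cos_mulr2n (pi * t / 2)) => c C C0 c0 -> c1.
  rewrite -(mulr_natl (c ^+ 2) 2) => E.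
  have [//|cl] := leP 2^-1 c.
  have : c ^+ 2 < 2^-1 ^+ 2 by rewrite ltrXn2r// nnegrE//; lra.
  lra.
have [->|zn0] := eqVneq z 0; first by rewrite mulr0 sin0 mulr0.
have zgt0 : 0 < z by rewrite lt_neqAle eq_sym zn0.
have dS t : is_derive t (1 : R) (fun y => sin (pi / 2 * y)) (pi / 2 * cos (pi / 2 * t)).
  exact: is_derive_sinM.
have [t] := @MVT _ (fun y => sin (pi / 2 * y)) _ 0 z zgt0 (fun t _ => dS t)
  (continuous_subspaceT (is_derive_continuous dS)).
rewrite in_itv/= => /andP[t0 tz]; rewrite mulr0 sin0 !subr0 => E.
have ht : 2^-1 <= cos (pi / 2 * t).
  have := cosh t; rewrite (ltW t0) (ltW tz) => /(_ isT).
  by congr (_ <= cos _); field.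
have hz : 2^-1 <= cos (pi / 2 * z).
  have := cosh z; rewrite (ltW zgt0) lexx => /(_ isT).
  by congr (_ <= cos _); field.
have -> : pi * z = (pi / 2 * z) + (pi / 2 * z) by field.
rewrite sinD.
have s1 : z / 2 <= sin (pi / 2 * z).
  have h : 2^-1 <= pi / 2 * cos (pi / 2 * t).
    have : 0 <= (pi / 2 - 1) * cos (pi / 2 * t) by rewrite mulr_ge0//; lra.
    lra.
  by rewrite E mulrC ler_wpM2r// ltW.
have : 0 <= (cos (pi / 2 * z) - 2^-1) * sin (pi / 2 * z) by rewrite mulr_ge0//; lra.
lra.
Qed.

Lemma int_shift (v : R -> R) (n : int) x : periodic v 1 -> v (x + n%:~R) = v x.
Proof.
move=> pv; have P m y : v (y + m%:R) = v y.
  by elim: m => [|m IH]; rewrite ?addr0// -natr1 addrA pv.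
case: n => n; first exact: P.
by rewrite NegzE mulrNz -[RHS](P n.+1) -[in LHS](P n.+1) -!addrA addNr addr0.
Qed.

Lemma sin_sqr_periodic : periodic (fun z : R => sin (pi * z) ^+ 2) 1.
Proof. by move=> z; rewrite mulrDr mulr1 sinDpi sqrrN. Qed.

(** This factor sin^2 is what cancels the singularity of the Fejer kernel. Translating by the
    integer nearest to y - x0 reduces to |z| <= 1/2, where |z| <= 2 |sin (pi z)|. *)
Lemma periodic_lip_sin (v : R -> R) L x0 y : periodic v 1 ->
  (forall a b, `|v a - v b| <= L * `|a - b|) ->
  (v y - v x0) ^+ 2 <= 4 * L ^+ 2 * sin (pi * (x0 - y)) ^+ 2.
Proof.
move=> pv vL.
have L0 : 0 <= L.
  by have := vL 1 0; rewrite subr0 normr1 mulr1; apply: le_trans.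
pose n := Num.floor (y - x0 + 2^-1).
have /andP[n1] := floor_itv (y - x0 + 2^-1).
rewrite -/n intrD1 => n2.
pose z := y - x0 - n%:~R.
have -> : v y = v (x0 + z).
  by rewrite -[RHS](int_shift n _ pv) /z; congr v; ring.
have -> : sin (pi * (x0 - y)) ^+ 2 = sin (pi * z) ^+ 2.
  rewrite -[RHS](int_shift n z sin_sqr_periodic) /z subrK.
  by rewrite -opprB mulrN sinN sqrrN.
have zle : `|z| <= 2^-1.
  by rewrite ler_norml; apply/andP; rewrite /z; split; lra.
have -> : sin (pi * z) ^+ 2 = sin (pi * `|z|) ^+ 2.
  have [z0|z0] := leP 0 z; first by rewrite ger0_norm.
  by rewrite ltr0_norm// mulrN sinN sqrrN.
have sz : `|z| <= 2 * sin (pi * `|z|) by apply: sin_pi_ge; rewrite normr_ge0.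
have vz : `|v (x0 + z) - v x0| <= L * `|z|.
  by have := vL (x0 + z) x0; rewrite [x0 + z]addrC addrK.
rewrite -[leLHS]real_normK ?num_real//.
have -> : 4 * L ^+ 2 * sin (pi * `|z|) ^+ 2 = (L * (2 * sin (pi * `|z|))) ^+ 2 by ring.
rewrite lerXn2r ?nnegrE//; first by apply: mulr_ge0 => //; apply: le_trans sz.
by apply: le_trans vz _; rewrite ler_wpM2l.
Qed.

End Trig.
Arguments continuous_cosl {R} c d.
Arguments continuous_cosM {R} c.
Arguments continuous_sinM {R} c.

Section Continuity.
Context {R : realType}.
Implicit Types (v w : R -> R).

Lemma continuous_mul v w : continuous v -> continuous w -> continuous (fun x => v x * w x).
Proof. by move=> cv cw x; apply: cvgM; [exact: cv|exact: cw]. Qed.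

Lemma continuous_add v w : continuous v -> continuous w -> continuous (fun x => v x + w x).
Proof. by move=> cv cw x; apply: cvgD; [exact: cv|exact: cw]. Qed.

Lemma continuous_opp v : continuous v -> continuous (fun x => - v x).
Proof. by move=> cv x; apply: cvgN; exact: cv. Qed.

Lemma continuous_sub v w : continuous v -> continuous w -> continuous (fun x => v x - w x).
Proof. by move=> cv cw x; apply: cvgB; [exact: cv|exact: cw]. Qed.

Lemma continuous_cst (c : R) : continuous (fun _ : R => c).
Proof. by move=> x; exact: cvg_cst. Qed.

Lemma continuous_scale (c : R) v : continuous v -> continuous (fun x => c * v x).
Proof. by move=> cv; apply: continuous_mul => //; exact: continuous_cst. Qed.

Lemma continuous_norm v : continuous v -> continuous (fun x => `|v x|).
Proof. by move=> cv x; apply: cvg_norm; exact: cv. Qed.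

Lemma continuous_exp v n : continuous v -> continuous (fun x => v x ^+ n).
Proof.
move=> cv; elim: n => [|n IH].
  by under eq_fun do rewrite expr0; exact: continuous_cst.
by under eq_fun do rewrite exprS; exact: continuous_mul.
Qed.

End Continuity.
Arguments continuous_mul {R} [v w] cv cw : rename.
Arguments continuous_add {R} [v w] cv cw : rename.
Arguments continuous_opp {R} [v] cv : rename.
Arguments continuous_sub {R} [v w] cv cw : rename.
Arguments continuous_cst {R} c.
Arguments continuous_scale {R} c [v] cv : rename.
Arguments continuous_norm {R} [v] cv : rename.
Arguments continuous_exp {R} [v] n cv : rename.

(** * Fourier coefficients, Fejer means and inversion *)

Section FourierCoef.
Context {R : realType}.
Implicit Types (v w : R -> R) (x y : R).

(** For real [v] the complex coefficients at k and -k are conjugate, so nonnegative frequencies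
    suffice: [fmod v k] is the common modulus, and each positive frequency is counted twice in
    [fpartial]. *)
Definition fcos v (k : nat) : R := cint (fun x => v x * cos (omega k * x)).
Definition fsin v (k : nat) : R := cint (fun x => v x * sin (omega k * x)).
Definition fmod v (k : nat) : R := Num.sqrt (fcos v k ^+ 2 + fsin v k ^+ 2).
Definition fterm v (k : nat) x : R :=
  fcos v k * cos (omega k * x) + fsin v k * sin (omega k * x).
Definition fpartial v (n : nat) x : R := fcos v 0 + 2 * \sum_(i < n) fterm v i.+1 x.

Lemma fmod_ge0 v k : 0 <= fmod v k.
Proof. exact: sqrtr_ge0. Qed.

Lemma fmod_sqr v k : fmod v k ^+ 2 = fcos v k ^+ 2 + fsin v k ^+ 2.
Proof. by rewrite sqr_sqrtr// addr_ge0 ?sqr_ge0. Qed.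

Lemma sqr_le_norm (a b : R) : 0 <= b -> a ^+ 2 <= b ^+ 2 -> `|a| <= b.
Proof. by move=> b0 h; rewrite -(ler_pXn2r (n := 2)) ?nnegrE// real_normK ?num_real. Qed.

(** Cauchy-Schwarz, with the defect written out as a square (Lagrange's identity). *)
Lemma rot_le (a b c s : R) : c ^+ 2 + s ^+ 2 = 1 ->
  `|a * c + b * s| <= Num.sqrt (a ^+ 2 + b ^+ 2).
Proof.
move=> cs; apply: sqr_le_norm; first exact: sqrtr_ge0.
rewrite sqr_sqrtr ?addr_ge0 ?sqr_ge0//.
have : (a * c + b * s) ^+ 2 + (a * s - b * c) ^+ 2 = (a ^+ 2 + b ^+ 2) * (c ^+ 2 + s ^+ 2).
  by ring.
by rewrite cs mulr1 => <-; rewrite lerDl sqr_ge0.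
Qed.

Lemma fterm_le v k x : `|fterm v k x| <= fmod v k.
Proof. by apply: rot_le; exact: cos2Dsin2. Qed.

Lemma fmod_le v k : continuous v -> fmod v k <= 2 * cint (fun x => `|v x|).
Proof.
move=> cv.
have C : `|fcos v k| <= cint (fun x => `|v x|).
  apply: le_trans (le_norm_cint _) _; first exact: continuous_mul cv (continuous_cosM (omega k)).
  apply: le_cint; [|exact: continuous_norm|].
    by apply: continuous_norm; exact: continuous_mul cv (continuous_cosM (omega k)).
  by move=> x; rewrite normrM ler_piMr// cos_norm_le1.
have S : `|fsin v k| <= cint (fun x => `|v x|).
  apply: le_trans (le_norm_cint _) _; first exact: continuous_mul cv (continuous_sinM (omega k)).
  apply: le_cint; [|exact: continuous_norm|].
    by apply: continuous_norm; exact: continuous_mul cv (continuous_sinM (omega k)).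
  by move=> x; rewrite normrM ler_piMr// sin_norm_le1.
rewrite -[leLHS]ger0_norm ?fmod_ge0//; apply: sqr_le_norm.
  by rewrite mulr_ge0// (le_trans _ C).
rewrite fmod_sqr -[_ ^+ 2]real_normK ?num_real// -[fsin _ _ ^+ 2]real_normK ?num_real//.
have := normr_ge0 (fcos v k); have := normr_ge0 (fsin v k).
move: C S; move: `|_| `|_| (cint _) => a b c *; nra.
Qed.

Lemma continuous_fterm v k : continuous (fterm v k).
Proof.
apply: continuous_add; apply: continuous_scale; first exact: continuous_cosM.
exact: continuous_sinM.
Qed.

Lemma continuous_fpartial v n : continuous (fpartial v n).
Proof.
apply: continuous_add; first exact: continuous_cst.
by apply: continuous_scale; apply: continuous_sum => i; exact: continuous_fterm.
Qed.

Arguments continuous_fterm : clear implicits.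
Arguments continuous_fpartial : clear implicits.

Lemma fterm_conv v k x : continuous v ->
  fterm v k x = cint (fun y => v y * cos (omega k * (x - y))).
Proof.
move=> cv; rewrite /fterm mulrC [X in _ + X]mulrC /fcos /fsin.
have c1 := continuous_mul cv (continuous_cosM (omega k)).
have c2 := continuous_mul cv (continuous_sinM (omega k)).
rewrite -!cintZ//= -cintD; try exact: continuous_scale.
by apply: eq_cint => y; rewrite mulrBr cosB; ring.
Qed.

Lemma continuous_cos_conv (c x : R) : continuous (fun y => cos (c * (x - y))).
Proof.
rewrite (_ : (fun y => _) = (fun y => cos (- c * y + c * x))).
  exact: continuous_cosl.
by apply/funext => y; congr cos; ring.
Qed.

Arguments continuous_cos_conv : clear implicits.

Lemma continuous_dirichlet n x : continuous (fun y : R => dirichlet n (x - y)).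
Proof.
apply: continuous_add; first exact: continuous_cst.
apply: continuous_scale; apply: continuous_sum => i.
exact: continuous_cos_conv.
Qed.

Lemma continuous_fejer n x : continuous (fun y : R => fejer n (x - y)).
Proof. by apply: continuous_sum => i; exact: continuous_dirichlet. Qed.

Arguments continuous_dirichlet : clear implicits.
Arguments continuous_fejer : clear implicits.

Lemma fpartial_conv v n x : continuous v ->
  fpartial v n x = cint (fun y => v y * dirichlet n (x - y)).
Proof.
move=> cv; have cc i := continuous_mul cv (continuous_cos_conv (omega i) x).
rewrite (@eq_cint _ _ (fun y => v y +
    2 * \sum_(i < n) v y * cos (omega i.+1 * (x - y)))); last first.
  by move=> y; rewrite /dirichlet mulrDr mulr1 mulrCA mulr_sumr.
have cs : continuous (fun y => \sum_(i < n) v y * cos (omega i.+1 * (x - y))).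
  exact: continuous_sum.
rewrite cintD//; last exact: continuous_scale.
rewrite cintZ// cint_sum// /fpartial; congr (_ + 2 * _).
  by apply: eq_cint => y; rewrite omega0 mul0r cos0 mulr1.
by apply: eq_bigr => i _; exact: fterm_conv.
Qed.

Lemma cint_dirichlet n x : cint (fun y : R => dirichlet n (x - y)) = 1.
Proof.
(* The mean of the kernel is the partial sum of the Fourier series of the constant 1. *)
have := fpartial_conv n x (continuous_cst (1 : R)); rewrite (eq_cint (w := fun y => dirichlet n (x - y))).
  move=> <-; rewrite /fpartial big1 ?mulr0 ?addr0; last first.
    move=> i _; rewrite /fterm.
    have -> : fcos (fun=> 1) i.+1 = 0.
      rewrite /fcos -[RHS](@cint_cosl R i.+1 0)//; apply: eq_cint => y.
      by rewrite mul1r addr0.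
    have -> : fsin (fun=> 1) i.+1 = 0.
      rewrite /fsin -[RHS](@cint_cosl R i.+1 (- (pi / 2)))//; apply: eq_cint => y.
      by rewrite mul1r cosBpihalf.
    by rewrite !mul0r addr0.
  rewrite /fcos -[RHS](@cint_cst R 1); apply: eq_cint => y.
  by rewrite omega0 mul0r cos0 mulr1.
by move=> y; rewrite mul1r.
Qed.

Lemma fejer_conv v n x : continuous v ->
  \sum_(i < n) fpartial v i x = cint (fun y => v y * fejer n (x - y)).
Proof.
move=> cv; rewrite (@eq_cint _ _ (fun y => \sum_(i < n) v y * dirichlet i (x - y))).
  rewrite cint_sum; last by move=> i; apply: continuous_mul => //; exact: continuous_dirichlet.
  by apply: eq_bigr => i _; exact: fpartial_conv.
by move=> y; rewrite /fejer mulr_sumr.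
Qed.

Lemma cint_fejer n x : cint (fun y : R => fejer n (x - y)) = n%:R.
Proof.
rewrite /fejer cint_sum; last by move=> i; exact: continuous_dirichlet.
rewrite (eq_bigr (fun=> 1)); last by move=> i _; exact: cint_dirichlet.
by rewrite sumr_const card_ord.
Qed.

(* The weight [s] balances the two halves of AM-GM: [v y - v x] is
   dominated by [s (v y - v x)^2 + 1/s], and the square absorbs the singularity
   of the Fejer kernel. *)
Lemma fejer_error v n x L s : continuous v -> periodic v 1 ->
  (forall a b, `|v a - v b| <= L * `|a - b|) -> 0 < s ->
  `|\sum_(i < n) fpartial v i x - n%:R * v x| <= s * (8 * L ^+ 2) + s^-1 * n%:R.
Proof.
move=> cv pv vL s0.
have cF := continuous_fejer n x.
have cvx : continuous (fun y => v y - v x) by apply: continuous_sub => //; exact: continuous_cst.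
rewrite fejer_conv// mulrC -(cint_fejer n x) -!cintZ// -cintB; first last.
- exact: continuous_scale.
- exact: continuous_mul.
rewrite (@eq_cint _ _ (fun y => (v y - v x) * fejer n (x - y))); last first.
  by move=> y; rewrite mulrBl.
rewrite -[s * _](@cint_cst R) -cintD; first last.
- exact: continuous_scale.
- exact: continuous_cst.
apply: le_trans (le_norm_cint _) _; first exact: continuous_mul.
apply: le_cint.
- by apply: continuous_norm; exact: continuous_mul.
- by apply: continuous_add; [exact: continuous_cst|exact: continuous_scale].
move=> y; rewrite normrM (ger0_norm (fejer_ge0 _ _)).
have h1 := periodic_lip_sin x y pv vL.
have h2 := @sin2_fejer_le R n (x - y).
have F0 := @fejer_ge0 R n (x - y).
move: h1 h2 F0; set S := sin _ ^+ 2; set F := fejer _ _; set w := v y - v x.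
move=> h1 h2 F0.
have h3 : w ^+ 2 * F <= 8 * L ^+ 2.
  apply: le_trans (ler_wpM2r F0 h1) _.
  rewrite (_ : 8 * L ^+ 2 = 4 * L ^+ 2 * 2); last by ring.
  by rewrite -[leLHS]mulrA; apply: ler_wpM2l => //; rewrite mulr_ge0// sqr_ge0.
have h4 : `|w| <= s * w ^+ 2 + s^-1.
  rewrite -(real_normK (num_real w)); move: `|w| => W.
  have : 0 <= s * (W - s^-1) ^+ 2 by rewrite mulr_ge0 ?sqr_ge0 ?ltW.
  have -> : s * (W - s^-1) ^+ 2 = s * W ^+ 2 - 2 * W + s^-1 by field; rewrite gt_eqF.
  have [W0|W0] := leP 0 W; first by lra.
  have : 0 < s^-1 by rewrite invr_gt0.
  have : 0 <= s * W ^+ 2 by rewrite mulr_ge0 ?sqr_ge0 ?ltW.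
  lra.
apply: le_trans (ler_wpM2r F0 h4) _.
by rewrite mulrDl -mulrA lerD2r ler_wpM2l// ltW.
Qed.

(** Convergence of the partial sums is assumed and only the limit has to be identified. By Cesaro it
    is also the limit of the Fejer means, which [fejer_error] compares with [v x]. *)
Lemma fourier_inversion v x L l : continuous v -> periodic v 1 ->
  (forall a b, `|v a - v b| <= L * `|a - b|) ->
  fpartial v n x @[n --> \oo] --> l -> l = v x.
Proof.
move=> cv pv vL /cesaro cl.
apply: (@cvg_unique _ _ _ _ _ _ cl) => //.
apply/cvgrPdist_le => e e0.
near=> n.
rewrite /arithmetic_mean/= seriesEord distrC.
have n0 : 0 < n.+1%:R :> R by rewrite ltr0n.
have -> : n.+1%:R^-1 * \sum_(i < n.+1) fpartial v i x - v x =
    n.+1%:R^-1 * (\sum_(i < n.+1) fpartial v i x - n.+1%:R * v x).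
  by field; rewrite gt_eqF.
rewrite normrM gtr0_norm ?invr_gt0// mulrC ler_pdivrMr//.
(* With the weight s = 2 / e, the term n / s costs e n / 2, and the other term does not depend on
   n. *)
have s0 : 0 < 2 / e by rewrite divr_gt0.
apply: le_trans (fejer_error n.+1 x cv pv vL s0) _.
have : 2 / e * (8 * L ^+ 2) <= e / 2 * n.+1%:R.
  rewrite -ler_pdivrMl ?divr_gt0//.
  near: n.
  have := @nbhs_infty_ger R ((e / 2)^-1 * (2 / e * (8 * L ^+ 2))).
  by apply: filterS => n /le_trans; apply; rewrite ler_nat.
have -> : (2 / e)^-1 = e / 2 by rewrite invf_div.
lra.
Unshelve. all: end_near. Qed.

End FourierCoef.
Arguments continuous_fterm {R} v k.
Arguments continuous_fpartial {R} v n.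

(** * Fourier multipliers *)

Section SumLimit.
Context {R : realType}.

Lemma cvg_norm_le (u : nat -> R) (l c e : R) N : u n @[n --> \oo] --> l ->
  (forall n, (N <= n)%N -> `|u n - c| <= e) -> `|l - c| <= e.
Proof.
move=> ul ue.
have H : `|u n - c| @[n --> \oo] --> `|l - c|.
  by apply: cvg_norm; apply: cvgB => //; exact: cvg_cst.
apply: (@closed_cvg _ _ _ eventually_filter (fun n => `|u n - c|) [set y : R | y <= e]) H => //.
  by exists N => //= n Nn; exact: ue.
Qed.

Lemma cvg_ge_bound (u : nat -> R) (l c : R) N : u n @[n --> \oo] --> l ->
  (forall n, (N <= n)%N -> c <= u n) -> c <= l.
Proof.
move=> ul cu; apply: (@closed_cvg _ _ _ eventually_filter u [set y : R | c <= y]) ul => //.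
by exists N => //= n Nn; exact: cu.
Qed.

Lemma cvg_le_bound (u : nat -> R) (l c : R) N : u n @[n --> \oo] --> l ->
  (forall n, (N <= n)%N -> u n <= c) -> l <= c.
Proof.
move=> ul cu; apply: (@closed_cvg _ _ _ eventually_filter u [set y : R | y <= c]) ul => //.
by exists N => //= n Nn; exact: cu.
Qed.

Lemma inv_sqr_le_telescope (i : nat) :
  i.+1%:R^-2 <= 2 * (i.+1%:R^-1 - i.+2%:R^-1) :> R.
Proof.
have i0 : 0 < i.+1%:R :> R by rewrite ltr0n.
have -> : i.+2%:R = i.+1%:R + 1 :> R by rewrite -[i.+2]addn1 natrD.
move: i.+1%:R (ler1n R i.+1) i0 => /= a a1 a0.
have -> : 2 * (a^-1 - (a + 1)^-1) = 2 / (a * (a + 1)).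
  by field; rewrite !gt_eqF// addr_gt0.
rewrite -exprVn -[X in X <= _]mul1r ler_pdivlMr ?mulr_gt0 ?addr_gt0//.
have -> : 1 * a^-1 ^+ 2 * (a * (a + 1)) = 1 + a^-1 by field; rewrite gt_eqF.
have : a^-1 <= 1 by rewrite invf_le1.
lra.
Qed.

Lemma sum_tail_le (a : nat -> R) B n d : (forall i, `|a i| <= B * i.+1%:R^-2) -> 0 <= B ->
  \sum_(n <= i < n + d) `|a i| <= 2 * B * (n.+1%:R^-1 - (n + d).+1%:R^-1).
Proof.
move=> aB B0; elim: d => [|d IH].
  by rewrite addn0 big_geq// subrr mulr0.
rewrite addnS big_nat_recr/= ?leq_addr//.
have := aB (n + d)%N; have := ler_wpM2l B0 (inv_sqr_le_telescope (n + d)).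
move=> h1 h2; apply: le_trans (lerD IH (le_trans h2 h1)) _.
by rewrite le_eqVlt; apply/orP; left; apply/eqP; ring.
Qed.

Lemma partial_sum_le (s : nat -> R) (c l : R) n : 0 <= c -> (forall i, 0 <= s i) ->
  c * \sum_(i < n) s i @[n --> \oo] --> l -> c * \sum_(i < n) s i <= l.
Proof.
move=> c0 s0 cv; apply: (cvg_ge_bound (N := n) cv) => k nk; rewrite ler_wpM2l//.
by rewrite -!(big_mkord xpredT s) (big_cat_nat (leq0n n) nk)/= lerDl sumr_ge0.
Qed.

(** The rate depends on [B] alone; applied at each point x, it gives convergence uniform in x. *)
Lemma sum_cvg (a : nat -> R) B : (forall i, `|a i| <= B * i.+1%:R^-2) ->
  exists2 l, \sum_(i < n) a i @[n --> \oo] --> l &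
    forall n, `|\sum_(i < n) a i - l| <= 2 * B / n.+1%:R.
Proof.
move=> aB.
have B0 : 0 <= B by have := aB 0%N; rewrite expr1n invr1 mulr1; apply: le_trans.
have sumE n : \sum_(i < n) a i = series a n by rewrite seriesEord.
have cv : cvgn (series a).
  apply: normed_cvg; apply: nondecreasing_is_cvgn.
    by apply/nondecreasing_seqP => n; rewrite /= /series/= big_nat_recr//= lerDl.
  exists (2 * B) => _ [n _ <-].
  rewrite /series/= -{1}[n]add0n; apply: le_trans (sum_tail_le 0 n aB B0) _.
  have h : 0 <= (0 + n).+1%:R^-1 :> R by rewrite invr_ge0.
  rewrite invr1 ler_piMr ?mulr_ge0//; lra.
exists (limn (series a)); first by under eq_fun do rewrite sumE.
move=> n; rewrite sumE distrC; apply: (@cvg_norm_le (series a) _ _ _ n cv) => m nm.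
rewrite sub_series_geq//; apply: le_trans (ler_norm_sum _ _ _) _.
rewrite -(subnKC nm); apply: le_trans (sum_tail_le _ _ aB B0) _.
by rewrite ler_wpM2l ?mulr_ge0// gerBl invr_ge0.
Qed.

End SumLimit.

(** * Periodic jets, multiplier series and Parseval identities *)

Section Jets.
Context {R : realType}.
Implicit Types (G H : nat -> R -> R) (v w : R -> R).

(** A smooth function is carried along with all its derivatives: [G j] is the j-th derivative of
    [G 0]. *)
Definition jet G : Prop := forall j (x : R), is_derive x (1 : R) (G j) (G j.+1 x).

Definition pjet G : Prop := jet G /\ periodic (G 0%N) 1.

Lemma jet_continuous G j : jet G -> continuous (G j).
Proof. by move=> jG; exact: is_derive_continuous (jG j). Qed.

Arguments jet_continuous [G] j.

Lemma is_derive1_unique (F : R -> R) (x a b : R) :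
  is_derive x (1 : R) F a -> is_derive x (1 : R) F b -> a = b.
Proof. by move=> da db; rewrite -(@derive_val _ _ _ _ _ _ _ da) (@derive_val _ _ _ _ _ _ _ db). Qed.

Lemma is_derive1_shift (F : R -> R) (x c a : R) : is_derive (x + c) (1 : R) F a ->
  is_derive x (1 : R) (fun y => F (y + c)) a.
Proof.
move=> dF; have := @is_derive1_chain R F (fun y => 1 * y + c) x a 1.
rewrite mul1r mulr1 => H; have {}H := H dF (is_derive1_affine 1 c x).
rewrite (_ : (fun y => F (y + c)) = (fun y => F (1 * y + c)))//.
by apply/funext => y; rewrite mul1r.
Qed.

Lemma pjet_periodic G j : pjet G -> periodic (G j) 1.
Proof.
move=> [jG pG]; elim: j => // j IH x.
apply: (@is_derive1_unique (G j) x); last exact: jG.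
have := is_derive1_shift (jG j (x + 1)).
by rewrite (_ : (fun y => G j (y + 1)) = G j)//; apply/funext => y; rewrite IH.
Qed.

Lemma pjet_shift G m : pjet G -> pjet (fun j => G (m + j)%N).
Proof.
move=> pG; split; first by move=> j x; rewrite addnS; exact: pG.1.
exact: pjet_periodic.
Qed.

Lemma periodic_bounded v : continuous v -> periodic v 1 -> exists M, forall x, `|v x| <= M.
Proof.
move=> cv pv.
have [c _ cM] := EVT_max (@ler01 R) (continuous_subspaceT (continuous_norm cv)).
exists `|v c| => x.
rewrite -(int_shift (- Num.floor x) x pv); apply: cM.
have /andP[] := floor_itv x; rewrite intrD1 in_itv/= mulrNz => h1 h2.
by apply/andP; split; lra.
Qed.

Lemma derive_lip (F f : R -> R) M : (forall x : R, is_derive x (1 : R) F (f x)) ->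
  (forall x, `|f x| <= M) -> forall a b : R, `|F a - F b| <= M * `|a - b|.
Proof.
move=> dF fM.
have H a b : a < b -> `|F a - F b| <= M * `|a - b|.
  move=> ab; have [c _] := MVT ab (fun x _ => dF x)
    (continuous_subspaceT (is_derive_continuous dF)).
  rewrite distrC => ->; rewrite normrM [`|a - b|]distrC.
  by rewrite ler_wpM2r.
move=> a b; have [ab|ab|->] := ltgtP a b; first exact: H.
  by rewrite distrC [`|a - b|]distrC; exact: H.
by rewrite !subrr normr0 mulr0.
Qed.

Lemma fcos_derive G j k : pjet G -> fcos (G j.+1) k = omega k * fsin (G j) k.
Proof.
move=> pG; have cG := jet_continuous j pG.1; have cG1 := jet_continuous j.+1 pG.1.
rewrite /fcos (cintM_parts (pG.1 j) (is_derive_cosM (omega k)) cG1); first last.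
- by move=> x; rewrite mulrDr mulr1 cos_omegaD.
- exact: pjet_periodic.
- exact: continuous_scale (continuous_sinM _).
rewrite -cintZ; last exact: continuous_mul cG (continuous_sinM _).
rewrite -cintN; last exact: continuous_mul cG (continuous_scale _ (continuous_sinM _)).
by apply: eq_cint => x; ring.
Qed.

Lemma fsin_derive G j k : pjet G -> fsin (G j.+1) k = - (omega k * fcos (G j) k).
Proof.
move=> pG; have cG := jet_continuous j pG.1; have cG1 := jet_continuous j.+1 pG.1.
rewrite /fsin (cintM_parts (pG.1 j) (is_derive_sinM (omega k)) cG1); first last.
- by move=> x; rewrite mulrDr mulr1 sin_omegaD.
- exact: pjet_periodic.
- exact: continuous_scale (continuous_cosM _).
rewrite -cintZ; last exact: continuous_mul cG (continuous_cosM _).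
by congr (- _); apply: eq_cint => x; ring.
Qed.

Lemma fmod_derive G j k : pjet G -> fmod (G j) k = omega k ^+ j * fmod (G 0%N) k.
Proof.
move=> pG; elim: j => [|j IH]; first by rewrite expr0 mul1r.
rewrite exprS -mulrA -IH /fmod fcos_derive// fsin_derive//.
move: (omega k) (@omega_ge0 R k) => w w0; rewrite sqrrN !exprMn -mulrDr addrC.
by rewrite sqrtrM ?sqr_ge0// sqrtr_sqr ger0_norm.
Qed.

Lemma fmod_decay G j k A : pjet G -> cint (fun x => `|G j x|) <= A -> (0 < k)%N ->
  fmod (G 0%N) k <= 2 * A / omega k ^+ j.
Proof.
move=> pG GA k0; have w0 : (0 : R) < omega k ^+ j by rewrite exprn_gt0 ?omega_gt0.
rewrite ler_pdivlMr// mulrC -fmod_derive//.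
by apply: le_trans (fmod_le _ (jet_continuous j pG.1)) _; rewrite ler_wpM2l.
Qed.

Lemma omega_ge k : k%:R <= omega k :> R.
Proof.
rewrite /omega ler_peMl//; have := @pi_ge2 R; lra.
Qed.

(** Two derivatives more than the weight requires are spent on making the sum over frequencies
    converge. *)
Lemma fmod_decay_nat G j : pjet G -> exists2 B, 0 <= B &
  forall i, fmod (G 0%N) i.+1 * omega i.+1 ^+ j <= B * i.+1%:R^-2.
Proof.
move=> pG; have cG := jet_continuous (j + 2) pG.1.
have GA := fmod_decay pG (lexx (cint (fun x => `|G (j + 2)%N x|))) (ltn0Sn _).
exists (2 * cint (fun x => `|G (j + 2)%N x|)).
  by rewrite mulr_ge0// cint_ge0.
move=> i; have w0 : 0 < omega i.+1 :> R by rewrite omega_gt0.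
apply: le_trans (ler_wpM2r (exprn_ge0 j (ltW w0)) (GA i)) _.
have A0 : 0 <= 2 * cint (fun x => `|G (j + 2)%N x|) by rewrite mulr_ge0// cint_ge0.
move: (2 * cint _) A0 => A A0.
rewrite -mulrA ler_wpM2l// exprD invfM mulrC mulrA divff ?expf_neq0 ?gt_eqF//.
rewrite mul1r -!exprVn lerXn2r ?nnegrE ?invr_ge0 ?(ltW w0)//.
by rewrite lef_pV2 ?posrE ?ltr0n// omega_ge.
Qed.

(* A Fourier multiplier series is encoded by its symbol on the positive
   frequencies. *)
Definition mult_partial (q : nat -> R) v n x : R := 2 * \sum_(i < n) q i.+1 * fterm v i.+1 x.
Definition mult (q : nat -> R) v x : R := limn (fun n => mult_partial q v n x).

(** The order of the quantifiers matters: [B] is chosen before the symbol, so the tails are uniform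
    over all symbols of the given growth. Passing to the limit in the symbol rests on this. *)
Lemma mult_cvg G M j : pjet G -> 0 <= M ->
  exists2 B, 0 <= B & forall q : nat -> R,
    (forall i, `|q i.+1| <= M * omega i.+1 ^+ j) ->
    forall x, (mult_partial q (G 0%N) n x @[n --> \oo] --> mult q (G 0%N) x) /\
      (forall n, `|mult_partial q (G 0%N) n x - mult q (G 0%N) x| <= B / n.+1%:R).
Proof.
move=> pG M0; have [B B0 HB] := fmod_decay_nat j pG.
exists (4 * (M * B)); first by rewrite !mulr_ge0.
move=> q qM x.
have [i|l sl le] := @sum_cvg R (fun i => q i.+1 * fterm (G 0%N) i.+1 x) (M * B).
  rewrite normrM -mulrA; apply: le_trans (ler_wpM2l M0 (HB i)).
  rewrite [fmod _ _ * _]mulrC mulrA; apply: ler_pM => //; exact: fterm_le.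
have cv : mult_partial q (G 0%N) n x @[n --> \oo] --> 2 * l.
  by apply: cvgM => //; exact: cvg_cst.
have -> : mult q (G 0%N) x = 2 * l by exact/cvg_lim.
split => // n; rewrite /mult_partial -mulrBr normrM ger0_norm//.
rewrite (_ : 4 * (M * B) / n.+1%:R = 2 * (2 * (M * B) / n.+1%:R)); last by ring.
by rewrite ler_wpM2l.
Qed.

Lemma pjet_inversion G x : pjet G -> fcos (G 0%N) 0 = 0 ->
  G 0%N x = mult (fun=> 1) (G 0%N) x.
Proof.
move=> pG c0.
have q1 i : `|(fun=> 1 : R) i.+1| <= 1 * omega i.+1 ^+ 0.
  by rewrite expr0 mulr1 normr1.
have [B B0 HB] := mult_cvg 0 pG ler01.
have [cv _] := HB (fun=> 1) q1 x.
have [L GL] := periodic_bounded (jet_continuous 1 pG.1) (pjet_periodic 1 pG).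
apply/esym/(fourier_inversion (L := L) (jet_continuous 0 pG.1) (pjet_periodic 0 pG)).
  exact: derive_lip (pG.1 0%N) GL.
apply: cvg_trans cv; apply: near_eq_cvg; near=> n.
rewrite /mult_partial /fpartial c0 add0r; congr (2 * _).
by apply: eq_bigr => i _; rewrite mul1r.
Unshelve. all: end_near. Qed.

Lemma cint_unif_cvg (P : nat -> R -> R) (L w : R -> R) B :
  (forall n, continuous (P n)) -> continuous L -> continuous w ->
  (forall n x, `|P n x - L x| <= B / n.+1%:R) ->
  cint (fun x => w x * P n x) @[n --> \oo] --> cint (fun x => w x * L x).
Proof.
move=> cP cL cw PL.
have cw' := continuous_norm cw.
have key n : `|cint (fun x => w x * L x) - cint (fun x => w x * P n x)| <=
    cint (fun x => `|w x|) * (B / n.+1%:R).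
  rewrite -cintB; [|exact: continuous_mul..].
  apply: le_trans (le_norm_cint _) _.
    by apply: continuous_sub; exact: continuous_mul.
  rewrite mulrC -cintZ//; apply: le_cint.
  - by apply: continuous_norm; apply: continuous_sub; exact: continuous_mul.
  - exact: continuous_scale.
  - by move=> x; rewrite -mulrBr normrM mulrC distrC ler_wpM2r.
apply/cvgrPdist_le => e e0; near=> n.
apply: le_trans (key n) _.
rewrite mulrA ler_pdivrMr ?ltr0n// -ler_pdivrMl// mulrC.
near: n; have := @nbhs_infty_ger R (cint (fun x => `|w x|) * B / e).
by apply: filterS => n /le_trans; apply; rewrite ler_nat.
Unshelve. all: end_near. Qed.

Lemma continuous_mult_partial q v n : continuous (mult_partial q v n).
Proof.
apply: continuous_scale; apply: continuous_sum => i.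
by apply: continuous_scale; exact: continuous_fterm.
Qed.

Lemma cint_mul_fterm v w k : continuous w ->
  cint (fun x => w x * fterm v k x) = fcos v k * fcos w k + fsin v k * fsin w k.
Proof.
move=> cw.
have c1 := continuous_mul cw (continuous_cosM (omega k)).
have c2 := continuous_mul cw (continuous_sinM (omega k)).
rewrite {2}/fcos {2}/fsin -!cintZ// -cintD; [|exact: continuous_scale..].
by apply: eq_cint => x; rewrite /fterm; ring.
Qed.

Lemma cint_mul_mult_partial q v w n : continuous w ->
  cint (fun x => w x * mult_partial q v n x) =
  2 * \sum_(i < n) q i.+1 * (fcos v i.+1 * fcos w i.+1 + fsin v i.+1 * fsin w i.+1).
Proof.
move=> cw.
have cwf k := continuous_mul cw (continuous_fterm v k).
rewrite (@eq_cint _ _ (fun x => 2 * \sum_(i < n) q i.+1 * (w x * fterm v i.+1 x))).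
  rewrite cintZ; last by apply: continuous_sum => i; exact: continuous_scale.
  rewrite cint_sum; last by move=> i; exact: continuous_scale.
  congr (2 * _); apply: eq_bigr => i _; rewrite cintZ//.
  by rewrite cint_mul_fterm.
move=> x; rewrite /mult_partial mulrCA mulr_sumr; congr (2 * _).
by apply: eq_bigr => i _; rewrite mulrCA.
Qed.

(** [L] is a continuous function known to equal the multiplier series; uniform convergence allows
    integration term by term against [w]. *)
Lemma parseval_mult q G w L M j : pjet G -> 0 <= M -> continuous w -> continuous L ->
  (forall i, `|q i.+1| <= M * omega i.+1 ^+ j) -> L =1 mult q (G 0%N) ->
  2 * \sum_(i < n) q i.+1 * (fcos (G 0%N) i.+1 * fcos w i.+1 + fsin (G 0%N) i.+1 * fsin w i.+1)
    @[n --> \oo] --> cint (fun x => w x * L x).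
Proof.
move=> pG M0 cw cL qM LE; have [B B0 HB] := mult_cvg j pG M0.
have H : forall n x, `|mult_partial q (G 0%N) n x - L x| <= B / n.+1%:R.
  by move=> n x; rewrite LE; exact: (HB q qM x).2.
have := @cint_unif_cvg (mult_partial q (G 0%N)) L w B
  (fun n => @continuous_mult_partial q (G 0%N) n) cL cw H.
by under eq_fun do rewrite cint_mul_mult_partial//.
Qed.

Lemma parseval G : pjet G -> fcos (G 0%N) 0 = 0 ->
  2 * \sum_(i < n) fmod (G 0%N) i.+1 ^+ 2 @[n --> \oo] --> cint (fun x => G 0%N x ^+ 2).
Proof.
move=> pG c0.
have q1 i : `|(fun=> 1 : R) i.+1| <= 1 * omega i.+1 ^+ 0.
  by rewrite expr0 mulr1 normr1.
have cG := jet_continuous 0 pG.1.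
have := @parseval_mult (fun=> 1) G (G 0%N) (G 0%N) 1 0%N pG ler01 cG cG q1 (fun x => pjet_inversion x pG c0).
under [X in _ --> X -> _]eq_cint do rewrite -expr2.
apply: cvg_trans; apply: near_eq_cvg; near=> n; congr (2 * _).
by apply: eq_bigr => i _; rewrite mul1r fmod_sqr !expr2.
Unshelve. all: end_near. Qed.

End Jets.

(** * The fractional Laplacian and the H^s norm as series over positive frequencies *)

Section FractionalLaplacian.
Context {R : realType}.
Implicit Types (v : R -> R) (G : nat -> R -> R).

Lemma sym_sum (f : int -> R) N : (forall k, f (- k) = f k) ->
  \sum_(j < N.*2.+1) f (j%:Z - N%:Z) = f 0 + 2 * \sum_(i < N) f i.+1%:Z.
Proof.
move=> fN; elim: N => [|N IH].
  by rewrite big_ord_recl !big_ord0 mulr0 subr0.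
rewrite doubleS big_ord_recl big_ord_recr/= [in RHS]big_ord_recr/=.
rewrite (eq_bigr (fun j : 'I_N.*2.+1 => f (j%:Z - N%:Z))); last first.
  by move=> j _; congr f; rewrite /bump/=; lia.
rewrite IH sub0r fN (_ : (bump 0 N.*2.+1)%:Z - N.+1%:Z = N.+1%:Z); first by ring.
by rewrite /bump/=; lia.
Qed.

Lemma fourier_cos v (k : int) :
  cint (fun x => v x * cos (2 * pi * k%:~R * x)) = fcos v `|k|%N.
Proof.
case: k => n //; apply: eq_cint => x; congr (_ * _).
by rewrite NegzE abszN mulrNz mulrN mulNr cosN.
Qed.

Lemma fourier_sin v (k : int) : continuous v ->
  cint (fun x => v x * sin (2 * pi * k%:~R * x)) = (-1) ^+ (k < 0)%R * fsin v `|k|%N.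
Proof.
move=> cv; case: k => n; first by rewrite mul1r.
rewrite NegzE abszN /= expr1 mulN1r /fsin -cintN; last first.
  exact: continuous_mul cv (continuous_sinM _).
by apply: eq_cint => x; rewrite mulrNz mulrN mulNr sinN mulrN.
Qed.

Lemma normc_fourier_coef v (k : int) : continuous v ->
  ComplexField.Normc.normc (fourier_coef v k) ^+ 2 = fmod v `|k|%N ^+ 2.
Proof.
move=> cv; rewrite /fourier_coef -/(cint _) -/(cint _) fourier_cos fourier_sin//=.
by rewrite sqrrN exprMn sqrr_sign mul1r.
Qed.

Lemma Re_fourier_term v (k : int) x (l : R) : continuous v ->
  complex.Re (real_complex R l * fourier_coef v k * fourier_exp k x)%C =
  l * fterm v `|k|%N x.
Proof.
move=> cv; rewrite /fourier_coef -/(cint _) -/(cint _) fourier_cos fourier_sin//=.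
rewrite /fterm; move: (fcos v _) (fsin v _) => a b.
transitivity (l * (a * cos (2 * pi * k%:~R * x) +
  (-1) ^+ (k < 0)%R * b * sin (2 * pi * k%:~R * x))); first by ring.
congr (_ * (_ * _ + _)).
  by case: k => n //; rewrite NegzE abszN mulrNz mulrN mulNr cosN.
rewrite mulrAC mulrC; congr (_ * _); case: k => n; first by rewrite mul1r.
by rewrite NegzE abszN /= expr1 mulN1r mulrNz mulrN mulNr sinN opprK.
Qed.

Definition flap_symbol (alpha : R) (k : nat) : R := omega k `^ alpha.

Lemma frac_lapE (alpha : R) v x : 0 < alpha -> continuous v ->
  frac_lap alpha v x = mult (flap_symbol alpha) v x.
Proof.
move=> a0 cv; rewrite /frac_lap /mult; congr (lim (_ @ \oo)); apply/funext => N.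
rewrite raddf_sum (eq_bigr (fun j : 'I_N.*2.+1 => (fun k : int =>
  (2 * pi * `|k%:~R|) `^ alpha * fterm v `|k|%N x) (j%:Z - N%:Z))); last first.
  by move=> j _; exact: Re_fourier_term.
rewrite (@sym_sum (fun k : int => (2 * pi * `|k%:~R|) `^ alpha * fterm v `|k|%N x)).
  (* The frequency 0 drops out because 0 to the power [alpha] is 0 for positive [alpha]. *)
  rewrite normr0 mulr0 powR0 ?gt_eqF// mul0r add0r /mult_partial; congr (2 * _).
  apply: eq_bigr => i _; congr (_ `^ _ * _).
  by rewrite -[_%:~R]/(i.+1%:R) normr_nat.
by move=> k; rewrite mulrNz normrN abszN.
Qed.

Lemma fsbig_sym (f : int -> R) N : (forall k, f (- k) = f k) ->
  (\sum_(k \in [set` [seq j%:Z - N%:Z | j <- iota 0 N.*2.+1]%R]) (f k)%:E =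
   (f 0 + 2 * \sum_(i < N) f i.+1%:Z)%:E)%E.
Proof.
move=> fN; rewrite -fsbig_seq; last first.
  by rewrite map_inj_uniq ?iota_uniq// => i j /addIr [].
rewrite big_map -sym_sum// -sumEFin.
by rewrite -(big_mkord xpredT (fun j => (f (j%:Z - N%:Z))%:E)) /index_iota subn0.
Qed.

Lemma sobolevH_term v s (k : int) : continuous v ->
  `|k%:~R| `^ (2 * s) * ComplexField.Normc.normc (fourier_coef v k) ^+ 2 =
  `|k|%:R `^ (2 * s) * fmod v `|k|%N ^+ 2 :> R.
Proof.
move=> cv; rewrite normc_fourier_coef//; congr (_ `^ _ * _).
by case: k => n; rewrite ?NegzE ?mulrNz ?normrN ?abszN !ger0_norm.
Qed.

Lemma sobolevH_le v s B : continuous v -> 0 < s ->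
  (forall n, 2 * \sum_(i < n) i.+1%:R `^ (2 * s) * fmod v i.+1 ^+ 2 <= B) ->
  (sobolevH s v <= ((2 * pi) `^ s * B `^ 2^-1)%:E)%E.
Proof.
move=> cv s0 HB; rewrite /sobolevH EFinM lee_pmul2l//; last first.
  by rewrite lte_fin powR_gt0// mulr_gt0// pi_gt0.
have B0 : 0 <= B by have := HB 0%N; rewrite big_ord0 mulr0.
rewrite -poweR_EFin; apply: gt0_ler_poweR; rewrite ?invr_ge0//.
- rewrite in_itv/= leey andbT; apply: esum_ge0 => k _.
  by rewrite lee_fin mulr_ge0 ?powR_ge0 ?sqr_ge0.
- by rewrite in_itv/= leey andbT lee_fin.
(* The sum over the integers is a supremum over finite sets, and each of these lies in a symmetric
   window [-N, N]. *)
apply: ge_ereal_sup => _ [F [fF _] <-].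
have /finite_seqP[r Fr] := fF.
pose N := \max_(k <- r) `|k|%N.
pose f (k : int) : R := `|k|%:R `^ (2 * s) * fmod v `|k|%N ^+ 2.
have -> : (\sum_(k \in F) (`|k%:~R| `^ (2 * s) *
    ComplexField.Normc.normc (fourier_coef v k) ^+ 2)%:E = \sum_(k \in F) (f k)%:E)%E.
  by apply: eq_fsbigr => k _; rewrite sobolevH_term.
apply: (@le_trans _ _ (\sum_(k \in [set` [seq j%:Z - N%:Z | j <- iota 0 N.*2.+1]%R]) (f k)%:E)%E).
  apply: lee_fsum_nneg_subset => //; first exact: finite_seq.
    move=> k; rewrite Fr !mem_setE => kr.
    have kN : (`|k| <= N)%N by apply: leq_bigmax_seq.
    apply/mapP; exists (absz ((k : int) + N%:Z)); last by lia.
    by rewrite mem_iota; lia.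
  by move=> k _; rewrite lee_fin mulr_ge0 ?powR_ge0 ?sqr_ge0.
rewrite fsbig_sym; last by move=> k; rewrite /f abszN.
rewrite lee_fin /f/= powR0 ?mulf_neq0 ?gt_eqF// mul0r add0r.
exact: HB.
Qed.

Lemma sobolevH_ge v s B n : continuous v -> 0 < s -> 0 <= B ->
  B <= 2 * \sum_(i < n) i.+1%:R `^ (2 * s) * fmod v i.+1 ^+ 2 ->
  (((2 * pi) `^ s * B `^ 2^-1)%:E <= sobolevH s v)%E.
Proof.
move=> cv s0 B0 HB; rewrite /sobolevH EFinM lee_pmul2l//; last first.
  by rewrite lte_fin powR_gt0// mulr_gt0// pi_gt0.
rewrite -poweR_EFin; apply: gt0_ler_poweR; rewrite ?invr_ge0//.
- by rewrite in_itv/= leey andbT lee_fin.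
- rewrite in_itv/= leey andbT; apply: esum_ge0 => k _.
  by rewrite lee_fin mulr_ge0 ?powR_ge0 ?sqr_ge0.
pose f (k : int) : R := `|k|%:R `^ (2 * s) * fmod v `|k|%N ^+ 2.
apply: esum_ge; exists [set` [seq j%:Z - n%:Z | j <- iota 0 n.*2.+1]].
  by split => //; exact: finite_seq.
under eq_fsbigr do rewrite sobolevH_term//.
rewrite (@fsbig_sym f); last by move=> k; rewrite /f abszN.
by rewrite lee_fin /f/= powR0 ?mulf_neq0 ?gt_eqF// mul0r add0r.
Qed.

End FractionalLaplacian.

(** * The maximum principle for the fractional Laplacian *)

Section Powers.
Context {R : realType}.
Implicit Types (a b r t : R).

Lemma powR_add a r t : 0 < a -> a `^ (r + t) = a `^ r * a `^ t.
Proof. by move=> a0; rewrite powRD//; apply/implyP => _; rewrite gt_eqF. Qed.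

Lemma powR_exp_le a r t : 1 <= a -> r <= t -> a `^ r <= a `^ t.
Proof. by move=> a1 rt; exact: ler_powR. Qed.

Lemma powR_exp_ge a r t : 0 < a <= 1 -> t <= r -> a `^ r <= a `^ t.
Proof. by move=> a1 rt; exact: (ger_powR a1). Qed.

Lemma powR_Nnat a n : 0 <= a -> a ^- n = a `^ (- n%:R).
Proof. by move=> a0; rewrite powRN powR_mulrn. Qed.

Lemma powR_monol a b r : 0 <= r -> 0 <= a -> a <= b -> a `^ r <= b `^ r.
Proof.
by move=> r0 a0 ab; apply: ge0_ler_powR; rewrite ?nnegrE//; exact: le_trans ab.
Qed.

Lemma powR_antil a b r : r <= 0 -> 0 < a -> a <= b -> b `^ r <= a `^ r.
Proof.
move=> r0 a0 ab; have b0 := lt_le_trans a0 ab.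
rewrite -[r]opprK !(powRN _ (- r)) lef_pV2 ?posrE ?powR_gt0//.
by apply: powR_monol => //; [rewrite oppr_ge0|exact: ltW].
Qed.

Lemma powR_one r : 1 `^ r = 1 :> R.
Proof. by rewrite powR1. Qed.

Lemma powR_le1 a r : 0 <= a <= 1 -> 0 <= r -> a `^ r <= 1.
Proof. by move=> /andP[a0 a1] r0; rewrite -[leRHS](powR_one r); exact: powR_monol. Qed.

Lemma powR_ge1 a r : 1 <= a -> 0 <= r -> 1 <= a `^ r.
Proof. by move=> a1 r0; rewrite -[leLHS](powR_one r); exact: powR_monol. Qed.

Lemma powR_le2 a r : 0 <= a <= 2 -> 0 <= r <= 1 -> a `^ r <= 2.
Proof.
move=> /andP[a0 a2] /andP[r0 r1]; have [le1|gt1] := leP a 1.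
  by apply: le_trans (powR_le1 _ _) _; rewrite ?a0 ?le1// ler1n.
by apply: le_trans (ler1_powR (ltW gt1) r1) a2.
Qed.

Lemma powR_onem_le2 a r c : `|a| <= c -> c < 1 -> 0 < r < 1 -> (1 - a) `^ r <= 2.
Proof.
rewrite ler_norml => /andP[h1 h2] c1 /andP[r0 r1].
by apply: powR_le2; apply/andP; split; lra.
Qed.

End Powers.

(** * The binomial series of (1 - z)^s for 0 < s < 1 *)

Section BinomialSeries.
Context {R : realType}.
Variable s : R.
Hypothesis s01 : 0 < s < 1.

(* [bincoef n] is the coefficient of [z^(n+1)] in [1 - (1 - z)^s]. *)
Fixpoint bincoef (n : nat) : R :=
  if n is m.+1 then bincoef m * (m.+1%:R - s) / m.+2%:R else s.

Definition binpoly (n : nat) (z : R) : R := 1 - \sum_(i < n) bincoef i * z ^+ i.+1.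

Lemma binpolyS n z : binpoly n.+1 z = binpoly n z - bincoef n * z ^+ n.+1.
Proof. by rewrite /binpoly big_ord_recr/= opprD addrA. Qed.

Lemma bincoef_ge0 n : 0 <= bincoef n.
Proof.
case/andP: s01 => s0 s1; elim: n => [|n IH]; first exact: ltW.
rewrite /= divr_ge0// mulr_ge0// subr_ge0 (le_trans (ltW s1))// ler1n//.
Qed.

Lemma bincoefS n : n.+2%:R * bincoef n.+1 = bincoef n * (n.+1%:R - s).
Proof. by rewrite /= mulrC divfK// pnatr_eq0. Qed.

Lemma bincoef_le n : n.+1%:R * bincoef n <= s.
Proof.
case/andP: s01 => s0 s1; elim: n => [|n IH]; first by rewrite mul1r.
rewrite bincoefS; apply: le_trans IH; rewrite mulrC ler_wpM2r ?bincoef_ge0//; lra.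
Qed.

(** A closed form at z = 1, from which nonnegativity there is immediate. *)
Lemma binpoly1 n : s * binpoly n 1 = n.+1%:R * bincoef n.
Proof.
elim: n => [|n IH]; first by rewrite /binpoly big_ord0 subr0 mulr1 mul1r.
by rewrite binpolyS mulrBr IH expr1n mulr1 bincoefS; ring.
Qed.

(** All coefficients after the constant one are nonpositive, so the polynomial is smallest at z = 1
    on [0, 1]. *)
Lemma binpoly_ge0 n z : 0 <= z <= 1 -> 0 <= binpoly n z.
Proof.
move=> /andP[z0 z1]; case/andP: s01 => s0 s1.
apply: (@le_trans _ _ (binpoly n 1)).
  by rewrite -(pmulr_rge0 _ s0) binpoly1 mulr_ge0 ?bincoef_ge0.
rewrite /binpoly lerD2l lerN2; apply: ler_sum => i _.
by rewrite ler_wpM2l ?bincoef_ge0// expr1n exprn_ile1.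
Qed.

Lemma binpoly_norm_le n z : `|z| <= 1 -> `|binpoly n z| <= 2.
Proof.
move=> z1; rewrite (_ : 2 = 1 + 1)//; apply: le_trans (ler_normB _ _) _.
rewrite normr1 lerD2l; apply: le_trans (ler_norm_sum _ _ _) _.
apply: (@le_trans _ _ (\sum_(i < n) bincoef i)).
  apply: ler_sum => i _; rewrite normrM ger0_norm ?bincoef_ge0// ler_piMr ?bincoef_ge0//.
  by rewrite normrX exprn_ile1.
have := @binpoly_ge0 n 1; rewrite lexx ler01 => /(_ isT); rewrite /binpoly subr_ge0.
by under eq_bigr do rewrite expr1n mulr1.
Qed.

Definition binpoly' (n : nat) (z : R) : R := - \sum_(i < n) bincoef i * (i.+1%:R * z ^+ i).

Lemma is_derive_exp n (z : R) : is_derive z (1 : R) (fun x => x ^+ n.+1) (n.+1%:R * z ^+ n).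
Proof.
elim: n => [|n IH]; first by rewrite expr0 mulr1; under eq_fun do rewrite expr1; exact: is_derive_id.
have := is_derive1M IH (is_derive_id z (1 : R)).
under eq_fun do rewrite -exprSr.
by move=> d; apply: (is_derive_eq d); rewrite mulr1 -mulrA -exprSr -[n.+2%:R]natr1 mulrDl mul1r.
Qed.

Lemma is_derive_binpoly n z : is_derive z (1 : R) (binpoly n) (binpoly' n z).
Proof.
have := is_derive1B (is_derive_cst (1 : R) z (1 : R))
  (@is_derive1_sum _ _ (index_enum 'I_n) xpredT _ _ z
    (fun i : 'I_n => is_derive1Z (bincoef i) (is_derive_exp i z))).
by rewrite sub0r.
Qed.

(** The function (1 - z)^s satisfies s y + (1 - z) y' = 0. Truncating its Taylor series leaves a
    single term of top degree as residual. *)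
Lemma binpoly_ode n z :
  s * binpoly n z + (1 - z) * binpoly' n z = n.+1%:R * bincoef n * z ^+ n.
Proof.
elim: n => [|n IH].
  by rewrite /binpoly /binpoly' !big_ord0 subr0 oppr0 mulr0 addr0 !mulr1 mul1r.
have -> : binpoly' n.+1 z = binpoly' n z - bincoef n * (n.+1%:R * z ^+ n).
  by rewrite /binpoly' big_ord_recr/= opprD.
rewrite binpolyS; transitivity (n.+1%:R * bincoef n * z ^+ n - s * bincoef n * z ^+ n.+1
    - (1 - z) * bincoef n * (n.+1%:R * z ^+ n)); first by rewrite -IH; ring.
by rewrite bincoefS exprS; ring.
Qed.

Lemma binpoly_error n z rho : `|z| <= rho -> rho < 1 ->
  `|binpoly n z - (1 - z) `^ s| <= 4 * (1 - rho) ^- 3 * rho ^+ n.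
Proof.
move=> zr r1; case/andP: s01 => s0 s1.
have r0 : 0 <= rho by apply: le_trans zr.
have r1' : 0 < 1 - rho by rewrite subr_gt0.
(* Dividing by the exact solution leaves only the residual of [binpoly_ode] in the derivative; as P
   0 = 1, the mean value theorem bounds P z - 1 by a multiple of rho^n. *)
pose P x := binpoly n x * (1 - x) `^ (- s).
pose P' x := (1 - x) `^ (- s - 1) * (n.+1%:R * bincoef n * x ^+ n).
have dP x : `|x| <= rho -> is_derive x (1 : R) P (P' x).
  move=> xr; have x1 : 0 < 1 - x by have := ler_norm x; lra.
  have d1 := @is_derive1_chain _ (fun y => y `^ (- s)) (fun y => (-1) * y + 1) x _ _
     (@is_derive1_powR _ (- s) (-1 * x + 1) _) (is_derive1_affine (-1) 1 x).
  have {}d1 : is_derive x (1 : R) (fun y => (1 - y) `^ (- s)) (- s * (1 - x) `^ (- s - 1) * -1).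
    have e (y : R) : -1 * y + 1 = 1 - y by ring.
    by move: d1; rewrite e; under eq_fun do rewrite e; apply.
  have d2 := is_derive1M (is_derive_binpoly n x) d1.
  apply: (is_derive_eq d2); rewrite /P' -binpoly_ode.
  have -> : (1 - x) `^ (- s) = (1 - x) * (1 - x) `^ (- s - 1).
    rewrite -[X in X * _]powRr1 ?ltW// -powR_add//.
    by congr (_ `^ _); ring.
  by ring.
have P0 : P 0 = 1.
  rewrite /P /binpoly subr0 powR1 mulr1 big1 ?subr0// => i _.
  by rewrite expr0n mulr0.
have P'le x : `|x| <= `|z| -> `|P' x| <= (1 - rho) ^- 2 * rho ^+ n.
  move=> xz; have xr := le_trans xz zr.
  have x1 : 1 - rho <= 1 - x by have := ler_norm x; lra.
  rewrite /P' normrM; apply: ler_pM => //.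
    rewrite ger0_norm ?powR_ge0//.
    apply: (@le_trans _ _ ((1 - rho) `^ (- s - 1))).
      by apply: powR_antil => //; lra.
    have -> : (1 - rho) ^- 2 = (1 - rho) `^ (- 2%:R) by rewrite powR_Nnat// ltW.
    by apply: (@powR_exp_ge _ (1 - rho)); [apply/andP; split|]; lra.
  rewrite normrM normrX ger0_norm ?mulr_ge0 ?bincoef_ge0//.
  rewrite -[leRHS]mul1r; apply: ler_pM => //; rewrite ?mulr_ge0 ?bincoef_ge0//.
    by apply: le_trans (bincoef_le n) _; exact: ltW.
  by rewrite lerXn2r ?nnegrE.
have key : `|P z - 1| <= (1 - rho) ^- 2 * rho ^+ n.
  rewrite (_ : P z - 1 = P z - P 0); last by rewrite P0.
  have M0 : 0 <= (1 - rho) ^- 2 * rho ^+ n by rewrite mulr_ge0 ?invr_ge0 ?exprn_ge0// ltW.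
  have [z0|z0] := leP z 0.
    have zE : `|z| = - z by rewrite ler0_norm.
    have le_z x : z <= x <= 0 -> `|x| <= `|z|.
      by move=> /andP[zx x0]; rewrite zE ler0_norm// lerN2.
    rewrite distrC; apply: le_trans (mvt_le z0 _ _) _.
    - by move=> x xz; apply: dP; exact: le_trans (le_z x xz) zr.
    - by move=> x xz; apply: P'le; exact: le_z.
    - by rewrite ler_piMr// sub0r -zE; exact: le_trans zr (ltW r1).
  have zE : `|z| = z by rewrite gtr0_norm.
  have le_z x : 0 <= x <= z -> `|x| <= `|z|.
    by move=> /andP[x0 xz]; rewrite zE ger0_norm.
  apply: le_trans (mvt_le (ltW z0) _ _) _.
  - by move=> x xz; apply: dP; exact: le_trans (le_z x xz) zr.
  - by move=> x xz; apply: P'le; exact: le_z.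
  - by rewrite ler_piMr// subr0 -zE; exact: le_trans zr (ltW r1).
have z1 : 0 < 1 - z by have := ler_norm z; lra.
have zN : - z <= rho by apply: le_trans zr; rewrite -normrN ler_norm.
have -> : binpoly n z - (1 - z) `^ s = (1 - z) `^ s * (P z - 1).
  by rewrite mulrBr mulr1 /P mulrCA -powR_add// subrr powRr0 mulr1.
rewrite normrM ger0_norm ?powR_ge0//.
have h1 : (1 - z) `^ s <= 4 * (1 - rho)^-1.
  apply: (@le_trans _ _ 2).
    by apply: powR_le2; apply/andP; split; lra.
  by rewrite ler_pdivlMr//; lra.
apply: le_trans (ler_pM (powR_ge0 _ _) (normr_ge0 _) h1 key) _.
rewrite le_eqVlt; apply/orP; left; apply/eqP; field; by rewrite gt_eqF.
Qed.

Lemma binpoly_cvg z : `|z| < 1 -> binpoly n z @[n --> \oo] --> (1 - z) `^ s.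
Proof.
move=> z1; apply/cvgrPdist_le => e e0.
have : 4 * (1 - `|z|) ^- 3 * `|z| ^+ n @[n --> \oo] --> 0.
  rewrite -[X in _ --> X](mulr0 (4 * (1 - `|z|) ^- 3)).
  apply: cvgM; first exact: cvg_cst.
  by apply: cvg_expr; rewrite normr_id.
move/cvgrPdist_le => /(_ e e0); apply: filterS => n.
rewrite sub0r normrN ger0_norm; last first.
  by rewrite !mulr_ge0 ?invr_ge0 ?exprn_ge0 ?subr_ge0 ?normr_ge0// ltW.
by rewrite distrC; apply: le_trans; exact: binpoly_error.
Qed.

End BinomialSeries.

(** * Sign of the fractional Laplacian at a maximum *)

Section FracLapMax.
Context {R : realType}.
Implicit Types (G : nat -> R -> R) (q : nat -> R) (x : R).

Lemma mult_lin G q1 q2 c M j x : pjet G -> 0 <= M ->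
  (forall i, `|q1 i.+1| <= M * omega i.+1 ^+ j) ->
  (forall i, `|q2 i.+1| <= M * omega i.+1 ^+ j) ->
  mult (fun k => q1 k + c * q2 k) (G 0%N) x = mult q1 (G 0%N) x + c * mult q2 (G 0%N) x.
Proof.
move=> pG M0 h1 h2; have [B B0 HB] := mult_cvg j pG M0.
have [c1 _] := HB q1 h1 x; have [c2 _] := HB q2 h2 x.
apply/cvg_lim => //.
rewrite (_ : (fun n => _) = (fun n => mult_partial q1 (G 0%N) n x +
    c * mult_partial q2 (G 0%N) n x)).
  by apply: cvgD => //; apply: cvgM => //; exact: cvg_cst.
apply/funext => n; rewrite /mult_partial [c * _]mulrCA -mulrDr; congr (2 * _).
by rewrite mulr_sumr -big_split/=; apply: eq_bigr => i _; ring.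
Qed.

Lemma is_derive1_seq (F : R -> R) (x a : R) (h : nat -> R) : is_derive x (1 : R) F a ->
  h l @[l --> \oo] --> (0 : R) -> (forall l, h l != 0) ->
  (h l)^-1 * (F (h l + x) - F x) @[l --> \oo] --> a.
Proof.
move=> dF hc h0.
have dl : t^-1 *: (F (t *: (1:R) + x) - F x) @[t --> (0:R)^'] --> a.
  rewrite -(@derive_val _ _ _ _ _ _ _ dF).
  have := @ex_derive _ _ _ _ _ _ _ dF; exact.
move/cvgr_dnbhsP : dl => /(_ h (conj h0 hc)).
by apply: cvg_trans; apply: near_eq_cvg; apply: nearW => l; rewrite /= /GRing.scale/= mulr1.
Qed.

Lemma cvg_sum_ord n (u : nat -> nat -> R) (c : nat -> R) :
  (forall i, u l i @[l --> \oo] --> c i) ->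
  \sum_(i < n) u l i @[l --> \oo] --> \sum_(i < n) c i.
Proof.
move=> uc; elim: n => [|n IH].
  by under eq_fun do rewrite big_ord0; rewrite big_ord0; exact: cvg_cst.
under eq_fun do rewrite big_ord_recr/=; rewrite big_ord_recr/=.
by apply: cvgD => //; exact: uc.
Qed.

(** Dominated convergence for symbols. One [n] makes the tails of all the series small, since [B] in
    [mult_cvg] serves every symbol; the remaining finite sum converges term by term. *)
Lemma mult_limit_ge0 G (qj : nat -> nat -> R) q M j x : pjet G -> 0 <= M ->
  (forall i l, `|qj l i.+1| <= M * omega i.+1 ^+ j) ->
  (forall i, `|q i.+1| <= M * omega i.+1 ^+ j) ->
  (forall i, qj l i.+1 @[l --> \oo] --> q i.+1) ->
  (forall l, 0 <= mult (qj l) (G 0%N) x) -> 0 <= mult q (G 0%N) x.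
Proof.
move=> pG M0 hj h qc pos; have [B B0 HB] := mult_cvg j pG M0.
rewrite -[leRHS]opprK oppr_ge0; apply/ler_addgt0Pr => e e0; rewrite add0r.
have [n _ /(_ _ (leqnn n)) nB] := @nbhs_infty_ger R (2 * B / e).
have n0 : 0 < n.+1%:R :> R by rewrite ltr0n.
have {nB} Bn : B / n.+1%:R <= e / 2.
  rewrite ler_pdivrMr// -ler_pdivrMl ?divr_gt0//.
  apply: le_trans (_ : _ <= n%:R) _; last by rewrite ler_nat.
  by apply: le_trans nB; rewrite invf_div; lra.
have cn : mult_partial (qj l) (G 0%N) n x @[l --> \oo] --> mult_partial q (G 0%N) n x.
  apply: cvgM; first exact: cvg_cst.
  apply: (@cvg_sum_ord n (fun l i => qj l i.+1 * fterm (G 0%N) i.+1 x)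
    (fun i => q i.+1 * fterm (G 0%N) i.+1 x)) => i.
  by apply: cvgM; [exact: qc|exact: cvg_cst].
have : - (e / 2) <= mult_partial q (G 0%N) n x.
  apply: (cvg_ge_bound (N := 0%N) cn) => l _; have := (HB (qj l) (hj^~ l) x).2 n.
  rewrite ler_norml => /andP[+ _]; move: (B / _) Bn => b; have := pos l; lra.
have := (HB q h x).2 n; rewrite ler_norml => /andP[_]; move: (B / _) Bn => b; lra.
Qed.

Section AtMaximum.
Variables (G : nat -> R -> R) (x0 : R).
Hypothesis pG : pjet G.
Hypothesis c0 : fcos (G 0%N) 0 = 0.
Hypothesis x0_max : forall x, G 0%N x <= G 0%N x0.

Lemma max_ge0 : 0 <= G 0%N x0.
Proof.
have -> : 0 = cint (G 0%N).
  by rewrite -c0; apply: eq_cint => x; rewrite omega0 mul0r cos0 mulr1.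
rewrite -[leRHS](@cint_cst R); apply: le_cint => //; last exact: continuous_cst.
exact: jet_continuous pG.1.
Qed.

Lemma cosn_symbol_le (h : R) n i : `|cos (omega i.+1 * h) ^+ n| <= 1 * omega i.+1 ^+ 0.
Proof. by rewrite expr0 mulr1 normrX exprn_ile1// cos_norm_le1. Qed.

(* Multiplying by [cos (omega k * h)] is averaging the two translates by [h]
   and [- h]. *)
Lemma mult_cosn_le h n x : mult (fun k => cos (omega k * h) ^+ n) (G 0%N) x <= G 0%N x0.
Proof.
have [B B0 HB] := mult_cvg 0 pG ler01.
elim: n x => [|n IH] x.
  rewrite (_ : (fun k => _) = fun=> 1); last by apply/funext => k; rewrite expr0.
  by rewrite -pjet_inversion.
have [cp _] := HB (fun k => cos (omega k * h) ^+ n) (cosn_symbol_le h n) (x + h).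
have [cm _] := HB (fun k => cos (omega k * h) ^+ n) (cosn_symbol_le h n) (x - h).
have [cS _] := HB (fun k => cos (omega k * h) ^+ n.+1) (cosn_symbol_le h n.+1) x.
have -> : mult (fun k => cos (omega k * h) ^+ n.+1) (G 0%N) x =
    2^-1 * (mult (fun k => cos (omega k * h) ^+ n) (G 0%N) (x + h) +
            mult (fun k => cos (omega k * h) ^+ n) (G 0%N) (x - h)).
  apply: (@cvg_unique _ _ _ _ _ _ cS) => //.
  rewrite (_ : (fun n0 => _) = (fun m => 2^-1 *
     (mult_partial (fun k => cos (omega k * h) ^+ n) (G 0%N) m (x + h) +
      mult_partial (fun k => cos (omega k * h) ^+ n) (G 0%N) m (x - h)))).
    by apply: cvgM; [exact: cvg_cst|exact: cvgD].
  apply/funext => m; rewrite /mult_partial -mulrDr -big_split/= mulrCA; congr (2 * _).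
  rewrite mulr_sumr; apply: eq_bigr => i _.
  by rewrite /fterm (mulrBr (omega _) x h) (mulrDr (omega _) x h) cosB cosD sinB sinD exprS; field.
have := IH (x + h); have := IH (x - h); lra.
Qed.

Section Fixed.
Variables (s h rho : R).
Hypotheses (s01 : 0 < s < 1) (rho0 : 0 <= rho) (rho1 : rho < 1).

Lemma z_lt1 k : `|rho * cos (omega k * h)| <= rho.
Proof. by rewrite normrM ger0_norm// ler_piMr// cos_norm_le1. Qed.

Lemma binpoly_symbol_le n i : `|binpoly s n (rho * cos (omega i.+1 * h))| <= 2 * omega i.+1 ^+ 0.
Proof.
rewrite expr0 mulr1 binpoly_norm_le//; apply: le_trans (z_lt1 _) _; exact: ltW.
Qed.

(** The powers of the cosine come with nonpositive coefficients, so replacing each averaged value by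
    the maximum can only lower the sum. What remains is the polynomial with the cosine set to 1. *)
Lemma binpoly_mult_ge n :
  binpoly s n rho * G 0%N x0 <= mult (fun k => binpoly s n (rho * cos (omega k * h))) (G 0%N) x0.
Proof.
elim: n => [|n IH].
  rewrite /binpoly big_ord0 subr0 mul1r.
  rewrite (_ : (fun k => _) = fun=> 1); last by apply/funext => k; rewrite big_ord0 subr0.
  by rewrite -pjet_inversion.
rewrite (_ : (fun k => _) = (fun k => binpoly s n (rho * cos (omega k * h)) +
   (- (bincoef s n * rho ^+ n.+1)) * cos (omega k * h) ^+ n.+1)); last first.
  by apply/funext => k; rewrite binpolyS exprMn; ring.
rewrite (@mult_lin _ _ _ _ 2 0 x0 pG)//; first last.
- move=> i; apply: le_trans (cosn_symbol_le h n.+1 i) _.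
  by rewrite expr0 !mulr1; lra.
- exact: binpoly_symbol_le.
rewrite binpolyS mulrBl mulNr lerB//.
by rewrite ler_wpM2l ?mult_cosn_le// mulr_ge0 ?exprn_ge0 ?bincoef_ge0.
Qed.

Lemma mult_pow_cos_ge0 :
  0 <= mult (fun k => (1 - rho * cos (omega k * h)) `^ s) (G 0%N) x0.
Proof.
have zle k := z_lt1 k.
apply: (@mult_limit_ge0 G (fun n k => binpoly s n (rho * cos (omega k * h))) _ 2 0 x0) => //.
- by move=> i n; exact: binpoly_symbol_le.
- move=> i; rewrite expr0 mulr1 ger0_norm ?powR_ge0//.
  exact: powR_onem_le2 (zle i.+1) rho1 s01.
- by move=> i; apply: binpoly_cvg => //; exact: le_lt_trans (zle _) rho1.
move=> n; apply: le_trans (binpoly_mult_ge n).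
by rewrite mulr_ge0 ?max_ge0// binpoly_ge0// rho0 ltW.
Qed.

End Fixed.

(* [(2 / h^2)^s (1 - rho cos (omega k * h))^s -> (omega k)^(2 s)] as [h -> 0] with
   [rho = 1 - h^3]. In the binomial series of [(1 - z)^s], [z = rho cos (omega k * h)], the
   coefficients after the constant term are nonpositive, and at a maximum of [G 0] each power of
   [cos (omega k * h)], being an average of translates, gives at most the value of [G 0] there. *)
Lemma mult_flap_max_ge0 (alpha : R) : 0 < alpha < 2 ->
  0 <= mult (flap_symbol alpha) (G 0%N) x0.
Proof.
move=> alpha02; pose s := alpha / 2.
have s01 : 0 < s < 1 by rewrite /s; apply/andP; split; lra.
pose h (l : nat) : R := l.+1%:R^-1.
have h0 l : 0 < h l by rewrite invr_gt0.
have h1 l : h l <= 1 by rewrite invf_le1// ler1n.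
pose rho l := 1 - h l ^+ 3.
have rho0 l : 0 <= rho l by rewrite subr_ge0 exprn_ile1// ltW.
have rho1 l : rho l < 1 by rewrite gtrBl exprn_gt0.
pose a l k := 2 / h l ^+ 2 * (1 - rho l * cos (omega k * h l)).
pose qj l k := (2 / h l ^+ 2) `^ s * (1 - rho l * cos (omega k * h l)) `^ s.
have hn0 l : h l != 0 by rewrite gt_eqF.
(* From 1 - cos (2 y) = 2 (sin y)^2. The square tends to (omega k)^2; the gap h^3 between rho and 1
   keeps the binomial series convergent and, even after multiplication by 2 / h^2, contributes only
   2 h cos, which vanishes. *)
have aE l k : a l k = (2 * (h l)^-1 * sin (omega k / 2 * h l)) ^+ 2 +
    2 * h l * cos (omega k * h l).
  rewrite /a /rho (_ : omega k * h l = (omega k / 2 * h l) *+ 2); last first.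
    by rewrite -mulr_natr; field.
  by rewrite cos_mulr2n cos2sin2 -mulr_natr; field.
have sinle l k : `|2 * (h l)^-1 * sin (omega k / 2 * h l)| <= omega k.
  have := derive_lip (@is_derive_sin R) (@cos_norm_le1 R) (omega k / 2 * h l) 0.
  rewrite sin0 !subr0 mul1r => hs; rewrite normrM ger0_norm ?mulr_ge0 ?invr_ge0 ?(ltW (h0 l))//.
  rewrite mulrAC ler_pdivrMr//.
  have e0 : 0 <= omega k / 2 * h l by rewrite mulr_ge0 ?divr_ge0 ?omega_ge0 ?(ltW (h0 l)).
  by move: hs; rewrite (ger0_norm e0); lra.
have om1 i : 1 <= omega i.+1 :> R by apply: le_trans (omega_ge _); rewrite ler1n.
have a0 l k : 0 <= a l k.
  rewrite mulr_ge0 ?divr_ge0 ?exprn_ge0 ?(ltW (h0 l))// subr_ge0.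
  have : `|rho l * cos (omega k * h l)| <= 1.
    by apply: le_trans (z_lt1 (h l) (rho0 l) k) _; exact: ltW.
  by rewrite ler_norml => /andP[].
have ale l i : a l i.+1 <= 3 * omega i.+1 ^+ 2.
  have h2 : (2 * (h l)^-1 * sin (omega i.+1 / 2 * h l)) ^+ 2 <= omega i.+1 ^+ 2.
    by rewrite -[leLHS]real_normK ?num_real// lerXn2r ?nnegrE// (le_trans _ (om1 i)).
  have h3 : 2 * h l * cos (omega i.+1 * h l) <= 2 * omega i.+1 ^+ 2.
    apply: (@le_trans _ _ 2); last by rewrite ler_peMr// exprn_ege1.
    by have := cos_le1 (omega i.+1 * h l); have := h1 l; have := h0 l; nra.
  by rewrite aE; lra.
have qjE l k : qj l k = a l k `^ s.
  have r1 : 0 <= 1 - rho l * cos (omega k * h l).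
    rewrite subr_ge0; have : `|rho l * cos (omega k * h l)| <= 1.
      by apply: le_trans (z_lt1 (h l) (rho0 l) k) _; exact: ltW.
    by rewrite ler_norml => /andP[].
  by rewrite /qj /a [RHS]powRM// divr_ge0 ?exprn_ge0 ?(ltW (h0 l)).
have qjle i l : `|qj l i.+1| <= 3 * omega i.+1 ^+ 2.
  rewrite qjE ger0_norm ?powR_ge0//.
  have m1 : 1 <= 3 * omega i.+1 ^+ 2 :> R.
    have : 1 <= omega i.+1 ^+ 2 :> R by rewrite exprn_ege1.
    by move: (omega _ ^+ 2) => y; lra.
  apply: le_trans (_ : (3 * omega i.+1 ^+ 2) `^ s <= _).
    apply: ge0_ler_powR; rewrite ?nnegrE//; first by case/andP: s01 => /ltW.
    exact: le_trans ler01 m1.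
  by apply: ler1_powR => //; case/andP: s01 => _ /ltW.
have flE k : flap_symbol alpha k = (omega k ^+ 2) `^ s.
  by rewrite /flap_symbol -powR_mulrn ?omega_ge0// -powRrM /s; congr (_ `^ _); field.
apply: (@mult_limit_ge0 G qj _ 3 2 x0) => //.
- move=> i; rewrite flE ger0_norm ?powR_ge0//.
  have m1 : 1 <= omega i.+1 ^+ 2 :> R by rewrite exprn_ege1.
  apply: le_trans (ler1_powR m1 _) _; first by case/andP: s01 => _ /ltW.
  by move: (omega _ ^+ 2) m1 => y; lra.
- move=> i; rewrite flE; under eq_fun do rewrite qjE.
  have w0 : 0 < omega i.+1 :> R by rewrite omega_gt0.
  have hc : h l @[l --> \oo] --> (0 : R) by exact: cvg_harmonic.
  have ca : a l i.+1 @[l --> \oo] --> omega i.+1 ^+ 2.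
    rewrite (_ : (fun l => _) = (fun l => (2 * (h l)^-1 * sin (omega i.+1 / 2 * h l)) ^+ 2 +
      2 * h l * cos (omega i.+1 * h l))); last by apply/funext => l; rewrite aE.
    rewrite -[X in _ --> X]addr0; apply: cvgD; last first.
      have c1 : cos (omega i.+1 * h l) @[l --> \oo] --> cos (omega i.+1 * 0).
        exact: cvg_comp _ _ hc (continuous_cosM (omega i.+1) 0).
      have c2 : 2 * h l @[l --> \oo] --> (2 * 0 : R) by apply: cvgM => //; exact: cvg_cst.
      by have := cvgM c2 c1; rewrite [2 * 0]mulr0 mul0r; exact.
    suff H : 2 * (h l)^-1 * sin (omega i.+1 / 2 * h l) @[l --> \oo] --> omega i.+1.
      by have := cvgM H H; exact.
    have := is_derive1_seq (is_derive_sinM (omega i.+1 / 2) 0) hc hn0.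
    rewrite mulr0 cos0 mulr1 sin0 => H.
    have H2 : 2 * ((h l)^-1 * (sin (omega i.+1 / 2 * (h l + 0)) - 0)) @[l --> \oo] --> omega i.+1.
      rewrite -[X in _ --> X](_ : 2 * (omega i.+1 / 2) = _); last by field.
      by apply: cvgM => //; exact: cvg_cst.
    rewrite (_ : (fun l => _) = (fun l => 2 * ((h l)^-1 * (sin (omega i.+1 / 2 *
      (h l + 0)) - 0))))//.
    by apply/funext => l; rewrite subr0 addr0 mulrA.
  have w20 : 0 < omega i.+1 ^+ 2 :> R by rewrite exprn_gt0.
  have pc : {for omega i.+1 ^+ 2, continuous (fun y : R => y `^ s)}.
    apply: differentiable_continuous; apply/derivable1_diffP.
    exact: (@ex_derive _ _ _ _ _ _ _ (is_derive1_powR s w20)).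
  exact: cvg_comp _ _ ca pc.
move=> l; rewrite /qj.
have q0 := mult_pow_cos_ge0 (h l) s01 (rho0 l) (rho1 l).
have -> : mult (fun k => (2 / h l ^+ 2) `^ s * (1 - rho l * cos (omega k * h l)) `^ s) (G 0%N) x0
    = (2 / h l ^+ 2) `^ s * mult (fun k => (1 - rho l * cos (omega k * h l)) `^ s) (G 0%N) x0.
  rewrite /mult/= -[RHS]add0r.
  have Z i : `|(fun _ : nat => 0 : R) i.+1| <= 2 * omega i.+1 ^+ 0.
    by rewrite normr0 expr0 mulr1.
  have L i : `|(1 - rho l * cos (omega i.+1 * h l)) `^ s| <= 2 * omega i.+1 ^+ 0.
    rewrite expr0 mulr1 ger0_norm ?powR_ge0//.
    exact: powR_onem_le2 (z_lt1 (h l) (rho0 l) i.+1) (rho1 l) s01.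
  (* The scalar factor is taken out by linearity with 0 as first symbol. *)
  have := @mult_lin G (fun=> 0) (fun k => (1 - rho l * cos (omega k * h l)) `^ s)
    ((2 / h l ^+ 2) `^ s) 2 0 x0 pG _ Z L.
  rewrite /mult/= => H; rewrite -[in RHS](_ : limn (fun n => mult_partial (fun=> 0) (G 0%N) n x0) = 0).
    rewrite -H//; congr (lim (_ @ \oo)); apply/funext => n.
    by congr (2 * _); apply: eq_bigr => i _; rewrite add0r.
  rewrite (_ : (fun n => _) = fun=> 0); first exact: lim_cst.
  by apply/funext => n; rewrite /mult_partial big1 ?mulr0// => i _; rewrite mul0r.
by rewrite mulr_ge0// powR_ge0.
Qed.

End AtMaximum.

End FracLapMax.

(** * Interpolation and comparison *)

Section PowerSums.
Context {R : realType}.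
Implicit Types (a b q r N A Z : R) (m : nat -> R).

Lemma powR_increment r a : 0 < a -> r <= 1 -> exists2 x, a < x < a + 1 &
  (a + 1) `^ r - a `^ r = r * x `^ (r - 1).
Proof.
move=> a0 r1; have aa : a < a + 1 by rewrite ltrDl.
have d x : a <= x -> is_derive x (1 : R) (fun y => y `^ r) (r * x `^ (r - 1)).
  by move=> ax; apply: is_derive1_powR; exact: lt_le_trans ax.
have [x||x] := @MVT _ (fun y => y `^ r) (fun x => r * x `^ (r - 1)) _ _ aa.
- by rewrite in_itv/= => /andP[ax _]; apply: d; exact: ltW.
- apply: derivable_within_continuous => x; rewrite in_itv/= => /andP[ax _].
  exact: (@ex_derive _ _ _ _ _ _ _ (d x ax)).
by rewrite in_itv/= => xa ->; exists x => //; rewrite [a + 1 - a]addrC addKr mulr1.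
Qed.

Lemma powR_increment_neg q a : 0 < q -> 0 < a ->
  (a + 1) `^ (- q - 1) <= q^-1 * (a `^ (- q) - (a + 1) `^ (- q)).
Proof.
move=> q0 a0; have [|x /andP[ax xa]] := @powR_increment (- q) a a0; first by lra.
move/(congr1 -%R); rewrite opprB mulNr opprK => ->; rewrite mulKf ?gt_eqF//.
by apply: powR_antil; [lra|exact: lt_trans ax|exact: ltW].
Qed.

(** The increment of x^q is q x^(q - 1) at a point x of ]k, k + 1[. For q < 1 this is at least q (k
    + 1)^(q - 1), whence 1/q; for q >= 1 the increment is at least (k + 1)^(q - 1). *)
Lemma powR_increment_pos q (k : nat) : 0 < q ->
  k.+1%:R `^ (q - 1) <= (1 + q^-1) * (k.+1%:R `^ q - k%:R `^ q).
Proof.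
move=> q0; have qV : 0 < q^-1 by rewrite invr_gt0.
have k1 : 0 < k.+1%:R :> R by rewrite ltr0n.
have mono : k%:R `^ q <= k.+1%:R `^ q by apply: powR_monol; rewrite ?ler_nat// ltW.
have E : k.+1%:R `^ q = k.+1%:R `^ (q - 1) * k.+1%:R.
  by rewrite -[X in _ * X]powRr1 ?ltW// -powR_add// subrK.
have [q1|q1] := leP 1 q.
  apply: (@le_trans _ _ (k.+1%:R `^ q - k%:R `^ q)); last first.
    by rewrite mulrDl mul1r lerDl mulr_ge0 ?subr_ge0// ltW.
  have [->|k0] := posnP k.
    by rewrite powR0 ?gt_eqF// subr0 !powR_one.
  have k0' : 0 < k%:R :> R by rewrite ltr0n.
  have E' : k%:R `^ q = k%:R `^ (q - 1) * k%:R.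
    by rewrite -[X in _ * X]powRr1 ?ltW// -powR_add// subrK.
  rewrite E E' -natr1 mulrDr mulr1 addrAC lerDr subr_ge0 ler_wpM2r ?(ltW k0')//.
  rewrite natr1; apply: powR_monol; rewrite ?ler_nat// ?subr_ge0//.
have [->|k0] := posnP k.
  by rewrite powR0 ?gt_eqF// subr0 !powR_one mulr1; lra.
have k0' : 0 < k%:R :> R by rewrite ltr0n.
have [x /andP[kx xk]] := powR_increment k0' (ltW q1).
rewrite natr1 => H.
have h : q * k.+1%:R `^ (q - 1) <= k.+1%:R `^ q - k%:R `^ q.
  rewrite H ler_wpM2l ?(ltW q0)//; apply: powR_antil; [lra|exact: lt_trans kx|].
  by rewrite -natr1 ltW.
apply: (@le_trans _ _ (q^-1 * (k.+1%:R `^ q - k%:R `^ q))).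
  by rewrite -ler_pdivrMl ?invr_gt0// invrK.
by rewrite ler_wpM2r ?subr_ge0// lerDr.
Qed.

Lemma sum_low q N M : 0 < q -> 0 < N ->
  \sum_(i < M | i.+1%:R <= N) i.+1%:R `^ (q - 1) <= (1 + q^-1) * N `^ q.
Proof.
move=> q0 N0; have c0 : 0 <= 1 + q^-1 by rewrite addr_ge0// invr_ge0 ltW.
(* [N] is real, so the induction on [M] is run with min (M, N): the bound telescopes up to [N] and
   then stays constant. *)
apply: (@le_trans _ _ ((1 + q^-1) * (Num.min M%:R N) `^ q)); last first.
  rewrite ler_wpM2l//; apply: powR_monol; first exact: ltW.
    by rewrite le_min ler0n ltW.
  by rewrite ge_min lexx orbT.
elim: M => [|M IH].
  by rewrite big_ord0 mulr_ge0// powR_ge0.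
rewrite big_mkcond big_ord_recr/= -big_mkcond/=.
case: ifPn => [MN|]; last first.
  rewrite addr0 -ltNge => NM; apply: le_trans IH _.
  rewrite ler_wpM2l//; apply: powR_monol; first exact: ltW.
    by rewrite le_min ler0n ltW.
  by rewrite le_min !ge_min lexx orbT ler_nat leqnSn.
have MN' : M%:R <= N by apply: le_trans MN; rewrite ler_nat.
rewrite (min_idPl MN); move: IH; rewrite (min_idPl MN') => IH.
apply: le_trans (lerD IH (powR_increment_pos M q0)) _.
by rewrite -mulrDr addrCA subrr addr0.
Qed.

Lemma sum_high q N M : 0 < q -> 1 <= N ->
  \sum_(i < M | N < i.+1%:R) i.+1%:R `^ (- q - 1) <= (1 + q^-1) * N `^ (- q).
Proof.
move=> q0 N1; have N0 := lt_le_trans ltr01 N1.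
have qV : 0 < q^-1 by rewrite invr_gt0.
(* The first term beyond [N] is paid by N^(- q); the later ones telescope, which requires keeping
   the negative term in [M] during the induction. *)
have aux : \sum_(i < M | N < i.+1%:R) i.+1%:R `^ (- q - 1) <=
    if M%:R <= N then 0 else (1 + q^-1) * N `^ (- q) - q^-1 * M%:R `^ (- q).
  elim: M => [|M IH]; first by rewrite big_ord0 (ltW N0).
  rewrite big_mkcond big_ord_recr/= -big_mkcond/= ltNge.
  case: (leP M.+1%:R N) => [MN|NM] /=.
    by rewrite addr0; apply: le_trans IH _; rewrite (le_trans _ MN)// ler_nat.
  move: IH; case: (leP M%:R N) => MN IH.
    apply: (@le_trans _ _ (N `^ (- q))).
      rewrite -[leRHS]add0r lerD//.
      apply: (@le_trans _ _ (N `^ (- q - 1))); first by apply: powR_antil => //; [lra|exact: ltW].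
      by apply: powR_exp_le => //; lra.
    have : M.+1%:R `^ (- q) <= N `^ (- q) by apply: powR_antil; [lra| |exact: ltW].
    by move=> /(ler_wpM2l (ltW qV)); lra.
  have M0 : 0 < M%:R :> R by exact: lt_trans MN.
  have := powR_increment_neg q0 M0; rewrite natr1 => h.
  by apply: le_trans (lerD IH h) _; rewrite le_eqVlt; apply/orP; left; apply/eqP; ring.
apply: le_trans aux _; case: ifP => _.
  by rewrite mulr_ge0 ?powR_ge0// addr_ge0// ltW.
by rewrite gerBl mulr_ge0 ?powR_ge0// ltW.
Qed.

(* Frequencies below [N] are estimated by [A / k], the others by the weighted square sum. *)
Lemma interp_sqr r a A Z : 2^-1 < a -> a <= r -> 0 <= A -> 0 <= Z -> exists2 C, 0 < C &
  forall m N, (forall i, 0 <= m i <= A / i.+1%:R) -> 1 <= N ->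
  (forall M, \sum_(i < M) i.+1%:R `^ (2 * r) * m i ^+ 2 <= Z * N `^ (2 * r - 1)) ->
  forall M, \sum_(i < M) i.+1%:R `^ (2 * a) * m i ^+ 2 <= C * N `^ (2 * a - 1).
Proof.
move=> a12 ar A0 Z0; pose q := 2 * a - 1; have q0 : 0 < q by rewrite /q; lra.
have qV : 0 < q^-1 by rewrite invr_gt0.
exists (A ^+ 2 * (1 + q^-1) + Z + 1).
  by rewrite ltr_wpDl ?ltr01// addr_ge0// mulr_ge0 ?sqr_ge0// addr_ge0// ltW.
move=> m N mA N1 mZ M; have N0 := lt_le_trans ltr01 N1.
rewrite (bigID (fun i : 'I_M => i.+1%:R <= N))/=.
apply: (@le_trans _ _ (A ^+ 2 * (1 + q^-1) * N `^ q + Z * N `^ q)); last first.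
  by rewrite -mulrDl ler_wpM2r ?powR_ge0// lerDl.
apply: lerD.
  rewrite -mulrA; apply: le_trans (ler_wpM2l (sqr_ge0 A) (sum_low M q0 N0)).
  rewrite mulr_sumr; apply: ler_sum => i _.
  have k0 : 0 < i.+1%:R :> R by rewrite ltr0n.
  have /andP[m0 mi] := mA i.
  have h : m i ^+ 2 <= A ^+ 2 * i.+1%:R ^- 2.
    by rewrite -exprVn -exprMn lerXn2r ?nnegrE// divr_ge0.
  apply: le_trans (ler_wpM2l (powR_ge0 _ _) h) _.
  rewrite mulrCA ler_wpM2l ?sqr_ge0// powR_Nnat ?(ltW k0)// -powR_add//.
  by apply: powR_exp_le; [rewrite ler1n|rewrite /q; lra].
apply: (@le_trans _ _ (N `^ (2 * a - 2 * r) * (Z * N `^ (2 * r - 1)))); last first.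
  rewrite mulrCA -powR_add//; rewrite le_eqVlt; apply/orP; left; apply/eqP.
  by congr (_ * _ `^ _); rewrite /q; ring.
apply: le_trans (ler_wpM2l (powR_ge0 _ _) (mZ M)).
rewrite mulr_sumr [leRHS](bigID (fun i : 'I_M => i.+1%:R <= N))/=.
rewrite -[leLHS]add0r; apply: lerD.
  apply: sumr_ge0 => i _; apply: mulr_ge0; first exact: powR_ge0.
  by apply: mulr_ge0; [exact: powR_ge0|exact: sqr_ge0].
apply: ler_sum => i; rewrite -ltNge => Ni.
have -> : i.+1%:R `^ (2 * a) = i.+1%:R `^ (2 * a - 2 * r) * i.+1%:R `^ (2 * r) :> R.
  by rewrite -powR_add ?ltr0n//; congr (_ `^ _); ring.
rewrite -mulrA; apply: ler_wpM2r.
  by apply: mulr_ge0; [exact: powR_ge0|exact: sqr_ge0].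
by apply: powR_antil => //; [lra|exact: ltW].
Qed.

(** Low frequencies as in [interp_sqr]. High ones by Cauchy-Schwarz against k^(2 (a - r)), summable
    precisely because a < r - 1/2. *)
Lemma interp_abs r a A Z : 0 < a -> a < r - 2^-1 -> 0 <= A -> 0 <= Z -> exists2 C, 0 < C &
  forall m N, (forall i, 0 <= m i <= A / i.+1%:R) -> 1 <= N ->
  (forall M, \sum_(i < M) i.+1%:R `^ (2 * r) * m i ^+ 2 <= Z * N `^ (2 * r - 1)) ->
  forall M, \sum_(i < M) i.+1%:R `^ a * m i <= C * N `^ a.
Proof.
move=> a0 ar A0 Z0; pose q := 2 * r - 2 * a - 1; have q0 : 0 < q by rewrite /q; lra.
have qV : 0 < q^-1 by rewrite invr_gt0.
have aV : 0 < a^-1 by rewrite invr_gt0.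
exists (A * (1 + a^-1) + (Z + (1 + q^-1)) + 1).
  by rewrite ltr_wpDl ?ltr01// !addr_ge0 ?mulr_ge0 ?addr_ge0// ltW.
move=> m N mA N1 mZ M; have N0 := lt_le_trans ltr01 N1.
rewrite (bigID (fun i : 'I_M => i.+1%:R <= N))/=.
apply: (@le_trans _ _ (A * (1 + a^-1) * N `^ a + (Z + (1 + q^-1)) * N `^ a)); last first.
  by rewrite -mulrDl ler_wpM2r ?powR_ge0// lerDl.
apply: lerD.
  rewrite -mulrA; apply: le_trans (ler_wpM2l A0 (sum_low M a0 N0)).
  rewrite mulr_sumr; apply: ler_sum => i _.
  have k0 : 0 < i.+1%:R :> R by rewrite ltr0n.
  have /andP[m0 mi] := mA i.
  apply: le_trans (ler_wpM2l (powR_ge0 _ _) mi) _.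
  rewrite mulrCA ler_wpM2l// -[_^-1]powR_inv1 ?(ltW k0)// -powR_add//.
(* The weight in x y <= (lam x^2 + y^2 / lam) / 2 for which both resulting sums are of size N^a. *)
pose lam := N `^ (a - 2 * r + 1).
have lam0 : 0 < lam by rewrite powR_gt0.
rewrite mulrDl.
have -> : Z * N `^ a = lam * (Z * N `^ (2 * r - 1)).
  by rewrite mulrCA -powR_add//; congr (_ * _ `^ _); ring.
have -> : (1 + q^-1) * N `^ a = lam^-1 * ((1 + q^-1) * N `^ (- q)).
  rewrite /lam -powRN mulrCA -powR_add//; congr (_ * _ `^ _); rewrite /q; ring.
apply: le_trans (lerD (ler_wpM2l (ltW lam0) (mZ M))
  (ler_wpM2l _ (sum_high M q0 N1))); last by rewrite invr_ge0 ltW.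
rewrite [X in lam * X](bigID (fun i : 'I_M => i.+1%:R <= N))/= mulrDr -addrA.
rewrite -[leLHS]add0r; apply: lerD.
  by apply: mulr_ge0; [exact: ltW|apply: sumr_ge0 => i _; rewrite mulr_ge0 ?powR_ge0 ?sqr_ge0].
rewrite (eq_bigl (fun i : 'I_M => N < i.+1%:R)); last by move=> i; rewrite -ltNge.
rewrite [X in lam * X](eq_bigl (fun i : 'I_M => N < i.+1%:R)); last by move=> i; rewrite -ltNge.
rewrite !mulr_sumr -big_split/=; apply: ler_sum => i Ni.
have k0 : 0 < i.+1%:R :> R by rewrite ltr0n.
have -> : i.+1%:R `^ (2 * r) = (i.+1%:R `^ r) ^+ 2.
  by rewrite -powR_mulrn ?powR_ge0// -powRrM; congr (_ `^ _); ring.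
have -> : i.+1%:R `^ (- q - 1) = (i.+1%:R `^ (a - r)) ^+ 2.
  by rewrite -powR_mulrn ?powR_ge0// -powRrM; congr (_ `^ _); rewrite /q; ring.
have -> : i.+1%:R `^ a = i.+1%:R `^ r * i.+1%:R `^ (a - r).
  by rewrite -powR_add//; congr (_ `^ _); ring.
have /andP[m0 _] := mA i.
move: (i.+1%:R `^ r) (i.+1%:R `^ (a - r)) (powR_ge0 i.+1%:R r) (powR_ge0 i.+1%:R (a - r)) => x y x0 y0.
have : 0 <= lam * (x * m i - lam^-1 * y) ^+ 2 by rewrite mulr_ge0 ?sqr_ge0 ?ltW.
have -> : lam * (x * m i - lam^-1 * y) ^+ 2 =
    lam * (x ^+ 2 * m i ^+ 2) + lam^-1 * y ^+ 2 - 2 * (x * y * m i).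
  by field; rewrite gt_eqF.
have : 0 <= x * y * m i by rewrite !mulr_ge0.
lra.
Qed.

End PowerSums.

(** * A barrier principle *)

Section Comparison.
Context {R : realType}.

(** After the last time at which [phi] is nonpositive, [phi] is positive and hence nonincreasing, so
    it cannot reach a positive value at [b]. Only the sign of [phi'] where [phi] is positive is
    needed. *)
Lemma barrier_le (phi phi' : R -> R) (a b : R) : a <= b ->
  {within `[a, b], continuous phi} ->
  (forall t, a < t < b -> is_derive t (1 : R) phi (phi' t)) ->
  (forall t, a < t < b -> 0 < phi t -> phi' t <= 0) ->
  phi a <= 0 -> phi b <= 0.
Proof.
move=> ab cphi dphi neg pa; rewrite leNgt; apply/negP => pb.
pose S := [set t : R | a <= t <= b /\ phi t <= 0].
have Sa : S a by split => //; rewrite lexx.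
have supS : has_sup S.
  by split; [exists a|exists b => t [/andP[]]].
pose c := sup S.
have ac : a <= c by apply: ub_le_sup => //; case: supS.
have cb : c <= b by apply: ge_sup; [exists a|move=> t [/andP[]]].
have pos t : c < t -> t <= b -> 0 < phi t.
  move=> ct tb; rewrite ltNge; apply/negP => pt.
  have : t <= c.
    apply: ub_le_sup; first by case: supS.
    by split => //; rewrite tb (le_trans ac (ltW ct)).
  by rewrite leNgt ct.
have pc : phi c <= 0.
  rewrite leNgt; apply/negP => pc.
  have cin : c \in `[a, b] by rewrite in_itv/= ac cb.
  have /subspace_continuousP/(_ c) := cphi; rewrite /= in_itv/= ac cb => /(_ isT) cvc.
  have /cvgrPdist_lt/(_ _ pc) := cvc.
  rewrite near_withinE => -[e /= e0 He].
  have [t [[tab pt] ct]] := sup_adherent e0 supS.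
  have tc : t <= c by apply: ub_le_sup; [case: supS|].
  have ct' : `|c - t| < e by rewrite ger0_norm ?subr_ge0// ltrBlDr -ltrBlDl.
  have tin : `[a, b]%classic t by rewrite /= in_itv.
  have H : `|phi c - phi t| < phi c := He t ct' tin.
  by move: H; rewrite ltr_norml => /andP[_]; lra.
have cltb : c < b by rewrite lt_neqAle cb andbT; apply: contraTneq pb => <-; rewrite -leNgt.
have sub t : c < t < b -> a < t < b by move=> /andP[ct ->]; rewrite (le_lt_trans ac ct).
have [x||x] := @MVT _ phi phi' c b cltb.
- by rewrite in_itv/= => xcb; apply: dphi; exact: sub.
- apply: continuous_subspaceW cphi => x /=; rewrite !in_itv/= => /andP[cx ->].
  by rewrite (le_trans ac cx).
rewrite in_itv/= => xcb E.
have := neg x (sub _ xcb) (pos x _ _); case/andP: (xcb) => cx xb.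
move=> /(_ cx (ltW xb)) n0.
have : phi' x * (b - c) <= 0 by rewrite mulr_le0_ge0// subr_ge0 ltW.
rewrite -E; lra.
Qed.

End Comparison.

(** * Landau inequalities on an interval *)

Section Landau.
Context {R : realType}.
Implicit Types (G : nat -> R -> R) (x y l b : R).

(** The factor l^j makes bounds of all orders scale alike, so the constants below do not depend on
    the length [l]. *)
Definition jet_bound G x l j b : Prop :=
  forall y, x <= y <= x + l -> l ^+ j * `|G j y| <= b.

(** The derivative at y is compared with a difference quotient over a step h = e l / 2; the error is
    at most h times the bound on the next derivative. *)
Lemma landau_step G x l j b0 b2 e : jet G -> 0 < l -> 0 < e <= 1 ->
  jet_bound G x l j b0 -> jet_bound G x l j.+2 b2 ->
  jet_bound G x l j.+1 (4 / e * b0 + e / 2 * b2).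
Proof.
move=> jG l0 /andP[e0 e1] h0 h2 y xy.
pose h := e * l / 2; have hgt : 0 < h by rewrite divr_gt0 ?mulr_gt0.
have hl : h <= l / 2 by rewrite /h ler_pM2r// ler_piMl// ltW.
have lj k : 0 < l ^+ k by rewrite exprn_gt0.
have key z w : x <= z -> z <= w -> w <= x + l -> w - z = h -> (y = z \/ y = w) ->
    l ^+ j.+1 * `|G j.+1 y| <= 4 / e * b0 + e / 2 * b2.
  move=> xz zw wl wz yzw.
  have zy t : z <= t <= w -> x <= t <= x + l.
    by move=> /andP[zt tw]; rewrite (le_trans xz zt) (le_trans tw wl).
  have yin : z <= y <= w by case: yzw => ->; rewrite lexx ?zw.
  pose phi t := G j t - G j.+1 y * t.
  have dphi t : is_derive t (1 : R) phi (G j.+1 t - G j.+1 y).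
    have := is_derive1B (jG j t) (is_derive1Z (G j.+1 y) (is_derive_id t (1 : R))).
    by rewrite mulr1.
  have B2 t : z <= t <= w -> `|G j.+2 t| <= b2 / l ^+ j.+2.
    by move=> tzw; rewrite ler_pdivlMr// mulrC; apply: h2; exact: zy.
  have bb t : z <= t <= w -> `|G j.+1 t - G j.+1 y| <= b2 / l ^+ j.+2 * h.
    move=> tzw; case/andP: (tzw) => zt tw; case/andP: yin => zy' yw.
    have M0 : 0 <= b2 / l ^+ j.+2 by apply: le_trans (B2 t tzw).
    have [ty|yt] := leP t y.
      rewrite distrC; apply: le_trans (mvt_le ty (fun s _ => jG j.+1 s) _) _.
        move=> s /andP[ts sy]; apply: B2; rewrite (le_trans zt ts) (le_trans sy yw)//.
      by rewrite ler_wpM2l//; lra.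
    apply: le_trans (mvt_le (ltW yt) (fun s _ => jG j.+1 s) _) _.
      move=> s /andP[ts sy]; apply: B2; rewrite (le_trans zy' ts) (le_trans sy tw)//.
    by rewrite ler_wpM2l//; lra.
  have := mvt_le zw (fun t _ => dphi t) bb; rewrite wz.
  have E : phi w - phi z = G j w - G j z - G j.+1 y * h by rewrite /phi -wz; ring.
  rewrite E => H.
  have gz : l ^+ j * `|G j z| <= b0 by apply: h0; apply: zy; rewrite lexx zw.
  have gw : l ^+ j * `|G j w| <= b0 by apply: h0; apply: zy; rewrite lexx zw.
  have H2 : `|G j.+1 y| * h <= `|G j w| + `|G j z| + b2 / l ^+ j.+2 * h * h.
    rewrite -[X in _ * X <= _](ger0_norm (ltW hgt)) -normrM.
    have -> : G j.+1 y * h = (G j w - G j z) - (G j w - G j z - G j.+1 y * h) by ring.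
    apply: le_trans (ler_normB _ _) _; apply: lerD => //.
    exact: ler_normB.
  have H3 := ler_wpM2l (ltW (lj j)) H2.
  have F : l ^+ j.+1 * `|G j.+1 y| = 2 / e * (l ^+ j * (`|G j.+1 y| * h)).
    rewrite /h exprS; field; by rewrite gt_eqF.
  rewrite F; apply: le_trans (ler_wpM2l _ H3) _; first by rewrite divr_ge0// ltW.
  rewrite !mulrDr.
  have -> : 2 / e * (l ^+ j * (b2 / l ^+ j.+2 * h * h)) = e / 2 * b2.
    rewrite /h !exprS; field; by rewrite !gt_eqF.
  have c0 : 0 <= 2 / e by rewrite divr_ge0// ltW.
  have := ler_wpM2l c0 gz; have := ler_wpM2l c0 gw.
  rewrite (_ : 4 / e * b0 = 2 / e * b0 + 2 / e * b0); last by field; rewrite gt_eqF.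
  move: (2 / e * _) (2 / e * _) (2 / e * _) (e / 2 * _) => p q r s; lra.
case/andP: (xy) => xy1 xy2.
(* As h <= l / 2, at least one of y + h and y - h lies in the interval. *)
have [yl|yl] := leP (y + h) (x + l).
  apply: (key y (y + h)) => //; first by rewrite lerDl ltW.
    by rewrite addrC addKr.
  by left.
apply: (key (y - h) y) => //; [lra|lra|by rewrite opprB addrC subrK|by right].
Qed.

Lemma landau_pre j e : 0 < e <= 1 -> exists2 C, 0 <= C & forall G x l b0 b,
  jet G -> 0 < l -> jet_bound G x l 0 b0 -> jet_bound G x l j.+1 b ->
  jet_bound G x l j (C * b0 + e * b).
Proof.
elim: j e => [|j IH] e /andP[e0 e1].
  exists 1 => // G x l b0 b jG l0 h0 h1 y xy.
  have b_ge0 : 0 <= b.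
    by apply: le_trans (h1 y xy); rewrite mulr_ge0// exprn_ge0// ltW.
  by rewrite mul1r; apply: le_trans (h0 y xy) _; rewrite lerDl mulr_ge0// ltW.
have c0 : 0 < 4 / e by rewrite divr_gt0.
(* The maximum [s] of order j + 1 reappears on the right with factor (4 / e) d = 1/2 and is absorbed
   on the left. *)
pose d := e / 8.
have d01 : 0 < d <= 1 by rewrite /d; apply/andP; split; lra.
have [C C0 HC] := IH d d01.
exists (2 * (4 / e * C)); first by rewrite mulr_ge0// mulr_ge0// ltW.
move=> G x l b0 b jG l0 h0 h2.
have ll : x <= x + l by rewrite lerDl ltW.
have cG : continuous (fun y => l ^+ j.+1 * `|G j.+1 y|).
  by apply: continuous_scale; apply: continuous_norm; exact: jet_continuous.
have [z zin zmax] := EVT_max ll (continuous_subspaceT cG).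
pose s := l ^+ j.+1 * `|G j.+1 z|.
have hs : jet_bound G x l j.+1 s by move=> y xy; apply: zmax; rewrite in_itv.
have h1 := HC G x l b0 s jG l0 h0 hs.
have e01 : 0 < e <= 1 by rewrite e0.
have h3 := landau_step jG l0 e01 h1 h2.
have : s <= 4 / e * (C * b0 + d * s) + e / 2 * b.
  by apply: h3; rewrite in_itv in zin.
have -> : 4 / e * (C * b0 + d * s) = 4 / e * C * b0 + s / 2.
  by rewrite /d; field; rewrite gt_eqF.
move=> hh y xy; apply: le_trans (hs y xy) _.
rewrite (_ : 2 * (4 / e * C) * b0 = 2 * (4 / e * C * b0)); last by ring.
move: (4 / e * C * b0) hh => p hh.
have : e / 2 * b = e * b / 2 by ring.
by move: (e / 2 * b) (e * b) hh => u w hh E; lra.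
Qed.

Lemma landau n j : (j <= n)%N -> exists2 C, 0 <= C & forall G x l b0 b,
  jet G -> 0 < l -> jet_bound G x l 0 b0 -> jet_bound G x l n b ->
  jet_bound G x l j (C * (b0 + b)).
Proof.
(* Descending induction from [n]: [landau_pre] bounds each order by order 0 and the order just above
   it. *)
move=> jn; rewrite -(subKn jn); elim: (n - j)%N => [|d IH].
  exists 1 => // G x l b0 b jG l0 h0 hn y xy; rewrite mul1r subn0 in hn *.
  apply: le_trans (hn y xy) _; rewrite lerDr.
  by apply: le_trans (h0 y xy); rewrite mul1r.
have [C C0 HC] := IH; have [dn|nd] := ltnP d n; last first.
  exists C => // G x l b0 b jG l0 h0 hn.
  have -> : (n - d.+1 = n - d)%N by lia.
  exact: HC.
have [C' C'0 HC'] := @landau_pre (n - d.+1) 1 (introT andP (conj ltr01 (lexx 1))).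
exists (C' + C); first by rewrite addr_ge0.
move=> G x l b0 b jG l0 h0 hn.
have e : (n - d = (n - d.+1).+1)%N by lia.
have h1 := HC G x l b0 b jG l0 h0 hn; rewrite e in h1.
move=> y xy; apply: le_trans (HC' _ _ _ _ _ jG l0 h0 h1 y xy) _.
rewrite mul1r mulrDl lerD2r ler_wpM2l// lerDl.
by apply: le_trans (hn y xy); rewrite mulr_ge0// exprn_ge0// ltW.
Qed.

End Landau.

(** * Leibniz rule and derivatives of compositions *)

Section Leibniz.
Context {R : realType}.
Implicit Types (A B G F : nat -> R -> R) (x : R).

Definition leibniz A B n x : R := \sum_(i < n.+1) 'C(n, i)%:R * (A i x * B (n - i)%N x).

Lemma leibniz_sum n (A B : nat -> R) :
  \sum_(i < n.+1) 'C(n, i)%:R * (A i.+1 * B (n - i)%N + A i * B (n - i).+1) =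
  \sum_(i < n.+2) 'C(n.+1, i)%:R * (A i * B (n.+1 - i)%N).
Proof.
under eq_bigr do rewrite mulrDr; rewrite big_split/=.
rewrite [RHS]big_ord_recl/= bin0 mul1r subn0.
under [X in _ = _ + X]eq_bigr => i _.
  rewrite /bump/= add1n binS natrD mulrDl subSS; over.
rewrite big_split/= addrA [LHS]addrC; congr (_ + _).
rewrite [in LHS]big_ord_recl/= bin0 mul1r subn0 [in RHS]big_ord_recr/= bin_small// mul0r addr0.
congr (_ + _).
apply: eq_bigr => i _; rewrite /bump/= add1n; congr (_ * (_ * B _)).
by have := ltn_ord i; lia.
Qed.

Lemma is_derive_leibniz A B n x :
  (forall i, (i <= n)%N -> is_derive x (1 : R) (A i) (A i.+1 x)) ->
  (forall i, is_derive x (1 : R) (B i) (B i.+1 x)) ->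
  is_derive x (1 : R) (leibniz A B n) (leibniz A B n.+1 x).
Proof.
move=> dA dB; rewrite /leibniz -(leibniz_sum n (A^~ x) (B^~ x)).
apply: (@is_derive1_sum _ _ (index_enum 'I_n.+1) xpredT
  (fun i y => 'C(n, i)%:R * (A i y * B (n - i)%N y))) => i.
apply: is_derive1Z; apply: is_derive1M => //.
by apply: dA; rewrite -ltnS.
Qed.

(* The iterated derivatives of the compositions [F m \o G 0], for all [m] at
   once, since differentiating raises both indices. *)
Definition comp_jet F G n m : R -> R := derive1n n (fun x => F m (G 0%N x)).

(** Both claims go through one strong induction: the Leibniz formula for order n + 1 is
    differentiable because its factors are lower derivatives of the composition with index m + 1. *)
Lemma comp_jet_derive F G : jet F -> jet G -> forall n m x,
  is_derive x (1 : R) (comp_jet F G n m) (comp_jet F G n.+1 m x) /\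
  comp_jet F G n.+1 m = leibniz (fun i => comp_jet F G i m.+1) (fun i => G i.+1) n.
Proof.
move=> jF jG n; elim/ltn_ind: n => n IH m.
suff H : forall x, is_derive x (1 : R) (comp_jet F G n m)
    (leibniz (fun i => comp_jet F G i m.+1) (fun i => G i.+1) n x).
  have E : comp_jet F G n.+1 m = leibniz (fun i => comp_jet F G i m.+1) (fun i => G i.+1) n.
    by apply/funext => x; rewrite /comp_jet derive1nS derive1E; exact: derive_val.
  by move=> x; split => //; rewrite E.
case: n IH => [|n] IH x.
  rewrite /leibniz big_ord1 bin0 mul1r subn0.
  exact: is_derive1_chain.
have [_ ->] := IH n (ltnSn n) m x.
apply: is_derive_leibniz => i; last exact: jG.
by move=> i_n; have [] := IH i i_n m.+1 x.
Qed.

Lemma comp_jet_jet F G m : jet F -> jet G -> jet (fun n => comp_jet F G n m).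
Proof. by move=> jF jG n x; have [] := comp_jet_derive jF jG n m x. Qed.

(** Isolates the only term with the highest derivative of [G 0]. *)
Lemma comp_jetS F G n m x : jet F -> jet G ->
  comp_jet F G n.+1 m x = F m.+1 (G 0%N x) * G n.+1 x +
    \sum_(i < n) 'C(n, i.+1)%:R * (comp_jet F G i.+1 m.+1 x * G (n - i)%N x).
Proof.
move=> jF jG; have [_ ->] := comp_jet_derive jF jG n m x.
rewrite /leibniz big_ord_recl/= bin0 mul1r subn0; congr (_ + _).
apply: eq_bigr => i _; rewrite /bump/= add1n; congr (_ * (_ * G _ _)).
by have := ltn_ord i; lia.
Qed.

(** Each derivative counts for one factor [N], and every term of the expansion has n derivatives in
    all. The constant depends on [F] only through the bounds [M]. *)
Lemma comp_jet_bound (b : R) (M : nat -> R) n m : 0 <= b -> (forall m, 0 <= M m) ->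
  exists2 C, 0 <= C & forall F G N x, jet F -> jet G -> 0 <= N ->
    (forall k, `|F k (G 0%N x)| <= M k) ->
    (forall a, (1 <= a <= n)%N -> `|G a x| <= b * N ^+ a) ->
    `|comp_jet F G n m x| <= C * N ^+ n.
Proof.
move=> b0 M0; elim/ltn_ind: n m => -[|n] IH m.
  by exists (M m) => // F G N x jF jG N0 FM _; rewrite expr0 mulr1; exact: FM.
have /choice[C HC] : forall i : 'I_n, exists C, 0 <= C /\ forall F G N x, jet F -> jet G -> 0 <= N ->
    (forall k, `|F k (G 0%N x)| <= M k) ->
    (forall a, (1 <= a <= i.+1)%N -> `|G a x| <= b * N ^+ a) ->
    `|comp_jet F G i.+1 m.+1 x| <= C * N ^+ i.+1.
  move=> i; have [C C0 H] := IH i.+1 (ltn_ord i) m.+1.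
  by exists C; split.
exists (M m.+1 * b + \sum_(i < n) 'C(n, i.+1)%:R * (C i * b)).
  by rewrite addr_ge0 ?mulr_ge0// sumr_ge0// => i _; rewrite !mulr_ge0// (HC i).1.
move=> F G N x jF jG N0 FM Gb; rewrite comp_jetS//.
apply: le_trans (ler_normD _ _) _; rewrite mulrDl; apply: lerD.
  by rewrite normrM -mulrA ler_pM// Gb// leqnn.
apply: le_trans (ler_norm_sum _ _ _) _; rewrite mulr_suml; apply: ler_sum => i _.
rewrite normrM normr_nat -mulrA ler_wpM2l// normrM.
have e : N ^+ n.+1 = N ^+ i.+1 * N ^+ (n - i) by rewrite -exprD; congr (_ ^+ _); have := ltn_ord i; lia.
rewrite e mulrACA ler_pM//.
  apply: (HC i).2 => // a /andP[a1 ai]; apply: Gb; rewrite a1/=.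
  by have := ltn_ord i; lia.
by apply: Gb; have := ltn_ord i; lia.
Qed.

End Leibniz.

(** * Solutions: a priori bounds *)

Section MultiplierJets.
Context {R : realType}.
Implicit Types (F : R -> R) (G : nat -> R -> R) (x y : R).

(** Quadratic remainders survive limits and integration; this replaces theorems on differentiating
    series and integrals with a parameter. *)
Lemma is_derive1_quad F x a C d : 0 < d ->
  (forall y, `|y - x| < d -> `|F y - F x - a * (y - x)| <= C * `|y - x| ^+ 2) ->
  is_derive x (1 : R) F a.
Proof.
move=> d0 H.
suff cv : h^-1 *: (F (h *: (1 : R) + x) - F x) @[h --> (0 : R)^'] --> a.
  by apply: DeriveDef; [apply/cvg_ex; exists a|exact/cvg_lim].
apply/cvgrPdist_le => e e0.
have C0 : 0 <= C.
  have := H (x + d / 2); rewrite [x + _]addrC addrK ger0_norm ?divr_ge0 ?(ltW d0)// => /(_ _)Hd.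
  have : 0 <= C * (d / 2) ^+ 2 by apply: le_trans (Hd _) => //; lra.
  by rewrite pmulr_lge0// exprn_gt0// divr_gt0.
have C1 : 0 < C + 1 by rewrite ltr_wpDl.
have m0 : 0 < Num.min d (e / (C + 1)) by rewrite lt_min d0 divr_gt0.
near=> h.
have h0 : h != 0 by near: h; exact: nbhs_dnbhs_neq.
have hm : `|h| < Num.min d (e / (C + 1)).
  near: h; apply: nbhs_dnbhs; apply/nbhs_normP; exists (Num.min d (e / (C + 1))) => //= t.
  by rewrite /ball_/= sub0r normrN.
move: hm; rewrite lt_min => /andP[hd he].
have := H (h + x); rewrite addrK => /(_ hd) K.
rewrite distrC /GRing.scale/= mulr1.
have -> : h^-1 * (F (h + x) - F x) - a = h^-1 * (F (h + x) - F x - a * h) by field.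
rewrite normrM normfV ler_pdivrMl ?normr_gt0//.
apply: le_trans K _; rewrite expr2 mulrA mulrC ler_wpM2l//.
move: he; rewrite ltr_pdivlMr// => he.
have : 0 <= `|h| by []. lra.
Unshelve. all: end_near. Qed.

Lemma is_derive_fterm G k x : pjet G ->
  is_derive x (1 : R) (fterm (G 0%N) k) (fterm (G 1%N) k x).
Proof.
move=> pG; have d := is_derive1D (is_derive1Z (fcos (G 0%N) k) (is_derive_cosM (omega k) x))
  (is_derive1Z (fsin (G 0%N) k) (is_derive_sinM (omega k) x)).
apply: (is_derive_eq d); rewrite /fterm fcos_derive// fsin_derive//; ring.
Qed.

Lemma is_derive_mult_partial q G n x : pjet G ->
  is_derive x (1 : R) (mult_partial q (G 0%N) n) (mult_partial q (G 1%N) n x).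
Proof.
move=> pG; apply: is_derive1Z; apply: (@is_derive1_sum _ _ (index_enum 'I_n) xpredT
  (fun i y => q i.+1 * fterm (G 0%N) i.+1 y)) => i.
by apply: is_derive1Z; exact: is_derive_fterm.
Qed.

Lemma is_derive_mult q G M j x : pjet G -> 0 <= M ->
  (forall i, `|q i.+1| <= M * omega i.+1 ^+ j) ->
  is_derive x (1 : R) (mult q (G 0%N)) (mult q (G 1%N) x).
Proof.
move=> pG M0 qM.
have [B0 B00 /(_ q qM) H0] := mult_cvg j pG M0.
have [B1 B10 /(_ q qM) H1] := mult_cvg j (pjet_shift 1 pG) M0.
have [B2 B20 /(_ q qM) H2] := mult_cvg j (pjet_shift 2 pG) M0.
rewrite /= ?add1n in H1; rewrite /= ?add2n in H2.
(* The empty partial sum is 0, so the error bound at n = 0 gives |limit| <= B2, and every partial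
   sum is then at most 2 B2. *)
have P2 n y : `|mult_partial q (G 2%N) n y| <= 2 * B2.
  have [_ h] := H2 y; have := h n; have := h 0%N.
  rewrite /mult_partial big_ord0 mulr0 sub0r normrN divr1 -/(mult_partial _ _ _ _) => h0 hn.
  have hn' : `|mult_partial q (G 2%N) n y - mult q (G 2%N) y| <= B2.
    by apply: le_trans hn _; rewrite ler_pdivrMr ?ltr0n// ler_peMr// ler1n.
  have -> : mult_partial q (G 2%N) n y =
    (mult_partial q (G 2%N) n y - mult q (G 2%N) y) + mult q (G 2%N) y by rewrite subrK.
  apply: le_trans (ler_normD _ _) _; lra.
apply: (@is_derive1_quad _ _ _ (2 * B2) 1) => // y _.
have B20' : 0 <= 2 * B2 by rewrite mulr_ge0.
have key n : `|mult_partial q (G 0%N) n y - mult_partial q (G 0%N) n x -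
     (y - x) * mult_partial q (G 1%N) n x| <= 2 * B2 * `|y - x| ^+ 2.
  apply: (taylor1_le B20') => z _; first exact: is_derive_mult_partial.
  exact: (derive_lip (fun z => is_derive_mult_partial q n z (pjet_shift 1 pG)) (P2 n)).
rewrite [_ * (y - x)]mulrC.
have cv : mult_partial q (G 0%N) n y - mult_partial q (G 0%N) n x -
     (y - x) * mult_partial q (G 1%N) n x @[n --> \oo] -->
   mult q (G 0%N) y - mult q (G 0%N) x - (y - x) * mult q (G 1%N) x.
  apply: cvgB; first by apply: cvgB; [exact: (H0 y).1|exact: (H0 x).1].
  by apply: cvgM; [exact: cvg_cst|exact: (H1 x).1].
rewrite -[X in `|X|]subr0; apply: (cvg_norm_le (N := 0%N) cv) => n _.
by rewrite subr0.
Qed.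

Lemma mult_jet q G M j : pjet G -> 0 <= M ->
  (forall i, `|q i.+1| <= M * omega i.+1 ^+ j) -> jet (fun i => mult q (G i)).
Proof.
move=> pG M0 qM i x; have := is_derive_mult x (pjet_shift i pG) M0 qM.
by rewrite /= addn0 addn1.
Qed.

Lemma flap_symbol_le (alpha : R) i : alpha <= 2 -> `|flap_symbol alpha i.+1| <= 1 * omega i.+1 ^+ 2.
Proof.
move=> a2; rewrite mul1r ger0_norm ?powR_ge0// -powR_mulrn ?omega_ge0//.
by apply: powR_exp_le => //; apply: le_trans (omega_ge _); rewrite ler1n.
Qed.

End MultiplierJets.

(* [F j] stands for the j-th derivative of [f], and [g i j] for that of [u] of order [i] in [t] and
   [j] in [x]; [b_init] and [b_energy] are the only information kept on [u_0]. *)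
Record burgers (R : realType) (alpha sigma D nu : R) (F : nat -> R -> R)
    (g : nat -> nat -> R -> R -> R) : Prop := Burgers {
  b_alpha : 1 < alpha < 2;
  b_nu : 0 < nu <= 1;
  b_sigma : 0 < sigma;
  b_D : 1 < D;
  b_F : jet F;
  b_convex : forall x, sigma <= F 2%N x;
  b_periodic : forall t, 0 <= t -> periodic (g 0%N 0%N t) 1;
  b_mean : forall t, 0 <= t -> cint (g 0%N 0%N t) = 0;
  b_dx : forall i j (t x : R), 0 <= t -> is_derive x (1 : R) (g i j t) (g i j.+1 t x);
  b_dt : forall i j (t x : R), 0 < t -> is_derive t (1 : R) (g i j ^~ x) (g i.+1 j t x);
  b_cont : forall i j, {within [set z : R * R | 0 <= z.1],
                          continuous (fun z : R * R => g i j z.1 z.2)};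
  b_eq : forall t x, 0 <= t -> g 1%N 0%N t x =
    - comp_jet F (fun j => g 0%N j t) 1 0 x - nu * mult (flap_symbol alpha) (g 0%N 0%N t) x;
  b_init : forall x, g 0%N 1%N 0 x <= D;
  b_energy : D ^- 2 <= cint (fun x => g 0%N 0%N 0 x ^+ 2)
}.

Arguments b_cont {R alpha sigma D nu F g} b i j.
Arguments b_dx {R alpha sigma D nu F g} b i j t x _ : rename.
Arguments b_dt {R alpha sigma D nu F g} b i j [t] x _ : rename.
Arguments jet_continuous {R} [G] j.

(** * Regularity in time, energies and the upper bound on the gradient *)

Section BasicFacts.
Context {R : realType} {alpha sigma D nu : R} {F : nat -> R -> R}
  {g : nat -> nat -> R -> R -> R}.
Hypothesis S : burgers alpha sigma D nu F g.

Lemma sol_pjet (t : R) : 0 <= t -> pjet (fun j => g 0%N j t).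
Proof. by move=> t0; split; [move=> j x; exact: b_dx S _ _ _ _ t0|exact: b_periodic S _ t0]. Qed.

Lemma sol_jet i (t : R) : 0 <= t -> jet (fun j => g i j t).
Proof. by move=> t0 j x; exact: b_dx S _ _ _ _ t0. Qed.

Lemma sol_fcos0 (t : R) : 0 <= t -> fcos (g 0%N 0%N t) 0 = 0.
Proof.
move=> t0; rewrite -[RHS](b_mean S t0); apply: eq_cint => x.
by rewrite omega0 mul0r cos0 mulr1.
Qed.

Lemma sol_fcos0_derive (t : R) j : 0 <= t -> fcos (g 0%N j t) 0 = 0.
Proof.
case: j => [|j] t0; first exact: sol_fcos0.
by rewrite (@fcos_derive _ (fun j => g 0%N j t) j 0 (sol_pjet t0)) omega0 mul0r.
Qed.

Lemma flap_jet (t : R) : 0 <= t -> jet (fun j => mult (flap_symbol alpha) (g 0%N j t)).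
Proof.
case/andP: (b_alpha S) => _ /ltW a2 t0.
exact: mult_jet (sol_pjet t0) ler01 (fun i => flap_symbol_le i a2).
Qed.

Lemma sol_eq j (t x : R) : 0 <= t -> g 1%N j t x =
  - comp_jet F (fun j => g 0%N j t) j.+1 0 x - nu * mult (flap_symbol alpha) (g 0%N j t) x.
Proof.
move=> t0; elim: j x => [|j IH] x; first exact: b_eq S _ _ t0.
apply: (@is_derive1_unique R (g 1%N j t) x); first exact: b_dx S _ _ _ _ t0.
have -> : g 1%N j t = fun x => - comp_jet F (fun j => g 0%N j t) j.+1 0 x -
    nu * mult (flap_symbol alpha) (g 0%N j t) x by apply/funext.
apply: is_derive1B; last by apply: is_derive1Z; exact: flap_jet.
by apply: is_derive1N; apply: comp_jet_jet; [exact: b_F S|exact: sol_jet].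
Qed.

(** The first time derivative inherits periodicity from the equation. *)
Lemma sol_periodic i j (t : R) : (i <= 1)%N -> 0 <= t -> periodic (g i j t) 1.
Proof.
move=> i1 t0; case: i i1 => [_|[_|//]].
  exact: (pjet_periodic j (sol_pjet t0)).
suff p0 : periodic (g 1%N 0%N t) 1 by exact: (pjet_periodic j (conj (sol_jet 1 t0) p0)).
move=> x; rewrite !(b_eq S)//; congr (- _ - _ * _).
  rewrite !(comp_jetS _ _ _ (b_F S) (sol_jet 0 t0)) !big_ord0; have p := sol_pjet t0.
  by rewrite (pjet_periodic 0 p) (pjet_periodic 1 p).
rewrite /mult; congr (lim (_ @ \oo)); apply/funext => n.
congr (2 * _); apply: eq_bigr => k _; congr (_ * (_ * _ + _ * _)).
  by rewrite mulrDr mulr1 cos_omegaD.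
by rewrite mulrDr mulr1 sin_omegaD.
Qed.

Lemma periodic_le (v : R -> R) M : periodic v 1 ->
  (forall x, 0 <= x <= 1 -> `|v x| <= M) -> forall x, `|v x| <= M.
Proof.
move=> pv vM x; rewrite -(int_shift (- Num.floor x) x pv); apply: vM.
have /andP[] := floor_itv x; rewrite intrD1 mulrNz => h1 h2.
by apply/andP; split; lra.
Qed.

(** [M] depends on the solution. Such bounds serve regularity in time and the start of the barriers,
    and never enter a final constant. *)
Lemma sol_bounded i j (T : R) : 0 <= T -> exists2 M, 0 <= M &
  forall t x : R, 0 <= t <= T -> 0 <= x <= 1 -> `|g i j t x| <= M.
Proof.
move=> T0.
have cK : compact (`[0, T]%classic `*` `[0, 1]%classic : set (R * R)).
  by apply: compact_setX; exact: segment_compact.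
have ne : (`[0, T]%classic `*` `[0, 1]%classic : set (R * R)) !=set0.
  by exists (0, 0); split; rewrite /= in_itv/= lexx ?T0 ?ler01.
have cc : {within (`[0, T]%classic `*` `[0, 1]%classic : set (R * R)),
    continuous (fun z : R * R => `|g i j z.1 z.2|)}.
  have sub : (`[0, T]%classic `*` `[0, 1]%classic : set (R * R)) `<=` [set z : R * R | 0 <= z.1].
    by move=> [t x] [/=]; rewrite in_itv/= => /andP[].
  have c0 := continuous_subspaceW sub (b_cont S i j).
  by move=> z; apply: (cvg_comp _ _ (c0 z)); exact: norm_continuous.
have [[t1 x1] _ H] := compact_EVT_max ne cK cc.
exists `|g i j t1 x1| => // t x tT xI.
by apply: (H (t, x)); rewrite inE; split; rewrite /= in_itv.
Qed.

Lemma sol_time_continuous i j (x T : R) : {within `[0, T]%classic, continuous (g i j ^~ x)}.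
Proof.
apply/subspace_continuousP => t; rewrite /= in_itv/= => /andP[t0 tT].
have /subspace_continuousP/(_ (t, x) t0) H := b_cont S i j.
have cp : (s, x) @[s --> within `[0, T] (nbhs t)] -->
    within [set z : R * R | 0 <= z.1] (nbhs (t, x)).
  move=> A /= hA.
  have c1 : continuous (fun s : R => (s, x) : R * R).
    move=> s; have h1 : (fun s : R => s) @ s --> s by exact: cvg_id.
    have h2 : (fun _ : R => x) @ s --> x by exact: cvg_cst.
    by move=> B; apply: (cvg_pair h1 h2).
  have h := c1 t _ hA.
  change (nbhs t (fun s : R => `[0, T]%classic s -> A (s, x))).
  apply: (@filterS _ (nbhs t) _ _ _ _ h) => {h} s h /=.
  by rewrite in_itv/= => /andP[s0 _]; exact: h.
exact: cvg_comp _ _ cp H.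
Qed.

Lemma sol_lip i j (T : R) : 0 <= T -> exists2 M, 0 <= M &
  forall s t x : R, 0 <= s <= T -> 0 <= t <= T -> 0 <= x <= 1 ->
    `|g i j s x - g i j t x| <= M * `|s - t|.
Proof.
move=> T0; have [M M0 HM] := sol_bounded i.+1 j T0.
exists M => //.
have key (s t x : R) : 0 <= s -> s < t -> t <= T -> 0 <= x <= 1 ->
    `|g i j t x - g i j s x| <= M * (t - s).
  move=> s0 st tT x01.
  have [y||y] := @MVT _ (g i j ^~ x) (g i.+1 j ^~ x) s t st.
  - by rewrite in_itv/= => /andP[sy _]; apply: (b_dt S); exact: le_lt_trans sy.
  - apply: continuous_subspaceW (@sol_time_continuous i j x T) => y /=.
    by rewrite !in_itv/= => /andP[sy yt]; rewrite (le_trans s0 sy) (le_trans yt tT).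
  rewrite in_itv/= => /andP[sy yt] ->; rewrite normrM [`|t - s|]gtr0_norm ?subr_gt0//.
  rewrite ler_wpM2r ?subr_ge0 ?(ltW st)// HM//.
  by rewrite (le_trans s0 (ltW sy)) (le_trans (ltW yt) tT).
move=> s t x /andP[s0 sT] /andP[t0 tT] x01.
have [st|ts|->] := ltgtP s t; last by rewrite !subrr normr0 mulr0.
  by rewrite distrC [`|s - t|]distrC [`|t - s|]gtr0_norm ?subr_gt0//; exact: key.
by rewrite [`|s - t|]gtr0_norm ?subr_gt0//; exact: key.
Qed.

Lemma sol_quad j (T : R) : 0 <= T -> exists2 M, 0 <= M &
  forall s t x : R, 0 < s <= T -> 0 < t <= T ->
    `|g 0%N j s x - g 0%N j t x - (s - t) * g 1%N j t x| <= M * `|s - t| ^+ 2.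
Proof.
move=> T0; have [M M0 HM] := sol_lip 1 j T0.
exists M => // s t x0 /andP[s0 sT] /andP[t0 tT].
have ps := sol_periodic j (leqnSn 0) (ltW s0).
have pt := sol_periodic j (leqnSn 0) (ltW t0).
have p1 := sol_periodic j (leqnn 1) (ltW t0).
apply: (@periodic_le (fun x => g 0%N j s x - g 0%N j t x - (s - t) * g 1%N j t x)).
  by move=> x; rewrite ps pt p1.
move=> x x01; have pos r : Num.min t s <= r <= Num.max t s -> 0 < r <= T.
  move=> /andP[r1 r2]; rewrite (lt_le_trans _ r1) ?lt_min ?t0 ?s0//=.
  by rewrite (le_trans r2)// ge_max tT sT.
apply: (taylor1_le (F := g 0%N j ^~ x) (f := g 1%N j ^~ x) M0) => r /pos/andP[r0 rT].
  exact: (b_dt S 0 j x r0).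
by apply: HM; rewrite ?(ltW r0) ?(ltW t0).
Qed.

Definition energy (j : nat) (t : R) := cint (fun x => g 0%N j t x ^+ 2).

Lemma energy_derive j (t : R) : 0 < t ->
  is_derive t (1 : R) (energy j) (2 * cint (fun x => g 0%N j t x * g 1%N j t x)).
Proof.
move=> t0; have t20 : 0 <= 2 * t by rewrite mulr_ge0// ltW.
have [M M0 HM] := sol_quad j t20.
have [B B0 HB] := sol_bounded 0 j t20.
have [L L0 HL] := sol_lip 0 j t20.
apply: (@is_derive1_quad _ _ _ _ (2 * B * M + L ^+ 2) t t0) => s st.
have [s0 s2] : 0 < s /\ s <= 2 * t by move: st; rewrite ltr_norml => /andP[]; split; lra.
have t2 : t <= 2 * t by lra.
have c0 r : 0 < r -> continuous (g 0%N j r) by move=> r0; exact: jet_continuous (sol_jet 0 (ltW r0)).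
have c1 : continuous (g 1%N j t) by exact: jet_continuous (sol_jet 1 (ltW t0)).
have cs := c0 s s0; have ct := c0 t t0.
have -> : energy j s - energy j t - 2 * cint (fun x => g 0%N j t x * g 1%N j t x) * (s - t) =
    cint (fun x => g 0%N j s x ^+ 2 - g 0%N j t x ^+ 2 -
      2 * ((s - t) * (g 0%N j t x * g 1%N j t x))).
  rewrite cintB; first last.
  - by do 2 apply: continuous_scale; exact: continuous_mul.
  - by apply: continuous_sub; exact: continuous_exp.
  rewrite cintB; [|exact: continuous_exp|exact: continuous_exp].
  rewrite cintZ; last by apply: continuous_scale; exact: continuous_mul.
  rewrite cintZ; last exact: continuous_mul.
  by rewrite -/(energy j s) -/(energy j t); ring.
apply: norm_cint_le.
  apply: continuous_sub; first by apply: continuous_sub; exact: continuous_exp.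
  by do 2 apply: continuous_scale; exact: continuous_mul.
have ps := sol_periodic j (leqnSn 0) (ltW s0).
have pt := sol_periodic j (leqnSn 0) (ltW t0).
have p1 := sol_periodic j (leqnn 1) (ltW t0).
apply: periodic_le; first by move=> x; rewrite ps pt p1.
move=> x x01.
have q := HM s t x; rewrite s0 s2 t0 t2 in q; have {}q := q isT isT.
have b := HB t x; rewrite (ltW t0) t2 in b; have {}b := b isT x01.
have l := HL s t x; rewrite (ltW s0) s2 (ltW t0) t2 in l; have {}l := l isT isT x01.
(* a^2 - b^2 - 2 b d = 2 b (a - b - d) + (a - b)^2, with d the linear term in time: both parts are
   quadratic in s - t. *)
have -> : g 0%N j s x ^+ 2 - g 0%N j t x ^+ 2 - 2 * ((s - t) * (g 0%N j t x * g 1%N j t x)) =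
  2 * g 0%N j t x * (g 0%N j s x - g 0%N j t x - (s - t) * g 1%N j t x) +
  (g 0%N j s x - g 0%N j t x) ^+ 2 by ring.
apply: le_trans (ler_normD _ _) _; rewrite [X in _ <= X]mulrDl; apply: lerD.
  rewrite !normrM (ger0_norm (ler0n _ 2)) -!mulrA ler_wpM2l//.
  by rewrite ler_pM.
by rewrite normrX -exprMn lerXn2r ?nnegrE// mulr_ge0.
Qed.

(** Includes t = 0, where no derivative in time is at hand. *)
Lemma energy_continuous j (T : R) : {within `[0, T]%classic, continuous (energy j)}.
Proof.
have [T0|T0] := leP 0 T; last first.
  rewrite set_itv_ge; first exact: continuous_subspace0.
  by rewrite bnd_simp -ltNge.
have [B B0 HB] := sol_bounded 0 j T0.
have [L L0 HL] := sol_lip 0 j T0.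
have C0 : 0 <= 2 * B * L by rewrite mulr_ge0// mulr_ge0.
have key (s t : R) : 0 <= s <= T -> 0 <= t <= T -> `|energy j s - energy j t| <= 2 * B * L * `|s - t|.
  move=> sT tT; have /andP[s0 _] := sT; have /andP[t0 _] := tT.
  have c0 r : 0 <= r -> continuous (g 0%N j r) by move=> r0; exact: jet_continuous (sol_jet 0 r0).
  rewrite /energy -cintB; [|by apply: continuous_exp; exact: c0..].
  apply: norm_cint_le; first by apply: continuous_sub; apply: continuous_exp; exact: c0.
  apply: periodic_le.
    by move=> x; rewrite (sol_periodic j (leqnSn 0) s0) (sol_periodic j (leqnSn 0) t0).
  move=> x x01; rewrite subr_sqr normrM mulrC -mulrA.
  apply: ler_pM => //; last exact: HL.
  by apply: le_trans (ler_normD _ _) _; have := HB s x sT x01; have := HB t x tT x01; lra.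
exact: lipschitz_within C0 key.
Qed.

Lemma energy_dissipation j (t : R) : 0 < t ->
  is_derive t (1 : R) (energy j)
    (- 2 * cint (fun x => g 0%N j t x * comp_jet F (fun j => g 0%N j t) j.+1 0 x)
     - 2 * nu * cint (fun x => g 0%N j t x * mult (flap_symbol alpha) (g 0%N j t) x)).
Proof.
move=> t0; have d := energy_derive j t0; apply: (is_derive_eq d).
have cG := jet_continuous j (sol_jet 0 (ltW t0)).
have cF := jet_continuous j.+1 (comp_jet_jet 0 (b_F S) (sol_jet 0 (ltW t0))).
have cL := jet_continuous j (flap_jet (ltW t0)).
have -> : cint (fun x => g 0%N j t x * g 1%N j t x) =
    - cint (fun x => g 0%N j t x * comp_jet F (fun j => g 0%N j t) j.+1 0 x) -
    nu * cint (fun x => g 0%N j t x * mult (flap_symbol alpha) (g 0%N j t) x); last by ring.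
rewrite (@eq_cint _ _ (fun x => - (g 0%N j t x * comp_jet F (fun j => g 0%N j t) j.+1 0 x) -
   nu * (g 0%N j t x * mult (flap_symbol alpha) (g 0%N j t) x))).
  rewrite cintB; first last.
  - by apply: continuous_scale; exact: continuous_mul.
  - by apply: continuous_opp; exact: continuous_mul.
  rewrite cintN; last exact: continuous_mul.
  by rewrite cintZ; last exact: continuous_mul.
by move=> x; rewrite sol_eq ?(ltW t0)//; ring.
Qed.

Lemma dissipation_cvg j (t : R) : 0 <= t ->
  2 * \sum_(i < n) flap_symbol alpha i.+1 * fmod (g 0%N j t) i.+1 ^+ 2 @[n --> \oo] -->
  cint (fun x => g 0%N j t x * mult (flap_symbol alpha) (g 0%N j t) x).
Proof.
move=> t0; case/andP: (b_alpha S) => _ /ltW a2.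
have pj : pjet (fun i => g 0%N (j + i)%N t) := pjet_shift j (sol_pjet t0).
have cG := jet_continuous j (sol_jet 0 t0).
have cL := jet_continuous j (flap_jet t0).
have := @parseval_mult _ (flap_symbol alpha) (fun i => g 0%N (j + i)%N t) (g 0%N j t)
  (mult (flap_symbol alpha) (g 0%N j t)) 1 2 pj ler01 cG cL (fun i => flap_symbol_le i a2).
rewrite addn0 => /(_ (fun=> erefl)).
by under eq_fun do under eq_bigr do rewrite -!expr2 -fmod_sqr.
Qed.

(** If W = sigma (t + c) u_x had a maximum above 1 on [0, T], then at that point u_xx = 0 and the
    equation gives u_xt <= - sigma u_x^2, so that W_t <= sigma u_x (1 - W) < 0. That is impossible
    at a maximum reached from earlier times. *)
Lemma gradient_bound (T x : R) : 0 <= T -> sigma * (T + (sigma * D)^-1) * g 0%N 1%N T x <= 1.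
Proof.
have s0 := b_sigma S; have D0 : 0 < D := lt_trans ltr01 (b_D S).
(* With this shift, W at time 0 is u_x / D, at most 1 by [b_init]. *)
pose c := (sigma * D)^-1; have c0 : 0 < c by rewrite invr_gt0 mulr_gt0.
move=> T0; pose W t y := sigma * (t + c) * g 0%N 1%N t y.
have cK : compact (`[0, T]%classic `*` `[0, 1]%classic : set (R * R)).
  by apply: compact_setX; exact: segment_compact.
have ne : (`[0, T]%classic `*` `[0, 1]%classic : set (R * R)) !=set0.
  by exists (0, 0); split; rewrite /= in_itv/= lexx ?T0 ?ler01.
have cW : {within (`[0, T]%classic `*` `[0, 1]%classic : set (R * R)),
    continuous (fun z : R * R => W z.1 z.2)}.
  have sub : (`[0, T]%classic `*` `[0, 1]%classic : set (R * R)) `<=` [set z : R * R | 0 <= z.1].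
    by move=> [t y] [/=]; rewrite in_itv/= => /andP[].
  have c1 := continuous_subspaceW sub (b_cont S 0 1).
  have c2 : continuous (fun z : R * R => sigma * (z.1 + c)).
    by move=> z; apply: cvgM; [exact: cvg_cst|apply: cvgD; [exact: cvg_fst|exact: cvg_cst]].
  have c3 := @continuous_subspaceT _ _ (`[0, T]%classic `*` `[0, 1]%classic : set (R * R)) _ c2.
  by move=> z; apply: cvgM; [exact: c3|exact: c1].
have [[t1 x1] tx1 H] := compact_EVT_max ne cK cW.
have [t1T x01] : 0 <= t1 <= T /\ 0 <= x1 <= 1.
  by move: tx1; rewrite inE => -[/=]; rewrite !in_itv.
have /andP[t10 t1T'] := t1T.
have Hmax t y : 0 <= t <= T -> W t y <= W t1 x1.
  move=> tT; have /andP[t0 _] := tT.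
  have pW : g 0%N 1%N t y = g 0%N 1%N t (y + (- Num.floor y)%:~R).
    by rewrite int_shift//; exact: sol_periodic.
  rewrite /W pW; apply: (H (t, y + (- Num.floor y)%:~R)); rewrite inE; split; rewrite /= in_itv//=.
  have /andP[] := floor_itv y; rewrite intrD1 mulrNz => h1 h2.
  by apply/andP; split; lra.
apply: le_trans (Hmax T x _) _; first by rewrite T0 lexx.
rewrite leNgt; apply/negP => W1.
have tc0 : 0 < t1 + c by rewrite ltr_wpDl.
have v0 : 0 < g 0%N 1%N t1 x1.
  by move: (lt_trans ltr01 W1); rewrite /W pmulr_rgt0// mulr_gt0.
have [t1z|t1n] := eqVneq t1 0.
  move: W1; rewrite t1z /W add0r /c invfM mulrA divff ?gt_eqF// mul1r.
  by rewrite ltr_pdivlMl// mulr1 ltNge (b_init S).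
have t1gt : 0 < t1 by rewrite lt_neqAle eq_sym t1n.
have vmax y : g 0%N 1%N t1 y <= g 0%N 1%N t1 x1.
  by have := Hmax t1 y t1T; rewrite /W ler_pM2l// mulr_gt0.
have vx0 : g 0%N 2%N t1 x1 = 0.
  have d := b_dx S 0 1 _ x1 t10.
  have h1 : x1 - 1 <= x1 + 1 by lra.
  have h2 : x1 \in `]x1 - 1, x1 + 1[ by rewrite in_itv/=; apply/andP; split; lra.
  have [h3 h4] := @derive1_at_max _ (g 0%N 1%N t1) (x1 - 1) (x1 + 1) x1 h1
    (fun y _ => @ex_derive _ _ _ _ _ _ _ (b_dx S 0 1 t1 y t10)) h2 (fun y _ => vmax y).
  by rewrite -(@derive_val _ _ _ _ _ _ _ d) h4.
have L0 : 0 <= mult (flap_symbol alpha) (g 0%N 1%N t1) x1.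
  have a02 : 0 < alpha < 2 by case/andP: (b_alpha S) => a1 ->; rewrite (lt_trans ltr01 a1).
  apply: (@mult_flap_max_ge0 _ (fun j => g 0%N j.+1 t1) x1 _ _ _ _ a02) => //.
    exact: (pjet_shift 1 (sol_pjet t10)).
  exact: (sol_fcos0_derive 1 t10).
have vt : g 1%N 1%N t1 x1 <= - sigma * g 0%N 1%N t1 x1 ^+ 2.
  rewrite (sol_eq 1 x1 t10) (comp_jetS _ _ _ (b_F S) (sol_jet 0 t10)).
  rewrite vx0 mulr0 add0r big_ord1 bin1 mul1r subn0.
  rewrite (comp_jetS _ _ _ (b_F S) (sol_jet 0 t10)).
  rewrite big_ord0 addr0 -mulrA -expr2.
  have : 0 <= nu * mult (flap_symbol alpha) (g 0%N 1%N t1) x1.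
    by rewrite mulr_ge0//; case/andP: (b_nu S) => /ltW.
  have : sigma * g 0%N 1%N t1 x1 ^+ 2 <= F 2%N (g 0%N 0%N t1 x1) * g 0%N 1%N t1 x1 ^+ 2.
    by rewrite ler_wpM2r ?sqr_ge0// (b_convex S).
  lra.
pose dW := sigma * g 0%N 1%N t1 x1 + sigma * (t1 + c) * g 1%N 1%N t1 x1.
have dWd : is_derive t1 (1 : R) (fun t => W t x1) dW.
  have := is_derive1M (is_derive1_affine sigma (sigma * c) t1) (b_dt S 0 1 x1 t1gt).
  by rewrite -mulrDr; under eq_fun do rewrite -mulrDr.
have dWneg : dW < 0.
  have : sigma * (t1 + c) * g 1%N 1%N t1 x1 <=
      - (sigma * g 0%N 1%N t1 x1) * W t1 x1.
    rewrite /W; apply: le_trans (ler_wpM2l _ vt) _; first by rewrite ltW// mulr_gt0.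
    by rewrite le_eqVlt; apply/orP; left; apply/eqP; ring.
  have sv : 0 < sigma * g 0%N 1%N t1 x1 by rewrite mulr_gt0.
  rewrite /dW; move: (sigma * g 0%N 1%N t1 x1) (W t1 x1) W1 sv => p q q1 p0 h.
  have : 0 < p * (q - 1) by rewrite mulr_gt0// subr_gt0.
  lra.
have cvd := is_derive1_seq dWd.
(* The maximum may be at t1 = T, so the difference quotients are taken from the left, at times that
   stay in [0, t1]. *)
have hc : - (t1 / l.+1%:R) @[l --> \oo] --> (0 : R).
  rewrite -[X in _ --> X](_ : - (t1 * 0) = 0); last by rewrite mulr0 oppr0.
  by apply: cvgN; apply: cvgM; [exact: cvg_cst|exact: cvg_harmonic].
have hn l : - (t1 / l.+1%:R) != 0.
  by rewrite oppr_eq0 mulf_neq0// invr_neq0// pnatr_eq0.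
have : 0 <= dW.
  apply: (cvg_ge_bound (N := 0%N) (cvd _ hc hn)) => l _.
  have tl : 0 < t1 / l.+1%:R by rewrite divr_gt0// ltr0n.
  have tl1 : t1 / l.+1%:R <= t1 by rewrite ler_pdivrMr ?ltr0n// ler_peMr ?(ltW t1gt)// ler1n.
  rewrite invrN mulNr -mulrN mulr_ge0 ?invr_ge0 ?(ltW tl)// oppr_ge0 subr_le0.
  move: (t1 / _) tl tl1 => d d0 d1.
  by apply: Hmax; apply/andP; split; lra.
by rewrite leNgt dWneg.
Qed.

End BasicFacts.

Arguments energy {R} g j t.

(** * Consequences of an upper bound on the derivative *)

Section OneSided.
Context {R : realType}.
Implicit Types (v w : R -> R) (M x y : R).

Lemma one_sided_lip v w M x y : (forall z, is_derive z (1 : R) v (w z)) -> (forall z, w z <= M) ->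
  x <= y -> v y - v x <= M * (y - x).
Proof.
rewrite le_eqVlt => dv wM /predU1P[->|xy]; first by rewrite !subrr mulr0.
have cv : {within `[x, y], continuous v}.
  by apply: continuous_subspaceT => z; exact: (is_derive_continuous dv).
have [z _ ->] := @MVT _ v w x y xy (fun z _ => dv z) cv.
by rewrite ler_wpM2r// subr_ge0 ltW.
Qed.

Lemma one_sided_osc v w M x y : 0 <= M -> periodic v 1 ->
  (forall z, is_derive z (1 : R) v (w z)) -> (forall z, w z <= M) -> v y - v x <= M.
Proof.
move=> M0 pv dv wM; pose k := - Num.floor (y - x).
have /andP[k1 k2] := floor_itv (y - x); rewrite intrD1 in k2.
have kE : k%:~R = - (Num.floor (y - x))%:~R :> R by rewrite mulrNz.
rewrite -(int_shift k y pv).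
apply: le_trans (one_sided_lip dv wM _) _; first by rewrite kE; lra.
by rewrite ler_piMr// kE; lra.
Qed.

Lemma one_sided_sup v w M x : 0 <= M -> periodic v 1 -> cint v = 0 ->
  (forall z, is_derive z (1 : R) v (w z)) -> (forall z, w z <= M) -> `|v x| <= M.
Proof.
move=> M0 pv mv dv wM; have cv := is_derive_continuous dv.
have osc y z := one_sided_osc y z M0 pv dv wM.
(* The mean is zero, so [v x] is an average of oscillations. *)
have -> : v x = cint (fun y => v x - v y).
  rewrite cintB//; last exact: continuous_cst.
  by rewrite cint_cst mv subr0.
apply: norm_cint_le; first by apply: continuous_sub => //; exact: continuous_cst.
by move=> y; rewrite ler_norml; have := osc x y; have := osc y x; lra.
Qed.

Lemma one_sided_abs v w M : 0 <= M -> periodic v 1 -> continuous w ->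
  (forall z, is_derive z (1 : R) v (w z)) -> (forall z, w z <= M) ->
  cint (fun x => `|w x|) <= 2 * M.
Proof.
move=> M0 pv cw dv wM.
(* From w <= M follows |w| <= 2 M - w, and the derivative [w] of a periodic function has mean
   zero. *)
apply: (@le_trans _ _ (cint (fun x => 2 * M - w x))).
  apply: le_cint; [exact: continuous_norm|by apply: continuous_sub => //; exact: continuous_cst|].
  by move=> x; have := wM x; case: (ger0P (w x)); lra.
rewrite cintB//; last exact: continuous_cst.
by rewrite cint_cst (cint_FTC dv cw) -[X in v X]add0r pv subrr subr0.
Qed.

End OneSided.

Section AprioriBounds.
Context {R : realType} {alpha sigma D nu : R} {F : nat -> R -> R}
  {g : nat -> nat -> R -> R -> R}.
Hypothesis S : burgers alpha sigma D nu F g.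

Let D_gt0 : 0 < D. Proof. exact: lt_trans ltr01 (b_D S). Qed.

Lemma sol_grad_le (t x : R) : 0 <= t -> g 0%N 1%N t x <= D.
Proof.
move=> t0; have s0 := b_sigma S; have := gradient_bound S x t0.
have [v0|v0 h] := leP (g 0%N 1%N t x) 0; first by move=> _; exact: le_trans v0 (ltW D_gt0).
have : sigma * (sigma * D)^-1 * g 0%N 1%N t x <= 1.
  apply: le_trans h; rewrite ler_wpM2r ?(ltW v0)// ler_wpM2l ?(ltW s0)//; lra.
by rewrite invfM mulrA divff ?gt_eqF// mul1r ler_pdivrMl// mulr1.
Qed.

Lemma sol_grad_le_time (t x : R) : 0 < t -> g 0%N 1%N t x <= (sigma * t)^-1.
Proof.
move=> t0; have s0 := b_sigma S; have := gradient_bound S x (ltW t0).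
have st : 0 < sigma * t by rewrite mulr_gt0.
have [v0|v0 h] := leP (g 0%N 1%N t x) 0.
  by move=> _; apply: le_trans v0 _; rewrite invr_ge0 ltW.
have : sigma * t * g 0%N 1%N t x <= 1.
  apply: le_trans h; rewrite ler_wpM2r ?(ltW v0)// ler_wpM2l ?(ltW s0)// lerDl.
  by rewrite invr_ge0 mulr_ge0// ltW.
by rewrite -ler_pdivlMl// mulr1.
Qed.

Lemma sol_le (t x : R) : 0 <= t -> `|g 0%N 0%N t x| <= D.
Proof.
move=> t0; apply: (one_sided_sup x (ltW D_gt0) (b_periodic S t0) (b_mean S t0)
  (fun z => b_dx S 0 0 t z t0)) => z; exact: sol_grad_le.
Qed.

Lemma sol_le_time (t x : R) : 0 < t -> `|g 0%N 0%N t x| <= (sigma * t)^-1.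
Proof.
move=> t0; have t1 := ltW t0; have s0 := b_sigma S.
have c0 : 0 <= (sigma * t)^-1 by rewrite invr_ge0 mulr_ge0// ltW.
apply: (one_sided_sup x c0 (b_periodic S t1) (b_mean S t1)
  (fun z => b_dx S 0 0 t z t1)) => z; exact: sol_grad_le_time.
Qed.

Lemma sol_grad_abs (t : R) : 0 <= t -> cint (fun x => `|g 0%N 1%N t x|) <= 2 * D.
Proof.
move=> t0; apply: (one_sided_abs (ltW D_gt0) (b_periodic S t0) _ (fun z => b_dx S 0 0 t z t0)).
  exact: jet_continuous (sol_jet S 0 t0).
by move=> z; exact: sol_grad_le.
Qed.

(** The coefficients of u_x are at most 2 |u_x|_1 <= 4 D; one derivative is a factor omega k >=
    k. *)
Lemma sol_fmod (t : R) i : 0 <= t -> 0 <= fmod (g 0%N 0%N t) i.+1 <= 4 * D / i.+1%:R.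
Proof.
move=> t0; rewrite fmod_ge0/=; have pG := sol_pjet S t0.
have c1 : continuous (g 0%N 1%N t) by exact: jet_continuous (sol_jet S 0 t0).
have h := fmod_le i.+1 c1; have := sol_grad_abs t0.
rewrite (fmod_derive 1 i.+1 pG) expr1 in h.
rewrite ler_pdivlMr ?ltr0n// => h2.
have : i.+1%:R * fmod (g 0%N 0%N t) i.+1 <= omega i.+1 * fmod (g 0%N 0%N t) i.+1.
  by rewrite ler_wpM2r ?fmod_ge0// omega_ge.
lra.
Qed.

End AprioriBounds.

(** * From weighted spectral sums to sup and L_2 bounds *)

Section SpectralBounds.
Context {R : realType}.
Implicit Types (G : nat -> R -> R) (x N Z r A : R).

Lemma fourier_sup G a B : pjet G -> fcos (G 0%N) 0 = 0 ->
  (forall M, \sum_(i < M) i.+1%:R `^ a%:R * fmod (G 0%N) i.+1 <= B) ->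
  forall x, `|G a x| <= 2 * (2 * pi) ^+ a * B.
Proof.
move=> pG c0 sB x.
have pGa := pjet_shift a pG.
have c0a : fcos (G a) 0 = 0.
  by case: a {sB pGa} => [//|a]; rewrite fcos_derive// omega0 mul0r.
have := @pjet_inversion _ (fun j => G (a + j)%N) x pGa; rewrite addn0 => /(_ c0a) ->.
have [B' B'0 HB] := mult_cvg 0 pGa (ler01 : 0 <= 1 :> R).
have q1 i : `|(fun=> 1 : R) i.+1| <= 1 * omega i.+1 ^+ 0.
  by rewrite expr0 mulr1 normr1.
have [cv _] := HB (fun=> 1) q1 x; rewrite -[X in `|X|]subr0 addn0 in cv *.
apply: (cvg_norm_le (N := 0%N) cv) => n _; rewrite subr0 /mult_partial normrM ger0_norm//.
rewrite -mulrA ler_wpM2l//.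
apply: (@le_trans _ _ ((2 * pi) ^+ a * \sum_(i < n) i.+1%:R `^ a%:R * fmod (G 0%N) i.+1)).
  apply: le_trans (ler_norm_sum _ _ _) _; rewrite mulr_sumr; apply: ler_sum => i _.
  rewrite mul1r; apply: le_trans (fterm_le _ _ _) _.
  by rewrite fmod_derive// /omega exprMn -mulrA powR_mulrn.
by rewrite ler_wpM2l// exprn_ge0// mulr_ge0// pi_ge0.
Qed.

Lemma fourier_energy G a : pjet G -> fcos (G 0%N) 0 = 0 ->
  2 * (2 * pi) ^+ a.*2 * \sum_(i < n) i.+1%:R `^ (2 * a%:R) * fmod (G 0%N) i.+1 ^+ 2 @[n --> \oo] -->
  cint (fun x => G a x ^+ 2).
Proof.
move=> pG c0.
have pGa := pjet_shift a pG.
have c0a : fcos (G a) 0 = 0.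
  by case: a {pGa} => [//|a]; rewrite fcos_derive// omega0 mul0r.
have := parseval pGa; rewrite addn0 => /(_ c0a).
rewrite (_ : (fun n => _) = (fun n => 2 * (2 * pi) ^+ a.*2 *
   \sum_(i < n) i.+1%:R `^ (2 * a%:R) * fmod (G 0%N) i.+1 ^+ 2))//.
apply/funext => n; rewrite -mulrA; congr (2 * _); rewrite mulr_sumr; apply: eq_bigr => i _.
rewrite fmod_derive// exprMn -exprM /omega exprMn -mulrA muln2.
by rewrite -natrM mul2n powR_mulrn.
Qed.

Lemma spectral_sup r A Z a : 0 <= A -> 0 <= Z -> (0 < a)%N -> a%:R < r - 2^-1 ->
  exists2 C, 0 < C & forall G N, pjet G -> fcos (G 0%N) 0 = 0 ->
  (forall i, 0 <= fmod (G 0%N) i.+1 <= A / i.+1%:R) -> 1 <= N ->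
  (forall M, \sum_(i < M) i.+1%:R `^ (2 * r) * fmod (G 0%N) i.+1 ^+ 2 <= Z * N `^ (2 * r - 1)) ->
  forall x, `|G a x| <= C * N ^+ a.
Proof.
move=> A0 Z0 a0 ar; have a0' : 0 < a%:R :> R by rewrite ltr0n.
have [C C0 HC] := interp_abs a0' ar A0 Z0.
have p0 : 0 < 2 * (2 * pi) ^+ a :> R by rewrite mulr_gt0// exprn_gt0// mulr_gt0// pi_gt0.
exists (2 * (2 * pi) ^+ a * C); first exact: mulr_gt0.
move=> G N pG c0 fA N1 fZ x.
have := fourier_sup pG c0 (HC (fun i => fmod (G 0%N) i.+1) N fA N1 fZ) x.
by rewrite powR_mulrn ?(le_trans ler01)// mulrA.
Qed.

Lemma spectral_energy r A Z a : 0 <= A -> 0 <= Z -> (0 < a)%N -> a%:R <= r ->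
  exists2 C, 0 < C & forall G N, pjet G -> fcos (G 0%N) 0 = 0 ->
  (forall i, 0 <= fmod (G 0%N) i.+1 <= A / i.+1%:R) -> 1 <= N ->
  (forall M, \sum_(i < M) i.+1%:R `^ (2 * r) * fmod (G 0%N) i.+1 ^+ 2 <= Z * N `^ (2 * r - 1)) ->
  cint (fun x => G a x ^+ 2) <= C * N ^+ a.*2.-1.
Proof.
move=> A0 Z0 a0 ar; have a0' : 2^-1 < a%:R :> R.
  by have : 1 <= a%:R :> R; [rewrite ler1n|lra].
have [C C0 HC] := interp_sqr a0' ar A0 Z0.
have p0 : 0 < 2 * (2 * pi) ^+ a.*2 :> R by rewrite mulr_gt0// exprn_gt0// mulr_gt0// pi_gt0.
exists (2 * (2 * pi) ^+ a.*2 * C); first exact: mulr_gt0.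
move=> G N pG c0 fA N1 fZ.
apply: (cvg_le_bound (N := 0%N) (fourier_energy pG c0)) => n _.
rewrite -[leRHS]mulrA ler_wpM2l ?(ltW p0)//.
apply: le_trans (HC (fun i => fmod (G 0%N) i.+1) N fA N1 fZ n) _.
rewrite -powR_mulrn ?(le_trans ler01)//.
rewrite (_ : 2 * a%:R - 1 = a.*2.-1%:R)// -natrM mul2n -subn1 natrB//.
by rewrite double_gt0.
Qed.

End SpectralBounds.

(** * Decay of the energies *)

Section Nonlinear.
Context {R : realType}.
Implicit Types (F G : nat -> R -> R) (x N r A D : R).

(** Lets estimates proved order by order share one constant. *)
Lemma uniform_const (P : nat -> R -> Prop) m :
  (forall a C C', P a C -> C <= C' -> P a C') ->
  (forall a, (1 <= a <= m)%N -> exists2 C, 0 < C & P a C) ->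
  exists2 C, 0 < C & forall a, (1 <= a <= m)%N -> P a C.
Proof.
move=> Pmono; elim: m => [|m IH] HP.
  by exists 1 => // a /andP[a1 a0]; move: (leq_trans a1 a0).
have [a /andP[a1 am]|C C0 HC] := IH; first by apply: HP; rewrite a1 leqW.
have [|C' C'0 HC'] := HP m.+1; first by rewrite /=.
exists (C + C') => [|a /andP[a1]]; first exact: addr_gt0.
rewrite leq_eqVlt => /predU1P[->|am].
  by apply: Pmono HC' _; rewrite lerDr ltW.
by apply: Pmono (HC a _) _; [rewrite a1|rewrite lerDl ltW].
Qed.

(** Solutions take their values in [-D, D], so bounds on the derivatives of the flux are taken
    there. *)
Lemma jet_bounded F D : jet F -> exists M : nat -> R,
  (forall k, 0 <= M k) /\ forall k y, `|y| <= D -> `|F k y| <= M k.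
Proof.
move=> jF; have H k : exists M, 0 <= M /\ forall y, `|y| <= D -> `|F k y| <= M.
  have [D0|D0] := leP 0 D; last first.
    by exists 0; split => // y /(le_trans (normr_ge0 y)); rewrite leNgt D0.
  have Dle : - D <= D by lra.
  have cF : {within `[- D, D], continuous (fun y => `|F k y|)}.
    by apply: continuous_subspaceT => y; apply: cvg_norm; exact: (jet_continuous k jF).
  have [c _ Hc] := EVT_max Dle cF.
  by exists `|F k c|; split => // y; rewrite ler_norml => yD; apply: Hc; rewrite in_itv.
have [M HM] := choice H.
by exists M; split => k; have [] := HM k.
Qed.

(** The integrand has 2 m + 1 derivatives in all, but two factors are measured in L_2, where squares
    are bounded by N^(2 a - 1); this saves one power of [N]. The term with u^(m+1) is a derivative
    up to lower order and is integrated by parts. *)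
Lemma nonlinear_bound F D A m r : jet F -> 0 <= D -> 0 <= A -> (0 < m)%N -> m%:R < r - 2^-1 ->
  exists2 C, 0 < C & forall G N, pjet G -> fcos (G 0%N) 0 = 0 ->
  (forall x, `|G 0%N x| <= D) ->
  (forall i, 0 <= fmod (G 0%N) i.+1 <= A / i.+1%:R) -> 1 <= N ->
  (forall M, \sum_(i < M) i.+1%:R `^ (2 * r) * fmod (G 0%N) i.+1 ^+ 2 <= 1 * N `^ (2 * r - 1)) ->
  `|cint (fun x => G m x * comp_jet F G m.+1 0 x)| <= C * N ^+ m.*2.
Proof.
move=> jF D0 A0 m0 mr.
have [MF [MF0 HMF]] := jet_bounded D jF.
pose Sp G N := [/\ pjet G, fcos (G 0%N) 0 = 0,
  forall i, 0 <= fmod (G 0%N) i.+1 <= A / i.+1%:R, 1 <= N &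
  forall M, \sum_(i < M) i.+1%:R `^ (2 * r) * fmod (G 0%N) i.+1 ^+ 2 <= 1 * N `^ (2 * r - 1)].
have [b b0 Hb] : exists2 b, 0 < b & forall a, (1 <= a <= m)%N ->
    forall G N, Sp G N -> forall x, `|G a x| <= b * N ^+ a.
  apply: uniform_const => [a C C' HC CC G N SG x|a /andP[a1 am]].
    have [_ _ _ N1 _] := SG; apply: le_trans (HC G N SG x) _.
    by rewrite ler_wpM2r// exprn_ge0// (le_trans ler01).
  have ar : a%:R < r - 2^-1 by apply: le_lt_trans mr; rewrite ler_nat.
  have [C C0 HC] := spectral_sup A0 (ler01 : 0 <= 1 :> R) a1 ar.
  by exists C => // G N [*]; exact: HC.
have [e e0 He] : exists2 e, 0 < e & forall a, (1 <= a <= m)%N ->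
    forall G N, Sp G N -> cint (fun x => G a x ^+ 2) <= e * N ^+ a.*2.-1.
  apply: uniform_const => [a C C' HC CC G N SG|a /andP[a1 am]].
    have [_ _ _ N1 _] := SG; apply: le_trans (HC G N SG) _.
    by rewrite ler_wpM2r// exprn_ge0// (le_trans ler01).
  have ar : a%:R <= r by have : a%:R <= m%:R :> R; [rewrite ler_nat|lra].
  have [C C0 HC] := spectral_energy A0 (ler01 : 0 <= 1 :> R) a1 ar.
  by exists C => // G N [*]; exact: HC.
have [q q0 Hq] : exists2 q, 0 < q & forall i, (1 <= i <= m)%N ->
    forall G N, Sp G N -> (forall x, `|G 0%N x| <= D) ->
    forall x, `|comp_jet F G i 1 x| <= q * N ^+ i.
  apply: uniform_const => [a C C' HC CC G N SG GD x|a /andP[a1 am]].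
    have [_ _ _ N1 _] := SG; apply: le_trans (HC G N SG GD x) _.
    by rewrite ler_wpM2r// exprn_ge0// (le_trans ler01).
  have [C C0 HC] := comp_jet_bound a 1 (ltW b0) MF0.
  exists (C + 1) => [|G N SG GD x]; first by rewrite ltr_wpDl.
  have [pG _ _ N1 _] := SG.
  have N0 : 0 <= N by apply: le_trans N1.
  apply: le_trans (HC F G N x jF pG.1 N0 (fun k => HMF k _ (GD x)) _) _.
    by move=> c /andP[c1 ca]; apply: Hb => //; rewrite c1 (leq_trans ca).
  by rewrite ler_wpM2r ?exprn_ge0// lerDl.
exists (MF 2%N * b * e + \sum_(i < m) 'C(m, i.+1)%:R * (q * e) + 1).
  by rewrite ltr_wpDl// addr_ge0//= ?sumr_ge0// => [|i _]; rewrite !mulr_ge0 ?(ltW b0) ?(ltW e0) ?(ltW q0).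
move=> G N pG c0 GD fA N1 fZ; have SG : Sp G N by [].
have N0 : 0 <= N by apply: le_trans N1.
have cG a : continuous (G a) by exact: (jet_continuous a pG.1).
have cF k : continuous (fun x => F k (G 0%N x)).
  by move=> x; apply: (cvg_comp _ _ (cG 0%N x)); exact: (jet_continuous k jF).
have cC n k : continuous (comp_jet F G n k) by exact: (jet_continuous n (comp_jet_jet k jF pG.1)).
rewrite (@eq_cint _ _ (fun x => G m x * (F 1%N (G 0%N x) * G m.+1 x) +
    \sum_(i < m) 'C(m, i.+1)%:R * (comp_jet F G i.+1 1 x * (G (m - i)%N x * G m x)))); last first.
  move=> x; rewrite (comp_jetS _ _ _ jF pG.1) mulrDr mulr_sumr; congr (_ + _).
  by apply: eq_bigr => i _; ring.
have cT (i : 'I_m) : continuous (fun x => comp_jet F G i.+1 1 x * (G (m - i)%N x * G m x)).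
  by apply: continuous_mul; [exact: cC|exact: continuous_mul].
have cT0 : continuous (fun x => G m x * (F 1%N (G 0%N x) * G m.+1 x)).
  by apply: continuous_mul => //; exact: continuous_mul.
rewrite cintD//; last by apply: continuous_sum => i; exact: continuous_scale.
rewrite cint_sum; last by move=> i; exact: continuous_scale.
apply: le_trans (ler_normD _ _) _; rewrite mulrDl mul1r; apply: ler_wpDr; first exact: exprn_ge0.
rewrite mulrDl; apply: lerD.
  (* [2 u^(m) F'(u) u^(m+1) = (F'(u) (u^(m))^2)' - F''(u) u_x (u^(m))^2] *)
  pose P' x := F 2%N (G 0%N x) * G 1%N x * G m x ^+ 2 + 2 * (G m x * (F 1%N (G 0%N x) * G m.+1 x)).
  have dP x : is_derive x (1 : R) (fun y => F 1%N (G 0%N y) * (G m y * G m y)) (P' x).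
    have := is_derive1M (is_derive1_chain (jF 1%N (G 0%N x)) (pG.1 0%N x))
      (is_derive1M (pG.1 m x) (pG.1 m x)).
    by move=> d; apply: (is_derive_eq d); rewrite /P'; ring.
  have cP1 : continuous (fun x => F 2%N (G 0%N x) * G 1%N x * G m x ^+ 2).
    by apply: continuous_mul; [exact: continuous_mul|exact: continuous_exp].
  have cP : continuous P' by apply: continuous_add => //; exact: continuous_scale.
  have := cint_FTC dP cP; rewrite cintD//; last exact: continuous_scale.
  rewrite cintZ// -[X in F 1%N (G 0%N X)]add0r -[X in G m X]add0r.
  rewrite (pjet_periodic 0 pG) (pjet_periodic m pG) subrr => E.
  have I2 : `|cint (fun x => F 2%N (G 0%N x) * G 1%N x * G m x ^+ 2)| <= MF 2%N * b * e * N ^+ m.*2.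
    apply: le_trans (le_norm_cint cP1) _.
    apply: (@le_trans _ _ (cint (fun x => MF 2%N * (b * N) * G m x ^+ 2))).
      apply: le_cint; [exact: continuous_norm|by apply: continuous_scale; exact: continuous_exp|].
      move=> x; rewrite normrM [`|_ ^+ 2|]ger0_norm ?sqr_ge0// normrM ler_wpM2r ?sqr_ge0//.
      by rewrite ler_pM// ?HMF//; have := Hb 1%N m0 G N SG x; rewrite expr1.
    rewrite cintZ; last exact: continuous_exp.
    have m1 : (1 <= m <= m)%N by rewrite m0 leqnn.
    apply: le_trans (ler_wpM2l _ (He m m1 G N SG)) _.
      by rewrite mulr_ge0// mulr_ge0// ltW.
    rewrite (_ : N ^+ m.*2 = N * N ^+ m.*2.-1); last by rewrite -exprS prednK// double_gt0.
    by rewrite le_eqVlt; apply/orP; left; apply/eqP; ring.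
  move: E I2; move: (cint _) (cint _) => u v E I2.
  have -> : u = - (2^-1 * v) by lra.
  rewrite normrN normrM ger0_norm ?invr_ge0//.
  have := normr_ge0 v; lra.
apply: le_trans (ler_norm_sum _ _ _) _; rewrite mulr_suml; apply: ler_sum => i _.
rewrite cintZ// normrM ger0_norm// -[leRHS]mulrA ler_wpM2l//.
have i1 : (1 <= i.+1 <= m)%N by rewrite /=.
have mi : (1 <= m - i <= m)%N by rewrite subn_gt0 ltn_ord leq_subr.
have m1 : (1 <= m <= m)%N by rewrite m0 leqnn.
apply: le_trans (le_norm_cint (cT i)) _.
(* AM-GM with weights that give both squares the same final size: N N^(2 m - 1) and N^(2 i + 1) N^(2
   (m - i) - 1) are both N^(2 m). *)
apply: (@le_trans _ _ (cint (fun x => q / 2 * (N * G m x ^+ 2 + N ^+ i.*2.+1 * G (m - i)%N x ^+ 2)))).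
  apply: le_cint; [exact: continuous_norm|apply: continuous_scale|].
    by apply: continuous_add; apply: continuous_scale; exact: continuous_exp.
  move=> x; rewrite normrM.
  apply: (@le_trans _ _ (q * N ^+ i.+1 * `|G (m - i)%N x * G m x|)).
    by rewrite ler_wpM2r//; exact: Hq.
  rewrite -!mulrA ler_wpM2l ?(ltW q0)// normrM.
  rewrite -[G m x ^+ 2]real_normK ?num_real// -[G (m - i)%N x ^+ 2]real_normK ?num_real//.
  have -> : N ^+ i.*2.+1 = N * (N ^+ i) ^+ 2 by rewrite -exprM muln2 -exprS.
  rewrite exprS; move: (N ^+ i) `|G m x| `|G (m - i)%N x| => p u v.
  have : 0 <= N * (u - p * v) ^+ 2 by rewrite mulr_ge0// sqr_ge0.
  lra.
rewrite cintZ; last by apply: continuous_add; apply: continuous_scale; exact: continuous_exp.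
rewrite cintD; [|by apply: continuous_scale; exact: continuous_exp..].
rewrite !cintZ; [|exact: continuous_exp..].
have h1 := ler_wpM2l N0 (He m m1 G N SG).
have h2 := ler_wpM2l (exprn_ge0 i.*2.+1 N0) (He (m - i)%N mi G N SG).
rewrite mulrCA -exprS prednK ?double_gt0// in h1.
rewrite mulrCA -exprD in h2.
have E : (i.*2.+1 + (m - i).*2.-1 = m.*2)%N.
  by have := ltn_ord i; case/andP: mi => mi _ im; lia.
rewrite E in h2; rewrite -[leLHS]mulrA -[leRHS]mulrA ler_wpM2l ?(ltW q0)//; lra.
Qed.

End Nonlinear.

Section Scales.
Context {R : realType}.
Implicit Types (alpha nu t : R).

(* [K] and [kappa] in the outline above. *)
Definition wave alpha nu : R := nu `^ (- beta_exp alpha).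
Definition scale alpha nu t : R := Num.max t^-1 (wave alpha nu).

Lemma wave_ge1 alpha nu : 1 < alpha -> 0 < nu <= 1 -> 1 <= wave alpha nu.
Proof.
move=> a1 /andP[n0 n1]; rewrite /wave powRN invf_ge1 ?powR_gt0//.
by apply: powR_le1 => //; rewrite ?(ltW n0)// invr_ge0 subr_ge0 ltW.
Qed.

Lemma wave_dissipation alpha nu : 1 < alpha -> 0 < nu -> nu * wave alpha nu `^ (alpha - 1) = 1.
Proof.
move=> a1 n0; rewrite /wave -powRrM /beta_exp mulNr mulVf ?subr_eq0 ?gt_eqF//.
by rewrite powR_inv1 ?ltW// divff// gt_eqF.
Qed.

Lemma scale_ge_wave alpha nu t : wave alpha nu <= scale alpha nu t.
Proof. by rewrite le_max lexx orbT. Qed.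

Lemma scale_ge1 alpha nu t : 1 < alpha -> 0 < nu <= 1 -> 1 <= scale alpha nu t.
Proof. by move=> a1 n0; apply: le_trans (scale_ge_wave _ _ _); exact: wave_ge1. Qed.

Lemma is_derive1_invX n (t : R) : t != 0 ->
  is_derive t (1 : R) (fun s => s^-1 ^+ n) (- n%:R * t^-1 ^+ n.+1).
Proof.
move=> t0; elim: n => [|n IH].
  by rewrite oppr0 mul0r; under eq_fun do rewrite expr0; exact: is_derive_cst.
have dV : is_derive t (1 : R) (fun s : R => s^-1) (- t^-1 ^+ 2).
  have d := @is_deriveV R (fun s : R => s) t 1 1 t0 (is_derive_id t (1 : R)).
  by apply: (is_derive_eq d); rewrite /GRing.scale/= mulr1 exprVn.
have d := is_derive1M dV IH; under eq_fun do rewrite exprS.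
by apply: (is_derive_eq d); rewrite -natr1 !exprS; ring.
Qed.

End Scales.

(** * Barriers for the energies *)

Section EnergyDecay.
Context {R : realType}.
Implicit Types (alpha sigma D nu : R) (F : nat -> R -> R) (g : nat -> nat -> R -> R -> R).

Lemma dissipation_lower alpha sigma D nu F g m (t : R) :
  burgers alpha sigma D nu F g -> 0 <= t -> forall n,
  \sum_(i < n) i.+1%:R `^ (2 * (m%:R + alpha / 2)) * fmod (g 0%N 0%N t) i.+1 ^+ 2 <=
  cint (fun x => g 0%N m t x * mult (flap_symbol alpha) (g 0%N m t) x).
Proof.
move=> S t0 n; have pG := sol_pjet S t0; case/andP: (b_alpha S) => a1 a2.
have a0 : 0 < alpha := lt_trans ltr01 a1.
have cv := dissipation_cvg S (j := m) t0.
have s0 i : 0 <= flap_symbol alpha i.+1 * fmod (g 0%N m t) i.+1 ^+ 2.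
  by rewrite mulr_ge0 ?powR_ge0 ?sqr_ge0.
apply: le_trans (partial_sum_le n (ler0n R 2) s0 cv).
apply: (@le_trans _ _ (\sum_(i < n) flap_symbol alpha i.+1 * fmod (g 0%N m t) i.+1 ^+ 2)); last first.
  by rewrite ler_peMl ?ler1n// sumr_ge0.
apply: ler_sum => i _.
have -> : flap_symbol alpha i.+1 * fmod (g 0%N m t) i.+1 ^+ 2 =
    flap_symbol alpha i.+1 * (omega i.+1 ^+ m) ^+ 2 * fmod (g 0%N 0%N t) i.+1 ^+ 2.
  by rewrite (fmod_derive m i.+1 pG) exprMn mulrA.
rewrite ler_wpM2r ?sqr_ge0//.
have o0 : 0 < omega i.+1 :> R by exact: omega_gt0.
rewrite -exprM -powR_mulrn ?(ltW o0)// /flap_symbol -powR_add//.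
rewrite (_ : 2 * (m%:R + alpha / 2) = alpha + (m * 2)%:R); last by rewrite natrM; lra.
by apply: powR_monol => //; [rewrite addr_ge0// ltW|exact: omega_ge].
Qed.

(** The constants [C1] and [C2] are those of the nonlinear term and of the energy in terms of [N];
    [B] remains free for the barrier argument. *)
Lemma energy_decrease alpha D F m : 1 < alpha < 2 -> 0 <= D -> jet F -> (0 < m)%N ->
  exists C1 C2, [/\ 0 < C1, 0 < C2 & forall sigma nu g B kappa (t : R),
    burgers alpha sigma D nu F g -> 0 < t -> 1 <= B -> 2 * C1 <= B `^ (alpha - 1) ->
    wave alpha nu <= kappa -> C2 * (B * kappa) ^+ m.*2.-1 < energy g m t ->
    - 2 * cint (fun x => g 0%N m t x * comp_jet F (fun j => g 0%N j t) m.+1 0 x)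
     - 2 * nu * cint (fun x => g 0%N m t x * mult (flap_symbol alpha) (g 0%N m t) x)
    <= - (B `^ (alpha - 1) * (B * kappa) ^+ m.*2)].
Proof.
case/andP=> a1 a2 D0 jF m0; pose r := m%:R + alpha / 2.
have A0 : 0 <= 4 * D by rewrite mulr_ge0.
have mr : m%:R < r - 2^-1 by rewrite /r; lra.
have mr' : m%:R <= r by rewrite /r; lra.
have [C1 C10 HC1] := nonlinear_bound jF D0 A0 m0 mr.
have [C2 C20 HC2] := spectral_energy A0 (ler01 : 0 <= 1 :> R) m0 mr'.
exists C1, C2; split => // sigma nu g B kappa t S t0 B1 BC kK yB.
have t1 := ltW t0; have pG := sol_pjet S t1; have c0 := sol_fcos0 S t1.
have k1 : 1 <= kappa by apply: le_trans kK; apply: wave_ge1 => //; exact: b_nu S.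
have n0 : 0 < nu by case/andP: (b_nu S).
pose N0 := cint (fun x => g 0%N m t x * mult (flap_symbol alpha) (g 0%N m t) x).
have DL := dissipation_lower m S t1; rewrite -/r -/N0 in DL *.
have N00 : 0 <= N0 by have := DL 0%N; rewrite big_ord0.
have m1 : 1 <= m%:R :> R by rewrite ler1n.
have p0 : 0 < 2 * r - 1 by rewrite /r; lra.
(* The least N >= B kappa at which [dissipation_lower] gives the spectral hypothesis with constant
   1. A large energy excludes N = B kappa, so [N0] equals N^(2 r - 1) = N^(alpha - 1) N^(2 m). *)
pose N := Num.max (B * kappa) (N0 `^ (2 * r - 1)^-1).
have Bk1 : 1 <= B * kappa by rewrite -[1]mulr1 ler_pM.
have N1 : 1 <= N by rewrite le_max Bk1.
have N_ge0 : 0 <= N by apply: le_trans N1.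
have N0N : N0 <= N `^ (2 * r - 1).
  have -> : N0 = (N0 `^ (2 * r - 1)^-1) `^ (2 * r - 1).
    by rewrite -powRrM mulVf ?gt_eqF// powRr1.
  by apply: powR_monol; rewrite ?powR_ge0 ?(ltW p0)// le_max lexx orbT.
have fZ M : \sum_(i < M) i.+1%:R `^ (2 * r) * fmod (g 0%N 0%N t) i.+1 ^+ 2 <= 1 * N `^ (2 * r - 1).
  by rewrite mul1r; apply: le_trans (DL M) N0N.
have fA i := sol_fmod S i t1.
have yN := HC2 (fun j => g 0%N j t) N pG c0 fA N1 fZ.
have NL := HC1 (fun j => g 0%N j t) N pG c0 (fun x => sol_le S x t1) fA N1 fZ.
have BkN : B * kappa < N.
  rewrite ltNge; apply/negP => NB; move: yB; rewrite ltNge => /negP; apply.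
  apply: le_trans yN _; rewrite ler_wpM2l ?(ltW C20)// lerXn2r ?nnegrE//.
  by apply: le_trans Bk1.
have NE : N = N0 `^ (2 * r - 1)^-1.
  by move: BkN; rewrite /N lt_max ltxx/= => h; apply/max_idPr; exact: ltW.
have N0E : N0 = N `^ (alpha - 1) * N ^+ m.*2.
  transitivity (N `^ (2 * r - 1)); first by rewrite NE -powRrM mulVf ?gt_eqF// powRr1.
  have Np : 0 < N by apply: lt_le_trans N1.
  by rewrite -powR_mulrn// -powR_add// -mul2n natrM /r; congr (_ `^ _); lra.
(* Since nu K^(alpha - 1) = 1 and N >= B K; with B^(alpha - 1) >= 2 C1 the dissipation then
   dominates the nonlinear term. *)
have P1 : B `^ (alpha - 1) <= nu * N `^ (alpha - 1).
  have am0 : 0 <= alpha - 1 by lra.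
  have B0 : 0 <= B by apply: le_trans B1.
  have W := wave_dissipation a1 n0.
  have w0 : 0 <= wave alpha nu by exact: powR_ge0.
  have h : (B * wave alpha nu) `^ (alpha - 1) <= N `^ (alpha - 1).
    apply: powR_monol => //; first exact: mulr_ge0.
    by apply: le_trans (ltW BkN); rewrite ler_wpM2l.
  rewrite powRM// in h.
  have := ler_wpM2l (ltW n0) h; rewrite mulrCA W mulr1; exact.
have NX : (B * kappa) ^+ m.*2 <= N ^+ m.*2.
  by rewrite lerXn2r ?nnegrE ?(ltW BkN)//; apply: le_trans Bk1.
move: NL; rewrite ler_norml => /andP[NL _].
rewrite N0E; move: (cint _) NL => w NL.
have NX0 : 0 <= (B * kappa) ^+ m.*2 by rewrite exprn_ge0// (le_trans ler01).
have P0 : 0 <= B `^ (alpha - 1) by exact: powR_ge0.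
move: (N `^ (alpha - 1)) (N ^+ m.*2) ((B * kappa) ^+ m.*2) (B `^ (alpha - 1)) P1 NX NX0 P0 BC NL =>
  p q s b P1 NX NX0 P0 BC NL.
have h1 : 0 <= (nu * p - b) * q by rewrite mulr_ge0 ?subr_ge0//; exact: le_trans NX.
have h2 : 0 <= (b - 2 * C1) * q by rewrite mulr_ge0 ?subr_ge0//; exact: le_trans NX.
have h3 : 0 <= b * (q - s) by rewrite mulr_ge0 ?subr_ge0.
lra.
Qed.

Lemma energy_start alpha sigma D nu F g j : burgers alpha sigma D nu F g ->
  exists M, forall t : R, 0 <= t <= 1 -> energy g j t <= M.
Proof.
move=> S; have [B B0 HB] := sol_bounded S 0 j ler01.
exists (B ^+ 2) => t /andP[t0 t1].
have cG : continuous (g 0%N j t) by exact: jet_continuous (sol_jet S 0 t0).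
apply: le_trans (ler_norm _) _; apply: norm_cint_le; first exact: continuous_exp.
move=> x; rewrite normrX lerXn2r ?nnegrE//.
apply: (@periodic_le _ (g 0%N j t)) x => [x|x x01]; first exact: (sol_periodic S j (leqnSn 0) t0).
by apply: HB => //; rewrite t0.
Qed.

Lemma energy_decay alpha D F m : 1 < alpha < 2 -> 0 <= D -> jet F -> (0 < m)%N ->
  exists2 C, 0 < C & forall sigma nu g (t : R), burgers alpha sigma D nu F g -> 0 < t ->
    energy g m t <= C * scale alpha nu t ^+ m.*2.-1.
Proof.
move=> a12 D0 jF m0; have [C1 [C2 [C10 C20 HC]]] := energy_decrease a12 D0 jF m0.
have a1 : 1 < alpha by case/andP: a12.
pose n := m.*2.-1; have nE : n.+1 = m.*2 by rewrite prednK// double_gt0.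
(* 2 C1 is required by [energy_decrease], n C2 makes the energy fall faster than the barrier C2 B^n
   t^(- n), and 1 ensures B >= 1. *)
pose Q := 1 + 2 * C1 + n%:R * C2; pose B := Q `^ (alpha - 1)^-1.
have nC : 0 <= n%:R * C2 by rewrite mulr_ge0// ltW.
have Q1 : 1 <= Q by rewrite /Q; lra.
have am0 : 0 < alpha - 1 by rewrite subr_gt0.
have BQ : B `^ (alpha - 1) = Q by rewrite /B -powRrM mulVf ?gt_eqF// powRr1// (le_trans ler01).
have B1 : 1 <= B by apply: powR_ge1 => //; rewrite invr_ge0 ltW.
have B0 : 0 < B by apply: lt_le_trans B1.
have BC : 2 * C1 <= B `^ (alpha - 1) by rewrite BQ /Q; lra.
exists (C2 * B ^+ n); first by rewrite mulr_gt0// exprn_gt0.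
move=> sigma nu g t S t0; rewrite -/n.
have K1 : 1 <= wave alpha nu by apply: wave_ge1 => //; exact: b_nu S.
have K0 : 0 < wave alpha nu by apply: lt_le_trans K1.
(* Up to time 1 / K the barrier is a multiple of t^(- n), with kappa = 1 / t. *)
have early s : 0 < s -> s <= (wave alpha nu)^-1 -> energy g m s <= C2 * B ^+ n * s^-1 ^+ n.
  move=> s0 sK; have [M HM] := energy_start m S.
  (* The starting time depends on the solution through [M]: at [d] the barrier exceeds every value
     of the energy on [0, 1]. *)
  pose d := Num.min s (C2 / (Num.max M 1)).
  have M0 : 0 < Num.max M 1 by rewrite lt_max ltr01 orbT.
  have d0 : 0 < d by rewrite lt_min s0 divr_gt0.
  have s1 : s <= 1 by apply: le_trans sK _; rewrite invf_le1.
  have d1 : d <= 1 by rewrite ge_min s1.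
  have ds : d <= s by rewrite ge_min lexx.
  pose phi u := energy g m u - C2 * B ^+ n * u^-1 ^+ n.
  pose dy u := - 2 * cint (fun x => g 0%N m u x * comp_jet F (fun j => g 0%N j u) m.+1 0 x)
     - 2 * nu * cint (fun x => g 0%N m u x * mult (flap_symbol alpha) (g 0%N m u) x).
  suff : phi s <= 0 by rewrite subr_le0.
  apply: (@barrier_le _ phi (fun u => dy u - C2 * B ^+ n * (- n%:R * u^-1 ^+ n.+1)) d s ds).
  - have c1 : {within `[d, s], continuous (energy g m)}.
      apply: (continuous_subspaceW _ (energy_continuous S (j := m) (T := s))) => u /=.
      by rewrite !in_itv/= => /andP[du ->]; rewrite (le_trans (ltW d0)).
    have c2 : {within `[d, s], continuous (fun u => C2 * B ^+ n * u^-1 ^+ n)}.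
      apply: derivable_within_continuous => u; rewrite in_itv/= => /andP[du _].
      have u0 : u != 0 by rewrite gt_eqF// (lt_le_trans d0).
      exact: (@ex_derive _ _ _ _ _ _ _ (is_derive1Z (C2 * B ^+ n) (is_derive1_invX n u0))).
    by move=> u; apply: cvgB; [exact: c1|exact: c2].
  - move=> u /andP[du us]; have u0 : 0 < u := lt_trans d0 du.
    apply: is_derive1B; first exact: (energy_dissipation S m u0).
    by apply: is_derive1Z; apply: is_derive1_invX; rewrite gt_eqF.
  - move=> u /andP[du us]; rewrite subr_gt0 => yu; have u0 : 0 < u := lt_trans d0 du.
    have ku : wave alpha nu <= u^-1.
      by rewrite -[wave _ _]invrK lef_pV2 ?posrE ?invr_gt0// (le_trans (ltW us)).
    have yB : C2 * (B * u^-1) ^+ n < energy g m u by rewrite exprMn mulrA.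
    have := HC sigma nu g B u^-1 u S u0 B1 BC ku yB; rewrite -nE BQ -/(dy u) => h.
    rewrite subr_le0; apply: le_trans h _; rewrite mulNr mulrN lerN2 exprMn mulrA.
    rewrite mulrA ler_wpM2r ?exprn_ge0 ?invr_ge0 ?(ltW u0)//.
    rewrite exprS mulrA mulrAC ler_wpM2r ?exprn_ge0 ?(ltW B0)//.
    apply: (@le_trans _ _ Q); first by rewrite /Q; lra.
    by rewrite ler_peMr// (le_trans ler01).
  rewrite subr_le0; have d01 : 0 <= d <= 1 by rewrite ltW.
  apply: le_trans (HM d d01) _.
  have dC : Num.max M 1 <= C2 * d^-1.
    by rewrite ler_pdivlMr// mulrC -ler_pdivlMr// ge_min lexx orbT.
  apply: le_trans (_ : Num.max M 1 <= _); first by rewrite le_max lexx.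
  apply: le_trans dC _; rewrite -mulrA ler_wpM2l ?(ltW C20)//.
  have id1 : 1 <= d^-1 by rewrite invf_ge1.
  have n0 : (0 < n)%N by rewrite /n; case: (m) m0.
  apply: (@le_trans _ _ (d^-1 ^+ n)); first by rewrite -[leLHS]expr1 ler_weXn2l.
  by rewrite ler_peMl ?exprn_ge0 ?(le_trans ler01)// exprn_ege1.
have sc0 : 0 <= scale alpha nu t by apply: le_trans (scale_ge_wave _ _ _); exact: ltW.
have C0 : 0 <= C2 * B ^+ n by rewrite mulr_ge0 ?exprn_ge0 ?(ltW B0)// ltW.
have [tK|/ltW Kt] := leP t (wave alpha nu)^-1.
  apply: le_trans (early t t0 tK) _; rewrite ler_wpM2l// lerXn2r ?nnegrE ?invr_ge0 ?(ltW t0)//.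
  by rewrite le_max lexx.
apply: (@le_trans _ _ (C2 * B ^+ n * wave alpha nu ^+ n)); last first.
  by rewrite ler_wpM2l// lerXn2r ?nnegrE ?(ltW K0)//; exact: scale_ge_wave.
have iK0 : 0 < (wave alpha nu)^-1 by rewrite invr_gt0.
(* From time 1 / K on the barrier is constant, with kappa = K, and starts from the value reached by
   [early]. *)
rewrite -subr_le0; pose phi u := energy g m u - C2 * B ^+ n * wave alpha nu ^+ n.
pose dy u := - 2 * cint (fun x => g 0%N m u x * comp_jet F (fun j => g 0%N j u) m.+1 0 x)
   - 2 * nu * cint (fun x => g 0%N m u x * mult (flap_symbol alpha) (g 0%N m u) x).
apply: (@barrier_le _ phi (fun u => dy u - 0) _ t Kt).
- have c1 : {within `[(wave alpha nu)^-1, t], continuous (energy g m)}.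
    apply: (continuous_subspaceW _ (energy_continuous S (j := m) (T := t))) => u /=.
    by rewrite !in_itv/= => /andP[du ->]; rewrite (le_trans (ltW iK0)).
  have c2 : {within `[(wave alpha nu)^-1, t], continuous (fun _ : R => C2 * B ^+ n * wave alpha nu ^+ n)}.
    by apply: continuous_subspaceT => u; exact: cvg_cst.
  by move=> u; apply: cvgB; [exact: c1|exact: c2].
- move=> u /andP[du us]; have u0 : 0 < u := lt_trans iK0 du.
  exact: is_derive1B (energy_dissipation S m u0) (is_derive_cst _ u (1 : R)).
- move=> u /andP[du us]; rewrite subr_gt0 => yu; have u0 : 0 < u := lt_trans iK0 du.
  have yB : C2 * (B * wave alpha nu) ^+ n < energy g m u by rewrite exprMn mulrA.
  rewrite subr0; apply: le_trans (HC sigma nu g B _ u S u0 B1 BC (lexx _) yB) _.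
  by rewrite oppr_le0 mulr_ge0 ?powR_ge0// exprn_ge0// mulr_ge0 ?(ltW B0) ?(ltW K0).
by rewrite subr_le0; have := early _ iK0 (lexx _); rewrite invrK.
Qed.

End EnergyDecay.

(** * Upper bounds for the norms *)

Section Regularity.
Context {R : realType}.
Implicit Types (alpha sigma D nu : R) (F : nat -> R -> R) (g : nat -> nat -> R -> R -> R).

Lemma spectral_decay alpha D F m : 1 < alpha < 2 -> 0 <= D -> jet F -> (0 < m)%N ->
  exists2 Z, 0 < Z & forall sigma nu g (t : R), burgers alpha sigma D nu F g -> 0 < t ->
    forall M, \sum_(i < M) i.+1%:R `^ (2 * m%:R) * fmod (g 0%N 0%N t) i.+1 ^+ 2 <=
      Z * scale alpha nu t `^ (2 * m%:R - 1).
Proof.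
move=> a12 D0 jF m0; have [C C0 HC] := energy_decay a12 D0 jF m0.
have a1 : 1 < alpha by case/andP: a12.
exists C => // sigma nu g t S t0 M; have pG := sol_pjet S (ltW t0).
have sc1 := scale_ge1 t a1 (b_nu S).
have -> : 2 * m%:R - 1 = m.*2.-1%:R :> R.
  by rewrite -natrM mul2n -subn1 natrB// double_gt0.
rewrite powR_mulrn ?(le_trans ler01)//; apply: le_trans (HC _ _ _ _ S t0).
have := fourier_energy (a := m) pG (sol_fcos0 S (ltW t0)) => cv.
set s := fun i => i.+1%:R `^ (2 * m%:R) * fmod (g 0%N 0%N t) i.+1 ^+ 2.
have s0 i : 0 <= s i by rewrite mulr_ge0 ?powR_ge0 ?sqr_ge0.
have q1 : 1 <= (2 * pi) ^+ m.*2 :> R.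
  by rewrite exprn_ege1//; have := pi_ge2 R; lra.
have q0 : 0 <= 2 * (2 * pi) ^+ m.*2 :> R by lra.
apply: le_trans (partial_sum_le M q0 s0 cv).
rewrite [leLHS](_ : _ = \sum_(i < M) s i)//.
by rewrite ler_peMl ?sumr_ge0//; lra.
Qed.

Lemma sup_decay alpha D F a : 1 < alpha < 2 -> 0 < D -> jet F ->
  exists2 C, 0 < C & forall sigma nu g (t x : R), burgers alpha sigma D nu F g -> 0 < t ->
    `|g 0%N a t x| <= C * scale alpha nu t ^+ a.
Proof.
move=> a12 D0 jF; have a1 : 1 < alpha by case/andP: a12.
case: a => [|a].
  by exists D => // sigma nu g t x S t0; rewrite mulr1; apply: (sol_le S x (ltW t0)).
have [Z Z0 HZ] := spectral_decay a12 (ltW D0) jF (ltn0Sn a.+1).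
have A0 : 0 <= 4 * D by rewrite mulr_ge0// ltW.
have ar : a.+1%:R < a.+2%:R - 2^-1 :> R by rewrite -[a.+2%:R]natr1; lra.
have [C C0 HC] := spectral_sup A0 (ltW Z0) (ltn0Sn a) ar.
exists C => // sigma nu g t x S t0; have t1 := ltW t0.
have sc1 := scale_ge1 t a1 (b_nu S).
exact: (HC (fun j => g 0%N j t) _ (sol_pjet S t1) (sol_fcos0 S t1)
  (fun i => sol_fmod S i t1) sc1 (HZ _ _ _ _ S t0)).
Qed.

Lemma sobolev_spectral_decay alpha D F s : 1 < alpha < 2 -> 0 < D -> jet F -> 2^-1 < s ->
  exists2 C, 0 < C & forall sigma nu g (t : R), burgers alpha sigma D nu F g -> 0 < t ->
    (sobolevH s (g 0%N 0%N t) <= (C * scale alpha nu t `^ (s - 2^-1))%:E)%E.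
Proof.
move=> a12 D0 jF s2; have a1 : 1 < alpha by case/andP: a12.
have s0 : 0 < s by apply: lt_trans s2.
pose m := (Num.truncn s).+1.
have sm : s <= m%:R by apply: ltW; have /andP[] := truncn_itv (ltW s0).
have [Z Z0 HZ] := spectral_decay a12 (ltW D0) jF (ltn0Sn _ : (0 < m)%N).
have A0 : 0 <= 4 * D by rewrite mulr_ge0// ltW.
have [C C0 HC] := interp_sqr s2 sm A0 (ltW Z0).
exists ((2 * pi) `^ s * (2 * C) `^ 2^-1) => [|sigma nu g t S t0].
  by rewrite mulr_gt0// powR_gt0 ?mulr_gt0 ?pi_gt0.
have t1 := ltW t0; have sc1 := scale_ge1 t a1 (b_nu S).
have sc0 : 0 < scale alpha nu t by apply: lt_le_trans sc1.
have E : (2 * pi) `^ s * (2 * C * scale alpha nu t `^ (2 * s - 1)) `^ 2^-1 =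
    (2 * pi) `^ s * (2 * C) `^ 2^-1 * scale alpha nu t `^ (s - 2^-1).
  rewrite [in X in _ * X]powRM ?powR_ge0 ?mulr_ge0 ?(ltW C0)// mulrA -powRrM; congr (_ * _ `^ _).
  by lra.
rewrite -E; apply: sobolevH_le => //; first exact: jet_continuous (sol_jet S 0 t1).
move=> n; rewrite -mulrA ler_wpM2l//.
exact: (HC (fun i => fmod (g 0%N 0%N t) i.+1) _ (fun i => sol_fmod S i t1) sc1 (HZ _ _ _ _ S t0)).
Qed.

End Regularity.

(** * L_p norms of continuous periodic functions *)

Section LpNorms.
Context {R : realType}.
Implicit Types (v w : R -> R) (p c l : R).

Lemma continuous_powR_norm v p : 0 < p -> continuous v -> continuous (fun x => `|v x| `^ p).
Proof.
move=> p0 cv x; rewrite /continuous_at; have [v0|v0] := eqVneq (v x) 0.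
  rewrite v0 normr0 powR0 ?gt_eqF//; apply/cvgrPdist_le => e e0.
  have e1 : 0 < e `^ p^-1 by rewrite powR_gt0.
  have := cv x; rewrite /continuous_at v0 => /cvgrPdist_le/(_ _ e1); apply: filterS => y.
  rewrite !sub0r !normrN (ger0_norm (powR_ge0 _ _)) => h.
  have := powR_monol (ltW p0) (normr_ge0 (v y)) h.
  by rewrite -powRrM mulVf ?gt_eqF// powRr1// ltW.
have n0 : 0 < `|v x| by rewrite normr_gt0.
have c1 : {for `|v x|, continuous (fun y : R => y `^ p)}.
  apply: differentiable_continuous; apply/derivable1_diffP.
  exact: (@ex_derive _ _ _ _ _ _ _ (is_derive1_powR p n0)).
by apply: (cvg_comp _ _ (continuous_norm cv x) c1).
Qed.

Lemma Lnorm_fin v p : 0 < p -> continuous v ->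
  ('N[circle_measure R]_(p%:E)[EFin \o v] = (cint (fun x => `|v x| `^ p) `^ p^-1)%:E)%E.
Proof.
move=> p0 cv; rewrite unlock -poweR_EFin EFin_cint; last exact: continuous_powR_norm.
by congr (_ `^ _)%E; apply: eq_integral => x _.
Qed.

Lemma Lnorm_fin_le v w p : 0 < p -> continuous v -> continuous w ->
  (forall x, `|v x| `^ p <= w x) ->
  ('N[circle_measure R]_(p%:E)[EFin \o v] <= (cint w `^ p^-1)%:E)%E.
Proof.
move=> p0 cv cw vw; have cp := continuous_powR_norm p0 cv.
rewrite Lnorm_fin// lee_fin; apply: powR_monol; first by rewrite invr_ge0 ltW.
  by apply: cint_ge0 => x; exact: powR_ge0.
exact: le_cint.
Qed.

Lemma Lnorm_le_sup v (p : \bar R) c : (1 <= p)%E -> continuous v -> (forall x, `|v x| <= c) ->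
  ('N[circle_measure R]_p[EFin \o v] <= c%:E)%E.
Proof.
move=> p1 cv vc; have c0 : 0 <= c by apply: le_trans (vc 0).
case: p p1 => [p p1| _|//]; last first.
  rewrite unlock circle_measureT lte01; apply/ess_supP; apply: nearW => x /=.
  by rewrite lee_fin.
have p0 : 0 < p by rewrite lee_fin in p1; apply: lt_le_trans p1.
apply: (@le_trans _ _ (cint (fun=> c `^ p) `^ p^-1)%:E).
  apply: Lnorm_fin_le => //; first exact: continuous_cst.
  by move=> x; apply: powR_monol => //; exact: ltW.
by rewrite cint_cst -powRrM mulfV ?gt_eqF// powRr1.
Qed.

Lemma unit_subinterval (a l : R) : 0 < l <= 1 -> exists k : int, exists b,
  [/\ 0 <= b, b + l / 2 < 1 \/ b = 0 & a <= b + k%:~R /\ b + k%:~R + l / 2 <= a + l].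
Proof.
case/andP=> l0 l1; have /andP[n1 n2] := floor_itv a; rewrite intrD1 in n2.
have [h|h] := ltP (a + l / 2) ((Num.floor a)%:~R + 1).
  exists (Num.floor a), (a - (Num.floor a)%:~R); split; [lra|left; lra|split; lra].
exists (Num.floor a + 1), 0; rewrite intrD1; split; [lra|by right|split; lra].
Qed.

(* An interval of length [l] may straddle an integer, but then one of its halves does not. *)
Lemma Lnorm_ge v (p : \bar R) a c l : (1 <= p)%E -> continuous v -> periodic v 1 -> 0 < l <= 1 ->
  0 <= c -> (forall x, a <= x <= a + l -> c <= `|v x|) ->
  (((l / 2) `^ fine p^-1 * c)%:E <= 'N[circle_measure R]_p[EFin \o v])%E.
Proof.
move=> p1 cv pv l01 c0 vc; have /andP[l0 l1] := l01.
have l20 : 0 < l / 2 by rewrite divr_gt0.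
have [k [b [b0 b1 [ab bl]]]] := unit_subinterval a l01.
have bl1 : b + l / 2 < 1 by case: b1 => // ->; lra.
have vcb x : b <= x <= b + l / 2 -> c <= `|v x|.
  by case/andP=> bx xb; rewrite -(int_shift k x pv); apply: vc; apply/andP; split; lra.
case: p p1 => [p p1| _|//]; last first.
  (* For infinite p the exponent 1/p is 0; an essential supremum below [c] would make an interval of
     length l / 2 negligible. *)
  rewrite powRr0 mul1r unlock circle_measureT lte01 leNgt; apply/negP => sc.
  have /ess_supP h := lexx (ess_sup (circle_measure R) (abse \o (EFin \o v))).
  have [N [mN N0 HN]] := h.
  have sub : `[b, b + l / 2] `<=` N.
    move=> x /=; rewrite in_itv/= => xb; apply: HN => /= H.
    have := lt_le_trans (le_lt_trans H sc) (vcb x xb : (c%:E <= `|v x|%:E)%E).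
    by rewrite ltxx.
  have : (circle_measure R `[b, (b + l / 2)%R]%classic <= circle_measure R N)%E.
    by apply: le_measure; rewrite ?inE.
  rewrite N0 circle_measureE; last first.
    by move=> x /=; rewrite !in_itv/= => /andP[bx xb]; rewrite (le_trans b0)//= (le_lt_trans xb).
  rewrite lebesgue_measure_itv/= lte_fin ltrDl l20 -EFinD lee_fin.
  by rewrite addrAC subrr add0r leNgt l20.
have p0 : 0 < p by rewrite lee_fin in p1; apply: lt_le_trans p1.
rewrite Lnorm_fin// lee_fin inver gt_eqF//=.
have cp := continuous_powR_norm p0 cv.
apply: (@le_trans _ _ ((l / 2 * c `^ p) `^ p^-1)).
  by rewrite [leRHS]powRM ?powR_ge0 ?(ltW l20)// -powRrM mulfV ?gt_eqF// powRr1.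
apply: powR_monol; first by rewrite invr_ge0 ltW.
  by rewrite mulr_ge0 ?powR_ge0// ltW.
have := @cint_ge_itv _ (fun x => `|v x| `^ p) b (b + l / 2) (c `^ p).
rewrite addrAC subrr add0r; apply => //.
- by rewrite lerDl ltW.
- exact: powR_ge0.
- by move=> x xb; apply: powR_monol => //; [exact: ltW|exact: vcb].
Qed.

End LpNorms.

(** * The oscillation deficit and the sharp L_p bounds *)

Section UpperLp.
Context {R : realType}.
Implicit Types (alpha sigma D nu : R) (F G : nat -> R -> R) (g : nat -> nat -> R -> R -> R).

(** The derivative with respect to the shift is the integral of a derivative over a period, hence
    zero. *)
Lemma cint_shift G (h : R) : pjet G -> cint (fun x => G 0%N (x + h)) = cint (G 0%N).
Proof.
move=> pG; have jG := pG.1.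
have cs j (s : R) : continuous (fun x => G j (x + s)).
  have d (x : R) := is_derive1_shift (jG j (x + s)).
  exact: (is_derive_continuous d).
pose phi s := cint (fun x => G 0%N (x + s)).
have [M HM] := periodic_bounded (jet_continuous 2 jG) (pjet_periodic 2 pG).
have lip := derive_lip (jG 1%N) HM.
have M0 : 0 <= M by apply: le_trans (HM 0).
have dphi s : is_derive s (1 : R) phi 0.
  apply: (@is_derive1_quad _ _ _ _ M 1) => // r _; rewrite mul0r subr0.
  have z : cint (fun x => G 1%N (x + s)) = 0.
    rewrite (cint_FTC (fun x => is_derive1_shift (jG 0%N (x + s))) (cs 1%N s)).
    by rewrite [1 + s]addrC (pjet_periodic 0 pG) add0r subrr.
  have -> : phi r - phi s = cint (fun x => G 0%N (x + r) - G 0%N (x + s) - (r - s) * G 1%N (x + s)).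
    rewrite cintB; [|by apply: continuous_sub|by apply: continuous_scale].
    by rewrite cintB// cintZ// z mulr0 subr0.
  apply: norm_cint_le.
    by apply: continuous_sub; [exact: continuous_sub|exact: continuous_scale].
  move=> x; have := @taylor1_le _ (fun q => G 0%N (x + q)) (fun q => G 1%N (x + q)) M s r M0.
  apply => q _; last by have := lip (x + q) (x + s); rewrite opprD addrACA subrr add0r.
  by under eq_fun do rewrite addrC; apply: is_derive1_shift; rewrite [q + x]addrC.
have lip0 := derive_lip dphi (M := 0); rewrite normr0 in lip0.
have := lip0 (fun _ => lexx 0) h 0; rewrite mul0r normr_le0 subr_eq0 => /eqP.
by rewrite /phi => ->; apply: eq_cint => x; rewrite addr0.
Qed.

(* How far [u] falls short of its maximal growth [2 D h] over a step [h], normalised to lie in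
   [(0, 1]]: it controls the oscillation of [u] on [[x, x + h]], and its mean is [h / 2]. *)
Definition deficit D (u : R -> R) (h x : R) : R := (2 * D * h - (u (x + h) - u x)) / (4 * D).

(** Landau's inequality is applied on a length l shorter than 1 / kappa, on which the oscillation of
    u and l^n |u^(n)| are both O(a). This bounds |u^(m)| by C a l^(- m). *)
Lemma deficit_interp alpha D F m n : 1 < alpha < 2 -> 0 < D -> jet F -> (m <= n)%N -> (0 < m)%N ->
  exists2 C, 0 < C & forall sigma nu g (t x : R), burgers alpha sigma D nu F g -> 0 < t ->
  let a := deficit D (g 0%N 0%N t) (scale alpha nu t)^-1 x in
  0 < a <= 1 /\ `|g 0%N m t x| <= C * scale alpha nu t ^+ m * a `^ (1 - m%:R / n%:R).
Proof.
move=> a12 D0 jF mn m0; have a1 : 1 < alpha by case/andP: a12.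
have [Cn Cn0 HCn] := sup_decay n a12 D0 jF.
have [L L0 HL] := @landau R n m mn.
exists (L * (4 * D + Cn) + 1) => [|sigma nu g t x S t0 a].
  by rewrite ltr_wpDl// mulr_ge0// addr_ge0 ?mulr_ge0 ?(ltW D0)// ltW.
have t1 := ltW t0; have sc1 := scale_ge1 t a1 (b_nu S).
have K0 : 0 < scale alpha nu t by apply: lt_le_trans sc1.
pose u := g 0%N 0%N t; pose h := (scale alpha nu t)^-1.
have h0 : 0 < h by rewrite invr_gt0.
have h1 : h <= 1 by rewrite invf_le1.
have du z : is_derive z (1 : R) u (g 0%N 1%N t z) := b_dx S 0 0 t z t1.
have lipu y z : y <= z -> u z - u y <= D * (z - y).
  exact: (one_sided_lip du (fun w => sol_grad_le S w t1)).
have osc y z : u z - u y <= D.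
  exact: (one_sided_osc y z (ltW D0) (b_periodic S t1) du (fun w => sol_grad_le S w t1)).
have aE : 4 * D * a = 2 * D * h - (u (x + h) - u x).
  by rewrite /a /deficit -/u -/h mulrC divfK// mulf_neq0// gt_eqF.
have Dh0 : 0 < D * h by rewrite mulr_gt0.
have Dh1 : D * h <= D by rewrite ler_piMr// ltW.
have xh : x <= x + h by rewrite lerDl ltW.
have a_gt0 : 0 < a.
  have := lipu x (x + h) xh; rewrite addrAC subrr add0r => l1.
  have : 0 < 4 * D * a by rewrite aE; lra.
  by rewrite pmulr_rgt0// mulr_gt0.
have a_le1 : a <= 1.
  have : 4 * D * a <= 4 * D * 1 by rewrite aE mulr1; have := osc (x + h) x; lra.
  by rewrite ler_pM2l// mulr_gt0.
split; first by rewrite a_gt0.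
(* Subtracting the value at [x] leaves the derivatives unchanged and turns the bound of order 0 into
   one on the oscillation. *)
pose G j y := if j is 0%N then u y - u x else g 0%N j t y.
have jG : jet G.
  move=> [|j] y; last exact: b_dx S _ _ _ _ t1.
  by have := is_derive1B (du y) (is_derive_cst (u x) y (1 : R)); rewrite subr0.
have n0 : (0 < n)%N by apply: leq_trans mn.
have n0' : 0 < n%:R :> R by rewrite ltr0n.
(* Chosen so that l^n = h^n a, which balances the two bounds. *)
pose l := h * a `^ n%:R^-1.
have p0 : 0 < a `^ n%:R^-1 by exact: powR_gt0.
have p1 : a `^ n%:R^-1 <= 1 by apply: powR_le1; rewrite ?invr_ge0 ?(ltW a_gt0) ?(ltW n0').
have l0 : 0 < l by rewrite mulr_gt0.
have lh : l <= h by rewrite /l ler_piMr// ltW.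
have b0 : jet_bound G x l 0 (4 * D * a).
  move=> y /andP[xy yl]; rewrite expr0 mul1r /G ler_norml aE.
  have yh : y <= x + h by apply: le_trans yl _; rewrite lerD2l.
  have e1 := lipu x y xy; have e2 := lipu y (x + h) yh.
  have e3 : D * (y - x) <= D * h by rewrite ler_wpM2l ?(ltW D0)//; lra.
  have e4 : D * (x + h - y) <= D * h by rewrite ler_wpM2l ?(ltW D0)//; lra.
  have e5 := lipu x (x + h) xh; rewrite addrAC subrr add0r in e5.
  by apply/andP; split; lra.
have GE j y : (0 < j)%N -> G j y = g 0%N j t y by case: j.
have lX j : l ^+ j = h ^+ j * a `^ (n%:R^-1 * j%:R).
  by rewrite exprMn; congr (_ * _); rewrite -powR_mulrn ?(ltW p0)// -powRrM.
have bn : jet_bound G x l n (Cn * a).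
  move=> y _; rewrite GE// lX mulVf ?gt_eqF// powRr1 ?(ltW a_gt0)//.
  rewrite mulrAC ler_wpM2r ?(ltW a_gt0)// /h exprVn ler_pdivrMl ?exprn_gt0// mulrC.
  exact: HCn S t0.
have xx : x <= x <= x + l by rewrite lexx lerDl ltW.
have := HL G x l _ _ jG l0 b0 bn x xx; rewrite GE// lX /h exprVn.
have ap : 0 < a `^ (n%:R^-1 * m%:R) by rewrite powR_gt0.
rewrite -[X in X <= _ -> _]mulrA ler_pdivrMl ?exprn_gt0// mulrC -ler_pdivlMr// => H.
apply: le_trans H _; rewrite -mulrA [n%:R^-1 * _]mulrC.
rewrite (_ : a `^ (1 - m%:R / n%:R) = a / a `^ (m%:R / n%:R)); last first.
  by rewrite powR_add// powRr1 ?(ltW a_gt0)// powRN.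
have i0 : 0 <= (a `^ (m%:R / n%:R))^-1 by rewrite invr_ge0 powR_ge0.
move: (_^-1) i0 => i i0.
have q0 : 0 <= scale alpha nu t ^+ m * (a * i).
  by rewrite mulr_ge0 ?exprn_ge0 ?(ltW K0)// mulr_ge0// ltW.
have -> : scale alpha nu t ^+ m * (L * (4 * D * a + Cn * a) * i) =
  L * (4 * D + Cn) * (scale alpha nu t ^+ m * (a * i)) by ring.
by rewrite -[leRHS]mulrA ler_wpM2r// lerDl.
Qed.

End UpperLp.

Section SobolevUpper.
Context {R : realType}.
Implicit Types (alpha sigma D nu r : R) (p : \bar R) (F G : nat -> R -> R) (g : nat -> nat -> R -> R -> R).

Lemma gamma_exp_fin m r : 1 <= r -> (0 < m)%N -> gamma_exp m r%:E = m%:R - r^-1.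
Proof.
move=> r1 m0; have r0 : 0 < r by apply: lt_le_trans r1.
rewrite /gamma_exp inver gt_eqF//=; apply/max_idPr.
by rewrite subr_ge0 (le_trans (_ : r^-1 <= 1)) ?ler1n// invf_le1.
Qed.

Lemma gamma_exp0 p : (1 <= p)%E -> gamma_exp 0 p = 0 :> R.
Proof.
move=> p1; apply/max_idPl; rewrite sub0r oppr_le0 fine_ge0// inve_ge0.
exact: le_trans p1.
Qed.

Lemma gamma_expy m : gamma_exp m +oo%E = m%:R :> R.
Proof. by rewrite /gamma_exp invey subr0; apply/max_idPr. Qed.

(** Interpolates between the sup bound on u_x and its L_1 bound 2 D, which does not grow with
    kappa. *)
Lemma Lnorm_upper1 alpha D F r : 1 < alpha < 2 -> 0 < D -> jet F -> 1 <= r ->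
  exists2 C, 0 < C & forall sigma nu g (t : R), burgers alpha sigma D nu F g -> 0 < t ->
    ('N[circle_measure R]_(r%:E)[EFin \o g 0%N 1%N t] <= (C * scale alpha nu t `^ (1 - r^-1))%:E)%E.
Proof.
move=> a12 D0 jF r1; have a1 : 1 < alpha by case/andP: a12.
have r0 : 0 < r by apply: lt_le_trans r1.
have [C C0 HC] := sup_decay 1 a12 D0 jF.
exists ((C `^ (r - 1) * (2 * D)) `^ r^-1) => [|sigma nu g t S t0].
  by rewrite powR_gt0 ?mulr_gt0// powR_gt0.
have t1 := ltW t0; have sc1 := scale_ge1 t a1 (b_nu S).
have K0 : 0 < scale alpha nu t by apply: lt_le_trans sc1.
have cu : continuous (g 0%N 1%N t) by exact: jet_continuous (sol_jet S 0 t1).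
pose M := (C * scale alpha nu t) `^ (r - 1).
have M0 : 0 <= M by exact: powR_ge0.
have cw : continuous (fun x => M * `|g 0%N 1%N t x|).
  by apply: continuous_scale; exact: continuous_norm.
have H x : `|g 0%N 1%N t x| `^ r <= M * `|g 0%N 1%N t x|.
  have [->|u0] := eqVneq (g 0%N 1%N t x) 0; first by rewrite normr0 powR0 ?mulr0// gt_eqF.
  have n0 : 0 < `|g 0%N 1%N t x| by rewrite normr_gt0.
  rewrite -[X in X `^ _ <= _]mulr1 -[X in _ `^ X](subrK 1) mulr1 powR_add// powRr1 ?(ltW n0)//.
  rewrite ler_wpM2r// powR_monol ?subr_ge0//.
  by have := HC sigma nu g t x S t0; rewrite expr1.
apply: le_trans (Lnorm_fin_le r0 cu cw H) _; rewrite lee_fin.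
have c1 : continuous (fun x => `|g 0%N 1%N t x|) by exact: continuous_norm.
rewrite cintZ//.
apply: (@le_trans _ _ ((M * (2 * D)) `^ r^-1)).
  apply: powR_monol; first by rewrite invr_ge0 ltW.
    by rewrite mulr_ge0// cint_ge0.
  by rewrite ler_wpM2l//; exact: (sol_grad_abs S t1).
rewrite /M [X in (X * _) `^ _]powRM ?(ltW C0) ?(ltW K0)// mulrAC.
by rewrite [leLHS]powRM ?mulr_ge0 ?powR_ge0 ?(ltW D0)// -powRrM mulrBl mul1r mulfV ?gt_eqF.
Qed.

Lemma Lnorm_upper2 alpha D F m r : 1 < alpha < 2 -> 0 < D -> jet F -> 1 < r -> (0 < m)%N ->
  exists2 C, 0 < C & forall sigma nu g (t : R), burgers alpha sigma D nu F g -> 0 < t ->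
    ('N[circle_measure R]_(r%:E)[EFin \o g 0%N m t] <=
      (C * scale alpha nu t `^ (m%:R - r^-1))%:E)%E.
Proof.
move=> a12 D0 jF r1 m0; have a1 : 1 < alpha by case/andP: a12.
have r0 : 0 < r by apply: lt_trans r1.
have rm0 : 0 < r - 1 by rewrite subr_gt0.
(* Large enough for r (1 - m/n) >= 1. As the deficit is at most 1, its power is then bounded by the
   deficit itself, whose mean is 1 / (2 kappa). *)
pose n := (m + (Num.truncn (m%:R * r / (r - 1))).+1)%N.
have mn : (m <= n)%N by rewrite leq_addr.
have n0 : 0 < n%:R :> R by rewrite ltr0n /n addnS.
have nE : 1 <= r * (1 - m%:R / n%:R).
  have h : m%:R * r <= n%:R * (r - 1).
    rewrite -ler_pdivrMr//; apply: (@le_trans _ _ (Num.truncn (m%:R * r / (r - 1))).+1%:R).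
      have q0 : 0 <= m%:R * r / (r - 1) by rewrite divr_ge0 ?mulr_ge0 ?(ltW r0)// ltW.
      by have /andP[_] := truncn_itv q0; exact: ltW.
    by rewrite ler_nat leq_addl.
  rewrite -[leLHS](divff (lt0r_neq0 n0)) -[X in _ <= _ * (X - _)](divff (lt0r_neq0 n0)) -mulrBl mulrA.
  by rewrite ler_pM2r ?invr_gt0//; lra.
have [C C0 HC] := deficit_interp a12 D0 jF mn m0.
exists C => // sigma nu g t S t0.
have t1 := ltW t0; have sc1 := scale_ge1 t a1 (b_nu S).
have pG := sol_pjet S t1.
move: HC => /(_ sigma nu g t _ S t0) HC.
set K := scale alpha nu t in sc1 HC *.
have K0 : 0 < K by apply: lt_le_trans sc1.
have cj j : continuous (g 0%N j t) by exact: jet_continuous (sol_jet S 0 t1).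
have cs : continuous (fun x => g 0%N 0%N t (x + K^-1)).
  have d (x : R) := is_derive1_shift (b_dx S 0 0 t (x + K^-1) t1).
  exact: (is_derive_continuous d).
have cd : continuous (deficit D (g 0%N 0%N t) K^-1).
  rewrite /deficit; under eq_fun do rewrite mulrC; apply: continuous_scale.
  by apply: continuous_sub; [exact: continuous_cst|exact: continuous_sub].
have dE : cint (deficit D (g 0%N 0%N t) K^-1) = K^-1 / 2.
  rewrite (@eq_cint _ _ (fun x => (4 * D)^-1 * (2 * D * K^-1 - (g 0%N 0%N t (x + K^-1) - g 0%N 0%N t x))));
    last by move=> x; rewrite /deficit mulrC.
  rewrite cintZ; last by apply: continuous_sub; [exact: continuous_cst|exact: continuous_sub].
  rewrite cintB; [|exact: continuous_cst|exact: continuous_sub].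
  rewrite cint_cst cintB// (cint_shift K^-1 pG) subrr subr0.
  by field; rewrite !gt_eqF.
pose w x := (C * K ^+ m) `^ r * deficit D (g 0%N 0%N t) K^-1 x.
have cw : continuous w by exact: continuous_scale.
have CK0 : 0 <= C * K ^+ m by rewrite mulr_ge0 ?exprn_ge0 ?(ltW K0)// ltW.
have H x : `|g 0%N m t x| `^ r <= w x.
  have [/andP[a0 a_le1] h] := HC x.
  apply: le_trans (powR_monol (ltW r0) (normr_ge0 _) h) _.
  rewrite powRM ?powR_ge0// -powRrM ler_wpM2l ?powR_ge0//.
  rewrite mulrC; apply: le_trans (_ : _ `^ 1 <= _); last by rewrite powRr1// ltW.
  by apply: powR_exp_ge => //; rewrite a0.
apply: le_trans (Lnorm_fin_le r0 (cj m) cw H) _; rewrite lee_fin /w cintZ// dE.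
have Kr : (C * K ^+ m) `^ r * (K^-1 / 2) <= (C * K ^+ m) `^ r * K^-1.
  by rewrite ler_wpM2l ?powR_ge0// ler_piMr ?invr_ge0 ?(ltW K0)//; lra.
apply: le_trans (powR_monol _ _ Kr) _; first by rewrite invr_ge0 ltW.
  by rewrite mulr_ge0 ?powR_ge0// divr_ge0// invr_ge0 ltW.
rewrite powRM ?powR_ge0 ?invr_ge0 ?(ltW K0)// -powRrM mulfV ?gt_eqF// powRr1//.
rewrite powR_add// powR_mulrn ?(ltW K0)// powRN -mulrA ler_wpM2l ?(ltW C0)//.
by rewrite -powR_inv1 ?(ltW K0)// -powRrM mulN1r powRN.
Qed.

Lemma Lnorm_upper alpha D F m p : 1 < alpha < 2 -> 0 < D -> jet F -> upper_range m p ->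
  exists2 C, 0 < C & forall sigma nu g (t : R), burgers alpha sigma D nu F g -> 0 < t ->
    ('N[circle_measure R]_p[EFin \o g 0%N m t] <= (C * scale alpha nu t `^ gamma_exp m p)%:E)%E.
Proof.
move=> a12 D0 jF mp; have a1 : 1 < alpha by case/andP: a12.
have p1 : (1 <= p)%E by case: mp => -[_ //] /ltW.
have sup : p = +oo%E \/ m = 0%N -> exists2 C, 0 < C & forall sigma nu g (t : R),
    burgers alpha sigma D nu F g -> 0 < t ->
    ('N[circle_measure R]_p[EFin \o g 0%N m t] <= (C * scale alpha nu t `^ gamma_exp m p)%:E)%E.
  move=> pm; have gE : gamma_exp m p = m%:R.
    by case: pm => ->; [exact: gamma_expy|exact: gamma_exp0].
  have [C C0 HC] := sup_decay m a12 D0 jF; exists C => // sigma nu g t S t0.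
  apply: Lnorm_le_sup => //; first exact: jet_continuous (sol_jet S 0 (ltW t0)).
  move=> x; rewrite gE powR_mulrn; first exact: HC S t0.
  by apply: le_trans (scale_ge1 t a1 (b_nu S)).
case: p p1 mp sup => [r r1|_ _ sup|//]; last by apply: sup; left.
rewrite lee_fin in r1; case: m => [|[|m]] mp sup; first by apply: sup; right.
  by rewrite gamma_exp_fin//; exact: Lnorm_upper1.
rewrite gamma_exp_fin//; apply: Lnorm_upper2 => //.
by case: mp => -[]; rewrite ?lte_fin.
Qed.

End SobolevUpper.

(** * Dissipation and lower bounds *)

Section EnergyBalance.
Context {R : realType} {alpha sigma D nu : R} {F : nat -> R -> R}
  {g : nat -> nat -> R -> R -> R}.

Lemma primitive_on (f : R -> R) (b : R) : continuous f ->
  exists Phi, forall y, `|y| <= b -> is_derive y (1 : R) Phi (f y).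
Proof.
(* One unit of margin on each side makes every point of [-b, b] interior. *)
move=> cf; pose a : R := - b - 1; pose u : R := b + 1.
have [bn|b0] := ltP b 0.
  by exists f => y /(le_trans (normr_ge0 y)); rewrite leNgt bn.
have au : a < u by rewrite /a /u; lra.
have fi : lebesgue_measure.-integrable `[a, u] (EFin \o f).
  apply: continuous_compact_integrable; first exact: segment_compact.
  exact: continuous_subspaceT.
exists (fun x => \int[lebesgue_measure]_(t in [set` `[a, x]]) f t)%R => y.
rewrite ler_norml => /andP[y1 y2].
have yu : y < u by rewrite /u; lra.
have ay : a < y by rewrite /a; lra.
have [d1 d2] := @continuous_FTC1_closed R f a y u yu fi ay (cf y).
apply: DeriveDef; [exact: d1|by rewrite -derive1E d2].
Qed.

Hypothesis S : burgers alpha sigma D nu F g.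

Let D_gt0 : 0 < D. Proof. exact: lt_trans ltr01 (b_D S). Qed.

Definition dissipation (t : R) : R :=
  nu * cint (fun x => g 0%N 0%N t x * mult (flap_symbol alpha) (g 0%N 0%N t) x).

Lemma conservation (t : R) : 0 <= t ->
  cint (fun x => g 0%N 0%N t x * comp_jet F (fun j => g 0%N j t) 1 0 x) = 0.
Proof.
move=> t0; have jG := sol_jet S 0 t0; have pG := sol_pjet S t0.
have cG j : continuous (g 0%N j t) by exact: (jet_continuous j jG).
have cF k : continuous (fun x => F k (g 0%N 0%N t x)).
  by move=> x; apply: (cvg_comp _ _ (cG 0%N x)); exact: (jet_continuous k (b_F S)).
have cf : continuous (fun y : R => y * F 1%N y).
  have cid : continuous (fun y : R => y) by move=> y; exact: cvg_id.
  exact: (continuous_mul cid (jet_continuous 1 (b_F S))).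
have [Phi HPhi] := primitive_on D cf.
have dP x := is_derive1_chain (HPhi _ (sol_le S x t0)) (b_dx S 0 0 t x t0).
rewrite (@eq_cint _ _ (fun x => g 0%N 0%N t x * F 1%N (g 0%N 0%N t x) * g 0%N 1%N t x)); last first.
  by move=> x; rewrite (comp_jetS _ _ _ (b_F S) jG) big_ord0 addr0 mulrA.
rewrite (cint_FTC dP); last by apply: continuous_mul => //; exact: continuous_mul.
by rewrite -[X in g 0%N 0%N t X]add0r (pjet_periodic 0 pG) subrr.
Qed.

Lemma energy0_derive (t : R) : 0 < t -> is_derive t (1 : R) (energy g 0) (- (2 * dissipation t)).
Proof.
move=> t0; have d := energy_dissipation S 0 t0; apply: (is_derive_eq d).
by rewrite (conservation (ltW t0)) mulr0 sub0r /dissipation mulrA.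
Qed.

(** Comparing two expressions of the derivative of the energy removes the multiplier; continuity in
    time can then be read off the derivatives of u. *)
Lemma dissipationE (t : R) : 0 < t ->
  dissipation t = - cint (fun x => g 0%N 0%N t x * g 1%N 0%N t x).
Proof.
move=> t0; have := is_derive1_unique (energy_derive S 0 t0) (energy0_derive t0).
lra.
Qed.

Lemma dissipation_continuous a b : 0 < a -> {within `[a, b], continuous dissipation}.
Proof.
move=> a0; have [ab|ba] := leP a b; last first.
  rewrite set_itv_ge; first exact: continuous_subspace0.
  by rewrite bnd_simp -ltNge.
have b0 : 0 <= b by rewrite (le_trans (ltW a0)).
have [B0 B00 HB0] := sol_bounded S 0 0 b0.
have [B1 B10 HB1] := sol_bounded S 1 0 b0.
have [L0 L00 HL0] := sol_lip S 0 0 b0.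
have [L1 L10 HL1] := sol_lip S 1 0 b0.
have cj i r : 0 <= r -> continuous (g i 0%N r) by move=> r0; exact: jet_continuous (sol_jet S i r0).
have key s t : a <= s <= b -> a <= t <= b ->
    `|dissipation s - dissipation t| <= (B0 * L1 + B1 * L0) * `|s - t|.
  move=> /andP[s1 s2] /andP[t1 t2].
  have s0 := lt_le_trans a0 s1; have t0 := lt_le_trans a0 t1.
  have cs := cj ^~ s ^~ (ltW s0); have ct := cj ^~ t ^~ (ltW t0).
  rewrite !dissipationE// opprK addrC -cintB; [|by apply: continuous_mul..].
  apply: norm_cint_le; first by apply: continuous_sub; apply: continuous_mul.
  apply: periodic_le => x.
    by rewrite !(sol_periodic S 0 (leqnSn 0) (ltW s0), sol_periodic S 0 (leqnSn 0) (ltW t0),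
      sol_periodic S 0 (leqnn 1) (ltW s0), sol_periodic S 0 (leqnn 1) (ltW t0)).
  move=> x01.
  have -> : g 0%N 0%N t x * g 1%N 0%N t x - g 0%N 0%N s x * g 1%N 0%N s x =
    - (g 0%N 0%N t x * (g 1%N 0%N s x - g 1%N 0%N t x) +
       g 1%N 0%N s x * (g 0%N 0%N s x - g 0%N 0%N t x)) by ring.
  rewrite normrN; apply: le_trans (ler_normD _ _) _; rewrite [leRHS]mulrDl !normrM -!mulrA.
  by apply: lerD; apply: ler_pM => //; [apply: HB0|apply: HL1|apply: HB1|apply: HL0];
    rewrite ?(ltW s0) ?(ltW t0).
apply: (lipschitz_within _ key); by rewrite addr_ge0// mulr_ge0.
Qed.

Lemma dissipation_le Ct (t : R) : 0 <= t ->
  (sobolevH (alpha / 2) (g 0%N 0%N t) ^+ 2 <= (Ct * nu^-1)%:E)%E -> dissipation t <= Ct.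
Proof.
move=> t0 H; have n0 : 0 < nu by case/andP: (b_nu S).
have a0 : 0 < alpha by case/andP: (b_alpha S) => a1 _; exact: lt_trans a1.
have a20 : 0 < alpha / 2 by rewrite divr_gt0.
have p0 : 0 < 2 * pi :> R by rewrite mulr_gt0// pi_gt0.
rewrite /dissipation mulrC -ler_pdivlMr//; have cv := dissipation_cvg S (j := 0%N) t0.
apply: (@cvg_le_bound _ _ _ _ 0 cv) => n _.
set s := \sum_(i < n) i.+1%:R `^ (2 * (alpha / 2)) * fmod (g 0%N 0%N t) i.+1 ^+ 2.
have s0 : 0 <= s by apply: sumr_ge0 => i _; rewrite mulr_ge0 ?powR_ge0 ?sqr_ge0.
have -> : 2 * \sum_(i < n) flap_symbol alpha i.+1 * fmod (g 0%N 0%N t) i.+1 ^+ 2 =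
    ((2 * pi) `^ (alpha / 2) * (2 * s) `^ 2^-1) ^+ 2.
  rewrite exprMn -!powR_mulrn ?powR_ge0// -!powRrM mulVf// powRr1 ?mulr_ge0//.
  rewrite (_ : alpha / 2 * 2 = alpha); last by field.
  rewrite mulrCA; congr (2 * _); rewrite mulr_sumr; apply: eq_bigr => i _.
  rewrite /flap_symbol /omega powRM ?(ltW p0)// -mulrA (_ : 2 * (alpha / 2) = alpha)//.
  by field.
have cu : continuous (g 0%N 0%N t) by exact: jet_continuous (sol_jet S 0 t0).
have h := sobolevH_ge cu a20 (mulr_ge0 (ler0n R 2) s0) (lexx (2 * s)).
rewrite -lee_fin EFin_expe; apply: le_trans H.
rewrite !expe2 lee_pmul// lee_fin mulr_ge0 ?powR_ge0//.
Qed.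

End EnergyBalance.

Arguments dissipation {R} alpha nu g t.

(** * Spectral lower bounds at times of large dissipation *)

Section LowerBounds.
Context {R : realType}.
Implicit Types (alpha sigma D nu T c : R) (F G : nat -> R -> R) (g : nat -> nat -> R -> R -> R).

Lemma scale_le alpha nu T (t : R) : 1 < alpha -> 0 < nu <= 1 -> 0 < T -> T <= t ->
  scale alpha nu t <= Num.max T^-1 1 * wave alpha nu.
Proof.
move=> a1 n1 T0 Tt; have K1 := wave_ge1 a1 n1.
have t0 : 0 < t by apply: lt_le_trans Tt.
have M0 : 0 <= Num.max T^-1 1 by rewrite le_max ler01 orbT.
rewrite ge_max; apply/andP; split; last first.
  by rewrite ler_peMl ?(le_trans ler01)// le_max lexx orbT.
apply: (@le_trans _ _ T^-1); first by rewrite lef_pV2.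
by apply: (@le_trans _ _ (Num.max T^-1 1)); rewrite ?le_max ?lexx// ler_peMr.
Qed.

(* When the dissipation is bounded below, so is its part carried by the wave numbers comparable
   to [wave alpha nu]: the smaller ones are controlled by [fmod u k <= A / k], the larger ones by
   the bound on the second derivative. *)
Lemma band_lower alpha D F c T : 1 < alpha < 2 -> 0 < D -> jet F -> 0 < c -> 0 < T ->
  exists e M c' : R, [/\ 0 < e, 0 < M, 0 < c' & forall sigma nu g (t : R),
    burgers alpha sigma D nu F g -> T <= t -> c <= dissipation alpha nu g t ->
    exists n, c' * wave alpha nu `^ (alpha - 1) <=
      \sum_(i < n | (e * wave alpha nu < i.+1%:R) && (i.+1%:R <= M * wave alpha nu))
        i.+1%:R `^ alpha * fmod (g 0%N 0%N t) i.+1 ^+ 2].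
Proof.
move=> a12 D0 jF c0 T0; have /andP[a1 a2] := a12.
have [Z Z0 HZ] := spectral_decay a12 (ltW D0) jF (isT : (0 < 2)%N).
pose q := alpha - 1; have q0 : 0 < q by rewrite /q subr_gt0.
pose A := 4 * D; have A0 : 0 < A by rewrite mulr_gt0.
pose B := Num.max T^-1 1; have B0 : 0 < B by rewrite lt_max ltr01 orbT.
pose P := 2 * (2 * pi) `^ alpha : R.
have P0 : 0 < P by rewrite mulr_gt0// powR_gt0// mulr_gt0// pi_gt0.
(* Some partial sum reaches half of the dissipation, that is 4 d K^q after division by [P]. The
   numbers [e] and [M] solve cl e^q = d and ch M^(alpha - 4) = d, so low and high frequencies take
   at most d K^q each. *)
pose d := c / (8 * P); have d0 : 0 < d by rewrite divr_gt0// mulr_gt0.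
pose cl := A ^+ 2 * (1 + q^-1); have cl0 : 0 < cl.
  by rewrite mulr_gt0 ?exprn_gt0// ltr_wpDr// invr_ge0 ltW.
pose ch := Z * B `^ 3; have ch0 : 0 < ch by rewrite mulr_gt0// powR_gt0.
pose e := (d / cl) `^ q^-1; have e0 : 0 < e by rewrite powR_gt0// divr_gt0.
pose M := (d / ch) `^ (alpha - 4)^-1; have M0 : 0 < M by rewrite powR_gt0// divr_gt0.
exists e, M, d; split => // sigma nu g t S Tt ct.
have t0 : 0 < t := lt_le_trans T0 Tt; have t1 := ltW t0.
have n0 : 0 < nu by case/andP: (b_nu S).
set K := wave alpha nu; have K1 : 1 <= K := wave_ge1 a1 (b_nu S).
have K0 : 0 < K by apply: lt_le_trans K1.
have KD := wave_dissipation a1 n0; rewrite -/K -/q in KD *.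
have Kq0 : 0 < K `^ q by rewrite powR_gt0.
pose s i := i.+1%:R `^ alpha * fmod (g 0%N 0%N t) i.+1 ^+ 2.
have s0 i : 0 <= s i by rewrite mulr_ge0 ?powR_ge0 ?sqr_ge0.
have [n Hn] : exists n, c / 2 * K `^ q <= P * \sum_(i < n) s i.
  apply/not_existsP => H.
  have cv := dissipation_cvg S (j := 0%N) t1.
  have : cint (fun x => g 0%N 0%N t x * mult (flap_symbol alpha) (g 0%N 0%N t) x) <= c / 2 * K `^ q.
    apply: (@cvg_le_bound _ _ _ _ 0 cv) => n _.
    have /negP := H n; rewrite -ltNge => /ltW; apply: le_trans.
    rewrite /P -mulrA ler_wpM2l// mulr_sumr; apply: ler_sum => i _.
    rewrite /flap_symbol /omega powRM ?mulr_ge0 ?pi_ge0// -mulrA; exact: lexx.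
  rewrite -(ler_pM2l n0) mulrCA KD mulr1 => h.
  by move: ct; rewrite /dissipation leNgt => /negP; apply; apply: le_lt_trans h _; lra.
exists n; rewrite -/(s _).
have low : \sum_(i < n | i.+1%:R <= e * K) s i <= d * K `^ q.
  apply: (@le_trans _ _ (A ^+ 2 * \sum_(i < n | i.+1%:R <= e * K) i.+1%:R `^ (q - 1))).
    rewrite mulr_sumr; apply: ler_sum => i _.
    have i0 : 0 < i.+1%:R :> R by [].
    have := sol_fmod S i t1 => /andP[f0 f1].
    have f2 : fmod (g 0%N 0%N t) i.+1 ^+ 2 <= (A / i.+1%:R) ^+ 2.
      by rewrite lerXn2r ?nnegrE// divr_ge0// ltW.
    apply: le_trans (ler_wpM2l (powR_ge0 _ _) f2) _.
    rewrite exprMn mulrCA ler_wpM2l ?sqr_ge0//.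
    have -> : i.+1%:R^-1 ^+ 2 = i.+1%:R `^ (- 2%:R) :> R by rewrite exprVn powR_Nnat.
    rewrite -powR_add// /q (_ : alpha - 2%:R = alpha - 1 - 1)//; lra.
  apply: le_trans (ler_wpM2l (sqr_ge0 A) (sum_low _ q0 (mulr_gt0 e0 K0))) _.
  rewrite powRM ?(ltW e0) ?(ltW K0)// !mulrA ler_wpM2r ?(ltW Kq0)// -/cl.
  have -> : e `^ q = d / cl.
    by rewrite /e -powRrM mulVf ?gt_eqF// powRr1//; exact: divr_ge0 (ltW d0) (ltW cl0).
  by rewrite mulrC divfK ?gt_eqF.
have high : \sum_(i < n | M * K < i.+1%:R) s i <= d * K `^ q.
  have MK0 : 0 < M * K by rewrite mulr_gt0.
  apply: (@le_trans _ _ ((M * K) `^ (alpha - 4) * \sum_(i < n) i.+1%:R `^ (2 * 2%:R) * fmod (g 0%N 0%N t) i.+1 ^+ 2)).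
    rewrite mulr_sumr big_mkcond/=; apply: ler_sum => i _; case: ifP => [iM|_]; last first.
      by rewrite mulr_ge0 ?powR_ge0// mulr_ge0 ?powR_ge0 ?sqr_ge0.
    rewrite mulrA ler_wpM2r ?sqr_ge0//.
    have -> : i.+1%:R `^ alpha = i.+1%:R `^ (alpha - 4) * i.+1%:R `^ 4.
      by rewrite -powR_add// subrK.
    have -> : 2 * 2%:R = 4 :> R by ring.
    rewrite ler_wpM2r ?powR_ge0// powR_antil//; [lra|exact: ltW].
  have := HZ sigma nu g t S t0 n => h.
  apply: le_trans (ler_wpM2l (powR_ge0 _ _) h) _.
  have -> : 2 * 2%:R - 1 = 3 :> R by ring.
  have hs : scale alpha nu t `^ 3 <= B `^ 3 * K `^ 3.
    rewrite -powRM ?(ltW B0) ?(ltW K0)//; apply: powR_monol => //.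
      by apply: le_trans (scale_ge1 t a1 (b_nu S)).
    exact: scale_le (b_nu S) T0 Tt.
  apply: le_trans (ler_wpM2l (powR_ge0 _ _) (ler_wpM2l (ltW Z0) hs)) _.
  rewrite powRM ?(ltW M0) ?(ltW K0)// /M -powRrM mulVf; last by rewrite lt_eqF//; lra.
  rewrite powRr1; last exact: divr_ge0 (ltW d0) (ltW ch0).
  have -> : d / ch * K `^ (alpha - 4) * (Z * (B `^ 3 * K `^ 3)) =
    d / ch * ch * (K `^ (alpha - 4) * K `^ 3) by rewrite /ch; ring.
  rewrite divfK ?gt_eqF// -powR_add// (_ : alpha - 4 + 3 = q)//.
  by rewrite /q; lra.
have decomp : \sum_(i < n) s i <= \sum_(i < n | i.+1%:R <= e * K) s i +
   \sum_(i < n | M * K < i.+1%:R) s i +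
   \sum_(i < n | (e * K < i.+1%:R) && (i.+1%:R <= M * K)) s i.
  rewrite (bigID (fun i : 'I_n => i.+1%:R <= e * K))/= -addrA lerD2l.
  rewrite (bigID (fun i : 'I_n => M * K < i.+1%:R))/=; apply: lerD.
    rewrite big_mkcond [leRHS]big_mkcond/=; apply: ler_sum => i _.
    by case: (M * K < _); rewrite ?andbT ?andbF//; case: (~~ _).
  rewrite big_mkcond [leRHS]big_mkcond/=; apply: ler_sum => i _.
  by rewrite -!ltNge -leNgt.
have : c / 2 * K `^ q <= P * (2 * (d * K `^ q) +
    \sum_(i < n | (e * K < i.+1%:R) && (i.+1%:R <= M * K)) s i).
  apply: le_trans Hn _; rewrite ler_wpM2l ?(ltW P0)//; lra.
rewrite -ler_pdivrMl//; move: (\sum_(i < n | _) _) => b.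
have -> : P^-1 * (c / 2 * K `^ q) = 4 * (d * K `^ q) by rewrite /d; field; rewrite gt_eqF.
have : 0 <= d * K `^ q by rewrite mulr_ge0// ltW.
lra.
Qed.

(** On the band, k^(2 s - alpha) is comparable to K^(2 s - alpha). The exponent may have either
    sign, so both ends of the band are used. *)
Lemma spectral_lower alpha D F c T s : 1 < alpha < 2 -> 0 < D -> jet F -> 0 < c -> 0 < T ->
  exists2 c', 0 < c' & forall sigma nu g (t : R),
    burgers alpha sigma D nu F g -> T <= t -> c <= dissipation alpha nu g t ->
    exists n, c' * wave alpha nu `^ (2 * s - 1) <=
      \sum_(i < n) i.+1%:R `^ (2 * s) * fmod (g 0%N 0%N t) i.+1 ^+ 2.
Proof.
move=> a12 D0 jF c0 T0; have [e [M [c' [e0 M0 c'0 H]]]] := band_lower a12 D0 jF c0 T0.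
have /andP[a1 a2] := a12.
pose r := 2 * s - alpha; pose m := Num.min (e `^ r) (M `^ r).
have m0 : 0 < m by rewrite lt_min !powR_gt0.
exists (m * c') => [|sigma nu g t S Tt ct]; first exact: mulr_gt0.
have [n Hn] := H sigma nu g t S Tt ct; exists n.
set K := wave alpha nu in Hn *; have K0 : 0 < K by apply: lt_le_trans (wave_ge1 a1 (b_nu S)).
have Kr : 0 <= m * K `^ r by rewrite mulr_ge0 ?powR_ge0// ltW.
apply: (@le_trans _ _ (m * K `^ r * (c' * K `^ (alpha - 1)))).
  rewrite mulrACA -powR_add// (_ : r + (alpha - 1) = 2 * s - 1)//.
  by rewrite /r; lra.
apply: le_trans (ler_wpM2l Kr Hn) _; rewrite mulr_sumr big_mkcond/=; apply: ler_sum => i _.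
case: ifP => [/andP[i1 i2]|_]; last by rewrite mulr_ge0 ?powR_ge0 ?sqr_ge0.
have i0 : 0 < i.+1%:R :> R by [].
rewrite mulrA ler_wpM2r ?sqr_ge0//.
have -> : i.+1%:R `^ (2 * s) = i.+1%:R `^ r * i.+1%:R `^ alpha.
  by rewrite -powR_add// /r subrK.
rewrite ler_wpM2r ?powR_ge0//; have [r0|/ltW r0] := leP 0 r.
  apply: (@le_trans _ _ ((e * K) `^ r)).
    by rewrite powRM ?(ltW e0) ?(ltW K0)// ler_wpM2r ?powR_ge0// ge_min lexx.
  by apply: powR_monol => //; [rewrite mulr_ge0 ?(ltW e0) ?(ltW K0)|exact: ltW].
apply: (@le_trans _ _ ((M * K) `^ r)).
  by rewrite powRM ?(ltW M0) ?(ltW K0)// ler_wpM2r ?powR_ge0// ge_min lexx orbT.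
by apply: powR_antil.
Qed.

Lemma sobolev_lower alpha D F c T s : 1 < alpha < 2 -> 0 < D -> jet F -> 0 < c -> 0 < T -> 0 < s ->
  exists2 c', 0 < c' & forall sigma nu g (t : R),
    burgers alpha sigma D nu F g -> T <= t -> c <= dissipation alpha nu g t ->
    ((c' * wave alpha nu `^ (s - 2^-1))%:E <= sobolevH s (g 0%N 0%N t))%E.
Proof.
move=> a12 D0 jF c0 T0 s0; have [b b0 Hb] := spectral_lower s a12 D0 jF c0 T0.
exists ((2 * pi) `^ s * (2 * b) `^ 2^-1) => [|sigma nu g t S Tt ct].
  by rewrite mulr_gt0// powR_gt0 ?mulr_gt0 ?pi_gt0.
have [n Hn] := Hb sigma nu g t S Tt ct; have t1 : 0 <= t by rewrite (le_trans (ltW T0)).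
have cu : continuous (g 0%N 0%N t) by exact: jet_continuous (sol_jet S 0 t1).
have BE : (2 * (b * wave alpha nu `^ (2 * s - 1))) `^ 2^-1 =
    (2 * b) `^ 2^-1 * wave alpha nu `^ (s - 2^-1).
  have -> : s - 2^-1 = (2 * s - 1) * 2^-1 by lra.
  rewrite mulrA powRrM -powRM ?powR_ge0//.
  exact: mulr_ge0 (ler0n _ _) (ltW b0).
rewrite -mulrA -BE; move: (wave _ _ `^ _) (powR_ge0 (wave alpha nu) (2 * s - 1)) Hn => k k0 Hn.
have B0 : 0 <= 2 * (b * k) by exact: mulr_ge0 (ler0n _ _) (mulr_ge0 (ltW b0) k0).
exact: (sobolevH_ge cu s0 B0 (ler_wpM2l (ler0n _ 2) Hn)).
Qed.

(** If |u_x| were below d K everywhere, the L_1 bound would give a squared L_2 norm of u_x of at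
    most 2 D d K = b K / 2, against the spectral bound b K for s = 1. *)
Lemma gradient_lower alpha D F c T : 1 < alpha < 2 -> 0 < D -> jet F -> 0 < c -> 0 < T ->
  exists2 d, 0 < d & forall sigma nu g (t : R),
    burgers alpha sigma D nu F g -> T <= t -> c <= dissipation alpha nu g t ->
    exists x, d * wave alpha nu <= `|g 0%N 1%N t x|.
Proof.
move=> a12 D0 jF c0 T0; have [b b0 Hb] := spectral_lower 1 a12 D0 jF c0 T0.
have /andP[a1 a2] := a12.
exists (b / (4 * D)) => [|sigma nu g t S Tt ct]; first by rewrite divr_gt0// mulr_gt0.
have [n Hn] := Hb sigma nu g t S Tt ct; have t1 : 0 <= t by rewrite (le_trans (ltW T0)).
set K := wave alpha nu in Hn *; have K0 : 0 < K by apply: lt_le_trans (wave_ge1 a1 (b_nu S)).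
apply/not_existsP => H; pose d := b / (4 * D) * K.
have cu : continuous (g 0%N 1%N t) by exact: jet_continuous (sol_jet S 0 t1).
have up : cint (fun x => g 0%N 1%N t x ^+ 2) <= d * (2 * D).
  apply: (@le_trans _ _ (cint (fun x => d * `|g 0%N 1%N t x|))).
    apply: le_cint; [exact: continuous_exp|by apply: continuous_scale; exact: continuous_norm|].
    move=> x; rewrite -real_normK ?num_real// expr2 ler_wpM2r//.
    by apply: ltW; rewrite ltNge; apply/negP; exact: H.
  rewrite cintZ; last exact: continuous_norm.
  rewrite ler_wpM2l ?(sol_grad_abs S t1)// /d mulr_ge0 ?(ltW K0)// divr_ge0 ?mulr_ge0// ltW//.
have := fourier_energy (a := 1) (sol_pjet S t1) (sol_fcos0 S t1) => cv.
have : b * K <= cint (fun x => g 0%N 1%N t x ^+ 2).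
  set s := fun i => i.+1%:R `^ (2 * 1%:R) * fmod (g 0%N 0%N t) i.+1 ^+ 2.
  have s0 i : 0 <= s i by rewrite mulr_ge0 ?powR_ge0 ?sqr_ge0.
  have q1 : 1 <= (2 * pi) ^+ 1.*2 :> R.
    by rewrite exprn_ege1//; have := pi_ge2 R; lra.
  have q0 : 0 <= 2 * (2 * pi) ^+ 1.*2 :> R by lra.
  apply: le_trans (partial_sum_le n q0 s0 cv); apply: (@le_trans _ _ (\sum_(i < n) s i)).
    apply: le_trans Hn; rewrite (_ : 2 * 1 - 1 = 1) ?powRr1 ?(ltW K0)//; ring.
  by rewrite ler_peMl ?sumr_ge0//; lra.
have dE : d * (2 * D) = b * K / 2 by rewrite /d; field; rewrite gt_eqF.
rewrite dE in up.
have : 0 < b * K by rewrite mulr_gt0.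
lra.
Qed.

End LowerBounds.

(** * Lower bounds at points and on intervals *)

Section PointwiseLower.
Context {R : realType}.
Implicit Types (alpha sigma D nu T c : R) (F G : nat -> R -> R) (g : nat -> nat -> R -> R -> R).

Lemma sup_wave alpha D F a T : 1 < alpha < 2 -> 0 < D -> jet F -> 0 < T ->
  exists2 C, 0 < C & forall sigma nu g (t x : R), burgers alpha sigma D nu F g -> T <= t ->
    `|g 0%N a t x| <= C * wave alpha nu ^+ a.
Proof.
move=> a12 D0 jF T0; have [C C0 HC] := sup_decay a a12 D0 jF.
have a1 : 1 < alpha by case/andP: a12.
pose B := Num.max T^-1 1; have B0 : 0 < B by rewrite lt_max ltr01 orbT.
exists (C * B ^+ a) => [|sigma nu g t x S Tt]; first by rewrite mulr_gt0// exprn_gt0.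
have t0 := lt_le_trans T0 Tt.
apply: le_trans (HC sigma nu g t x S t0) _; rewrite -mulrA -exprMn ler_wpM2l ?(ltW C0)//.
have sB := scale_le a1 (b_nu S) T0 Tt; have s1 := scale_ge1 t a1 (b_nu S).
have s0 := le_trans ler01 s1; have w0 := le_trans s0 sB.
by rewrite lerXn2r.
Qed.

(** By Landau's inequality around a point where u_x is large: u cannot be too small there, because
    u_xx is O(K^2), and no higher derivative can be, because |u| <= D. *)
Lemma derivative_lower alpha D F m c T : 1 < alpha < 2 -> 0 < D -> jet F -> 0 < c -> 0 < T ->
  exists2 d, 0 < d & forall sigma nu g (t : R),
    burgers alpha sigma D nu F g -> T <= t -> c <= dissipation alpha nu g t ->
    exists x, d * wave alpha nu ^+ m <= `|g 0%N m t x|.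
Proof.
move=> a12 D0 jF c0 T0; have [d d0 Hd] := gradient_lower a12 D0 jF c0 T0.
have /andP[a1 a2] := a12.
have Kgt0 nu : 0 < nu <= 1 -> 0 < wave alpha nu.
  by move=> n1; apply: lt_le_trans (wave_ge1 a1 n1).
case: m => [|m].
  have [C2 C20 HC2] := sup_wave 2 a12 D0 jF T0.
  have [L L0 HL] := @landau R 2 1 isT.
  have L1 : 0 < L + 1 by rewrite ltr_wpDl.
  (* Makes the share of the second derivative l d / (2 (L + 1)); [h] is half of that, so the sum
     stays below l d / L. *)
  pose l := d / (2 * (L + 1) * C2).
  have l0 : 0 < l by rewrite divr_gt0// mulr_gt0// mulr_gt0// ltr_wpDl.
  pose h := l * d / (4 * (L + 1)); have h0 : 0 < h.
    by rewrite divr_gt0 ?(mulr_gt0 l0 d0)// mulr_gt0.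
  exists h => // sigma nu g t S Tt ct; rewrite expr0 mulr1.
  have K0 := Kgt0 nu (b_nu S); have t1 : 0 <= t by rewrite (le_trans (ltW T0)).
  have [x Hx] := Hd sigma nu g t S Tt ct.
  apply/not_existsP => H.
  have lK : 0 < l / wave alpha nu by rewrite divr_gt0.
  have b0 : jet_bound (fun j => g 0%N j t) x (l / wave alpha nu) 0 h.
    move=> y _; rewrite expr0 mul1r; apply: ltW; rewrite ltNge; apply/negP; exact: H.
  have b2 : jet_bound (fun j => g 0%N j t) x (l / wave alpha nu) 2 (l ^+ 2 * C2).
    move=> y _; rewrite exprMn -mulrA ler_wpM2l ?sqr_ge0// exprVn ler_pdivrMl ?exprn_gt0// mulrC.
    exact: HC2 S Tt.
  have xx : x <= x <= x + l / wave alpha nu by rewrite lexx lerDl ltW.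
  have := HL _ x _ _ _ (sol_jet S 0 t1) lK b0 b2 x xx; rewrite expr1 => up.
  have : l * d <= L * (h + l ^+ 2 * C2).
    apply: le_trans up; apply: le_trans (ler_wpM2l (ltW lK) Hx).
    by rewrite mulrACA mulVf ?gt_eqF// mulr1.
  have -> : l ^+ 2 * C2 = l * d / (2 * (L + 1)).
    by rewrite /l; field; rewrite !gt_eqF// ltr_wpDl.
  rewrite leNgt => /negP; apply.
  have -> : h + l * d / (2 * (L + 1)) = 3 / 4 * (l * d) / (L + 1).
    by rewrite /h; field; rewrite gt_eqF.
  rewrite mulrA ltr_pdivrMr//.
  have : 0 < l * d by rewrite mulr_gt0.
  move: (l * d) => z z0; have : 0 <= L * z by rewrite mulr_ge0// ltW.
  lra.
have [L L0 HL] := @landau R m.+1 1 isT.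
(* So long that l d exceeds 2 L D, the most that Landau's inequality would allow. *)
pose l := (2 * (L + 1) * D + 1) / d.
have l1 : 0 < 2 * (L + 1) * D + 1 by rewrite ltr_wpDl// !mulr_ge0// ?(ltW D0)// ltW// ltr_wpDl.
have l0 : 0 < l by rewrite divr_gt0.
exists (D / l ^+ m.+1) => [|sigma nu g t S Tt ct]; first by rewrite divr_gt0// exprn_gt0.
have K0 := Kgt0 nu (b_nu S); have t1 : 0 <= t by rewrite (le_trans (ltW T0)).
have [x Hx] := Hd sigma nu g t S Tt ct.
apply/not_existsP => H.
have lK : 0 < l / wave alpha nu by rewrite divr_gt0.
have b0 : jet_bound (fun j => g 0%N j t) x (l / wave alpha nu) 0 D.
  by move=> y _; rewrite expr0 mul1r; exact: (sol_le S y t1).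
have b1 : jet_bound (fun j => g 0%N j t) x (l / wave alpha nu) m.+1 D.
  move=> y _; have := H y => /negP; rewrite -ltNge => /ltW h.
  rewrite exprMn exprVn mulrAC ler_pdivrMr ?exprn_gt0// -ler_pdivlMl ?exprn_gt0//.
  by rewrite mulrA [X in X * _]mulrC.
have xx : x <= x <= x + l / wave alpha nu by rewrite lexx lerDl ltW.
have := HL _ x _ _ _ (sol_jet S 0 t1) lK b0 b1 x xx; rewrite expr1 => up.
have : l * d <= L * (D + D).
  apply: le_trans up; apply: le_trans (ler_wpM2l (ltW lK) Hx).
  by rewrite mulrACA mulVf ?gt_eqF// mulr1.
rewrite /l divfK ?gt_eqF//; have : 0 <= L * D by rewrite mulr_ge0// ltW.
lra.
Qed.

(** For m = 0 the length must not shrink with [nu], as gamma is 0. The one-sided bound u_x <= D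
    suffices: a large positive value persists to the left, a large negative one to the right. *)
Lemma interval_lower alpha D F m c T : 1 < alpha < 2 -> 0 < D -> jet F -> 0 < c -> 0 < T ->
  exists d l, [/\ 0 < d, 0 < l <= 1 & forall sigma nu g (t : R),
    burgers alpha sigma D nu F g -> T <= t -> c <= dissipation alpha nu g t ->
    exists x, forall y, x <= y <= x + (if m is 0%N then l else l / wave alpha nu) ->
      d * wave alpha nu ^+ m <= `|g 0%N m t y|].
Proof.
move=> a12 D0 jF c0 T0; have [d d0 Hd] := derivative_lower m a12 D0 jF c0 T0.
have /andP[a1 a2] := a12.
case: m Hd => [|m] Hd.
  pose l := Num.min 1 (d / (2 * D)).
  have l0 : 0 < l by rewrite lt_min ltr01 divr_gt0// mulr_gt0.
  have lD : D * l <= d / 2.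
    apply: (@le_trans _ _ (D * (d / (2 * D)))).
      by rewrite ler_wpM2l ?(ltW D0)// ge_min lexx orbT.
    by rewrite le_eqVlt; apply/orP; left; apply/eqP; field; rewrite gt_eqF.
  exists (d / 2), l; split; [exact: divr_gt0|by rewrite l0 ge_min lexx|].
  move=> sigma nu g t S Tt ct; have t1 : 0 <= t by rewrite (le_trans (ltW T0)).
  have [x] := Hd sigma nu g t S Tt ct; rewrite expr0 !mulr1 => Hx.
  have du z : is_derive z (1 : R) (g 0%N 0%N t) (g 0%N 1%N t z) := b_dx S 0 0 t z t1.
  have lip y z : y <= z -> g 0%N 0%N t z - g 0%N 0%N t y <= D * (z - y).
    exact: (one_sided_lip du (fun w => sol_grad_le S w t1)).
  have [u0|u0] := leP 0 (g 0%N 0%N t x).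
    rewrite ger0_norm// in Hx; exists (x - l) => y /andP[y1 y2].
    have yx : y <= x by lra.
    have := lip y x yx; have : D * (x - y) <= D * l by rewrite ler_wpM2l ?(ltW D0)//; lra.
    by move=> e1 e2; apply: le_trans (ler_norm _); lra.
  rewrite ltr0_norm// in Hx; exists x => y /andP[y1 y2].
  have := lip x y y1; have : D * (y - x) <= D * l by rewrite ler_wpM2l ?(ltW D0)//; lra.
  by move=> e1 e2; rewrite -normrN; apply: le_trans (ler_norm _); lra.
have [C C0 HC] := sup_wave m.+2 a12 D0 jF T0.
pose l := Num.min 1 (d / (2 * C)).
have l0 : 0 < l by rewrite lt_min ltr01 divr_gt0// mulr_gt0.
have lC : C * l <= d / 2.
  apply: (@le_trans _ _ (C * (d / (2 * C)))).
    by rewrite ler_wpM2l ?(ltW C0)// ge_min lexx orbT.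
  by rewrite le_eqVlt; apply/orP; left; apply/eqP; field; rewrite gt_eqF.
exists (d / 2), l; split; [exact: divr_gt0|by rewrite l0 ge_min lexx|].
move=> sigma nu g t S Tt ct; have t1 : 0 <= t by rewrite (le_trans (ltW T0)).
have [x Hx] := Hd sigma nu g t S Tt ct; exists x => y /andP[xy yl].
set K := wave alpha nu in Hx yl *.
have K0 : 0 < K by apply: lt_le_trans (wave_ge1 a1 (b_nu S)).
have := @mvt_le _ (g 0%N m.+1 t) (g 0%N m.+2 t) (C * K ^+ m.+2) x y xy
  (fun z _ => b_dx S 0 m.+1 t z t1) (fun z _ => HC sigma nu g t z S Tt) => h.
have h2 : C * K ^+ m.+2 * (y - x) <= d / 2 * K ^+ m.+1.
  apply: (@le_trans _ _ (C * K ^+ m.+2 * (l / K))).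
    have CK : 0 <= C * K ^+ m.+2 by rewrite mulr_ge0 ?exprn_ge0 ?(ltW C0) ?(ltW K0).
    have yxl : y - x <= l / K by rewrite lerBlDl.
    exact: ler_wpM2l.
  have -> : C * K ^+ m.+2 * (l / K) = C * l * K ^+ m.+1.
    by rewrite exprS; field; rewrite gt_eqF.
  by rewrite ler_wpM2r ?exprn_ge0 ?(ltW K0).
have := ler_normB (g 0%N m.+1 t y) (g 0%N m.+1 t y - g 0%N m.+1 t x).
rewrite subKr => h3; have := le_trans h h2; move: Hx h3.
move: (K ^+ m.+1) `|g 0%N m.+1 t x| `|g 0%N m.+1 t y| `|_ - _| => k u v w.
lra.
Qed.

Lemma Lnorm_lower alpha D F m c T (p : \bar R) : 1 < alpha < 2 -> 0 < D -> jet F -> 0 < c ->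
  0 < T -> (1 <= p)%E ->
  exists2 d, 0 < d & forall sigma nu g (t : R),
    burgers alpha sigma D nu F g -> T <= t -> c <= dissipation alpha nu g t ->
    ((d * wave alpha nu `^ gamma_exp m p)%:E <= 'N[circle_measure R]_p[EFin \o g 0%N m t])%E.
Proof.
move=> a12 D0 jF c0 T0 p1; have [d [l [d0 l01 H]]] := interval_lower m a12 D0 jF c0 T0.
have /andP[a1 a2] := a12; have /andP[l0 l1] := l01.
have l20 : 0 < l / 2 by rewrite divr_gt0.
exists ((l / 2) `^ fine p^-1 * d) => [|sigma nu g t S Tt ct].
  by rewrite mulr_gt0// powR_gt0.
have t1 : 0 <= t by rewrite (le_trans (ltW T0)).
have cu : continuous (g 0%N m t) by exact: jet_continuous (sol_jet S 0 t1).
have pu := sol_periodic S m (leqnSn 0) t1.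
have [x Hx] := H sigma nu g t S Tt ct.
have K1 := wave_ge1 a1 (b_nu S); set K := wave alpha nu in Hx K1 *.
have K0 : 0 < K by apply: lt_le_trans K1.
case: m {H} cu pu Hx => [|m] cu pu Hx.
  rewrite gamma_exp0// powRr0 mulr1.
  apply: (Lnorm_ge p1 cu pu l01 (ltW d0)) => y /Hx.
  by rewrite expr0 mulr1.
have lK : 0 < l / K <= 1.
  by rewrite divr_gt0//= ler_pdivrMr// mul1r (le_trans l1).
have dK : 0 <= d * K ^+ m.+1 by rewrite mulr_ge0 ?exprn_ge0 ?(ltW K0)// ltW.
have := Lnorm_ge p1 cu pu lK dK Hx; apply: le_trans.
rewrite lee_fin le_eqVlt; apply/orP; left; apply/eqP.
have -> : gamma_exp m.+1 p = m.+1%:R - fine p^-1.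
  case: p p1 {pu cu Hx dK lK} => [r r1|_|//]; last by rewrite gamma_expy invey subr0.
  rewrite lee_fin in r1; rewrite gamma_exp_fin// inver gt_eqF//.
  exact: lt_le_trans r1.
rewrite powR_add// powR_mulrn ?(ltW K0)// powRN.
rewrite (_ : l / K / 2 = l / 2 * K^-1); last by field; rewrite gt_eqF.
rewrite [in RHS]powRM ?invr_ge0 ?(ltW l20) ?(ltW K0)//.
rewrite -[K^-1](powR_inv1 (ltW K0)) -powRrM mulN1r powRN; ring.
Qed.

End PointwiseLower.

(** * Time averages *)

Section TimeAverages.
Context {R : realType}.
Implicit Types (A : R -> \bar R) (sigma D Ct kappa b c : R).

(** The integral of a nonnegative function is a supremum over simple functions below it, so
    monotonicity needs no measurability. *)
Lemma le_integral_nonmeas d (T : measurableType d) (mu : {measure set T -> \bar R}) (E : set T)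
    (f h : T -> \bar R) : (forall x, E x -> 0 <= f x)%E -> (forall x, E x -> f x <= h x)%E ->
  (\int[mu]_(x in E) f x <= \int[mu]_(x in E) h x)%E.
Proof.
move=> f0 fh; have h0 x : E x -> (0 <= h x)%E by move=> Ex; exact: le_trans (f0 x Ex) (fh x Ex).
rewrite !ge0_integralE//; apply: le_ereal_sup => _ [s /= sf <-]; exists s => //= x.
apply: le_trans (sf x) _; rewrite !patchE; case: ifPn => // xE.
by apply: fh; rewrite inE in xE.
Qed.

Lemma avg_start_gt0 D Ct : 0 < D -> 0 < Ct -> 0 < avg_start D Ct.
Proof. by move=> D0 C0; rewrite /avg_start !mulr_gt0 ?invr_gt0 ?exprn_gt0. Qed.

Lemma avg_start_lt_end sigma D Ct : 0 < D -> 0 < Ct -> avg_start D Ct < avg_end sigma D Ct.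
Proof.
move=> D0 C0; have T0 := avg_start_gt0 D0 C0.
by rewrite /avg_end lt_max; apply/orP; left; lra.
Qed.

Lemma avg_moment_upper sigma D Ct kappa A b : 0 < D -> 0 < Ct -> 0 < kappa -> 0 <= b ->
  (forall t : R, avg_start D Ct <= t -> (0 <= A t)%E) ->
  (forall t : R, avg_start D Ct <= t -> (A t <= b%:E)%E) ->
  (avg_moment sigma D Ct kappa A <= b%:E)%E.
Proof.
move=> D0 C0 k0 b0 A0 Ab; have T12 := avg_start_lt_end sigma D0 C0.
set T1 := avg_start D Ct in A0 Ab T12; set T2 := avg_end sigma D Ct in T12.
have T0 : 0 < T2 - T1 by rewrite subr_gt0.
have : (time_avg sigma D Ct (fun t => A t `^ kappa) <= (b `^ kappa)%:E)%E.
  rewrite /time_avg -/T1 -/T2 lee_pdivrMl//.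
  apply: (@le_trans _ _ (\int[lebesgue_measure]_(t in `[T1, T2]) (b `^ kappa)%:E)%E).
    apply: le_integral_nonmeas => t; rewrite /= in_itv/= => /andP[t1 t2].
      exact: poweR_ge0.
    rewrite -poweR_EFin; apply: gt0_ler_poweR => //; first exact: ltW.
    - by rewrite in_itv/= leey A0.
    - by rewrite in_itv/= leey lee_fin b0.
    - exact: Ab.
  rewrite integral_cst//= lebesgue_measure_itv/= lte_fin T12 -EFinD muleC.
  exact: lexx.
move=> h; rewrite /avg_moment.
have -> : b%:E = ((b `^ kappa)%:E `^ kappa^-1)%E.
  by rewrite poweR_EFin -powRrM mulfV ?gt_eqF// powRr1.
apply: gt0_ler_poweR => //; first by rewrite invr_ge0 ltW.
- rewrite in_itv/= leey andbT /time_avg mule_ge0 ?lee_fin ?invr_ge0 ?(ltW T0)//.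
  by apply: integral_ge0 => t _; exact: poweR_ge0.
- by rewrite in_itv/= leey lee_fin powR_ge0.
Qed.

End TimeAverages.

(** * Times of large dissipation *)

Section GoodTimes.
Context {R : realType} {alpha sigma D nu Ct : R} {F : nat -> R -> R}
  {g : nat -> nat -> R -> R -> R}.
Hypothesis S : burgers alpha sigma D nu F g.
Hypothesis Ct_gt0 : 0 < Ct.
Hypothesis energy_le : forall t : R, 0 <= t ->
  (sobolevH (alpha / 2) (g 0%N 0%N t) ^+ 2 <= (Ct * nu^-1)%:E)%E.

Let T1 := avg_start D Ct.
Let T2 := avg_end sigma D Ct.
Let D_gt0 : 0 < D. Proof. exact: lt_trans ltr01 (b_D S). Qed.
Let T1_gt0 : 0 < T1. Proof. exact: avg_start_gt0. Qed.
Let T12 : T1 < T2. Proof. exact: avg_start_lt_end. Qed.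

(** With dissipation at most [Ct], the energy loses at most 2 Ct T1 = D^(-2) / 2 before T1. *)
Lemma energy_start_lower : D ^- 2 / 2 <= energy g 0 T1.
Proof.
have [t|| t tI] := @MVT _ (energy g 0) (fun t => - (2 * dissipation alpha nu g t)) 0 T1 T1_gt0.
- by rewrite in_itv/= => /andP[t0 _]; exact: energy0_derive S _ t0.
- exact: (energy_continuous S (j := 0%N) (T := T1)).
move: tI; rewrite in_itv/= => /andP[t0 _] E.
have h := dissipation_le S (ltW t0) (energy_le (ltW t0)).
have e0 := b_energy S; rewrite -/(energy g 0 0) in e0.
rewrite subr0 in E.
have h2 : dissipation alpha nu g t * T1 <= Ct * T1 by rewrite ler_wpM2r// ltW.
have CT : Ct * T1 = D ^- 2 / 4 by rewrite /T1 /avg_start; field; rewrite !gt_eqF.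
move: (D ^- 2) e0 CT => q e0 CT; lra.
Qed.

(** T2 is late enough for |u| <= 1 / (sigma T2) <= 1 / (2 D). *)
Lemma energy_end_upper : energy g 0 T2 <= D ^- 2 / 4.
Proof.
have s0 := b_sigma S.
have T20 : 0 < T2 by exact: lt_trans T12.
have sT : 2 * D <= sigma * T2.
  by rewrite -ler_pdivrMl// mulrC /T2 /avg_end le_max lexx orbT.
have cu : continuous (g 0%N 0%N T2) by exact: jet_continuous (sol_jet S 0 (ltW T20)).
have b x : `|g 0%N 0%N T2 x| <= (2 * D)^-1.
  apply: le_trans (sol_le_time S x T20) _.
  by rewrite lef_pV2// posrE ?mulr_gt0.
have -> : D ^- 2 / 4 = ((2 * D)^-1) ^+ 2 by field; rewrite gt_eqF.
apply: le_trans (ler_norm _) _; apply: norm_cint_le; first exact: continuous_exp.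
move=> x; rewrite normrX lerXn2r ?nnegrE//; exact: le_trans (b x).
Qed.

(** The energy drops by at least D^(-2) / 4 on [T1, T2] and its derivative is minus twice the
    dissipation, which therefore integrates to D^(-2) / 8 or more. The threshold uses up half of
    this. *)
Definition dissipation_threshold : R := D ^- 2 / (16 * (T2 - T1)).

Lemma dissipation_threshold_gt0 : 0 < dissipation_threshold.
Proof.
by rewrite divr_gt0 ?mulr_gt0 ?subr_gt0// invr_gt0 exprn_gt0.
Qed.

Lemma integral_excess : ((D ^- 2 / 16)%:E <=
  \int[lebesgue_measure]_(t in `[T1, T2])
    (Num.max 0 (dissipation alpha nu g t - dissipation_threshold))%:E)%E.
Proof.
set c := dissipation_threshold.
pose f t := dissipation alpha nu g t - c.
pose Phi t := - 2^-1 * energy g 0 t - c * t.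
have cf : {within `[T1, T2], continuous f}.
  have c1 := dissipation_continuous S (b := T2) T1_gt0.
  have c2 : {within `[T1, T2], continuous (fun _ : R => c)}.
    by apply: continuous_subspaceT => t; exact: cvg_cst.
  by move=> t; apply: cvgB; [exact: c1|exact: c2].
have dPhi (t : R) : 0 < t -> is_derive t (1 : R) Phi (f t).
  move=> t0; have d := is_derive1B (is_derive1Z (- 2^-1) (energy0_derive S t0))
    (is_derive1Z c (is_derive_id t (1 : R))).
  by apply: (is_derive_eq d); rewrite /f; lra.
have cPhi (t : R) : 0 < t -> {for t, continuous Phi}.
  move=> t0; apply: differentiable_continuous; apply/derivable1_diffP.
  exact: (@ex_derive _ _ _ _ _ _ _ (dPhi t t0)).
have FTC : (\int[lebesgue_measure]_(t in `[T1, T2]) (f t)%:E = (Phi T2)%:E - (Phi T1)%:E)%E.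
  apply: continuous_FTC2 => //.
  - split; first by move=> t; rewrite in_itv/= => /andP[t0 _];
      exact: (@ex_derive _ _ _ _ _ _ _ (dPhi t (lt_trans T1_gt0 t0))).
    + by apply: cvg_at_right_filter; exact: cPhi.
    + by apply: cvg_at_left_filter; apply: cPhi; exact: lt_trans T12.
  - move=> t; rewrite in_itv/= => /andP[t0 _]; rewrite derive1E.
    exact: (@derive_val _ _ _ _ _ _ _ (dPhi t (lt_trans T1_gt0 t0))).
apply: (@le_trans _ _ (\int[lebesgue_measure]_(t in `[T1, T2]) (f t)%:E)%E).
  rewrite FTC -EFinB lee_fin /Phi.
  have cT : c * (T2 - T1) = D ^- 2 / 16.
    by rewrite /c /dissipation_threshold; field; rewrite subr_eq0 !gt_eqF.
  have := energy_start_lower; have := energy_end_upper.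
  move: (D ^- 2) cT => q cT; lra.
apply: le_integral => //.
- exact: continuous_compact_integrable (@segment_compact _ _ _) cf.
- apply: continuous_compact_integrable; first exact: segment_compact.
  have c0 : {within `[T1, T2], continuous (fun _ : R => 0 : R)}.
    by apply: continuous_subspaceT => t; exact: cvg_cst.
  by move=> t; apply: (@continuous_max _ _ _ _ t (c0 t) (cf t)).
- by move=> t _; rewrite lee_fin le_max lexx orbT.
Qed.

(** The excess of the dissipation over the threshold vanishes outside the good times, is at most
    [Ct], and has integral bounded below. Hence A^kappa >= (b^kappa / Ct) excess at every time of
    the interval. *)
Lemma avg_moment_lower (kappa : R) (A : R -> \bar R) (b : R) : 0 < kappa -> 0 <= b ->
  (forall t : R, T1 <= t -> (0 <= A t)%E) ->
  (forall t : R, T1 <= t -> dissipation_threshold <= dissipation alpha nu g t -> (b%:E <= A t)%E) ->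
  ((b * (D ^- 2 / 16 / Ct / (T2 - T1)) `^ kappa^-1)%:E <= avg_moment sigma D Ct kappa A)%E.
Proof.
move=> k0 b0 A0 Ab; set c := dissipation_threshold in Ab *.
have T0 : 0 < T2 - T1 by rewrite subr_gt0.
have s0 (t : R) : T1 <= t -> 0 <= t by move=> tT; exact: le_trans (ltW T1_gt0) tT.
pose q := b `^ kappa / Ct; have q0 : 0 <= q by rewrite divr_ge0 ?powR_ge0// ltW.
have H : ((q * (D ^- 2 / 16))%:E <=
    \int[lebesgue_measure]_(t in `[T1, T2]) (A t `^ kappa))%E.
  rewrite EFinM; apply: (@le_trans _ _ (q%:E * \int[lebesgue_measure]_(t in `[T1, T2])
    (Num.max 0 (dissipation alpha nu g t - c))%:E)%E).
    by rewrite lee_wpmul2l ?lee_fin//; exact: integral_excess.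
  rewrite -ge0_integralZl_EFin//; first last.
  - have cf : {within `[T1, T2], continuous (fun t => Num.max 0 (dissipation alpha nu g t - c))}.
      have c1 := dissipation_continuous S (b := T2) T1_gt0.
      have c2 : {within `[T1, T2], continuous (fun _ : R => c)}.
        by apply: continuous_subspaceT => t; exact: cvg_cst.
      have c0 : {within `[T1, T2], continuous (fun _ : R => 0 : R)}.
        by apply: continuous_subspaceT => t; exact: cvg_cst.
      move=> t; apply: (@continuous_max _ _ _ _ t (c0 t)).
      by apply: cvgB; [exact: c1|exact: c2].
    apply/measurable_EFinP; exact: subspace_continuous_measurable_fun.
  - by move=> t _; rewrite lee_fin le_max lexx.
  apply: le_integral_nonmeas => t; rewrite /= in_itv/= => /andP[t1 t2].
    by rewrite mule_ge0 ?lee_fin// le_max lexx.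
  have [h|h] := leP (dissipation alpha nu g t) c.
    by rewrite (_ : Num.max 0 _ = 0) ?mule0 ?poweR_ge0//; apply/max_idPl; rewrite subr_le0.
  apply: (@le_trans _ _ (b%:E `^ kappa)%E).
    rewrite poweR_EFin -EFinM lee_fin /q -mulrA ler_piMr ?powR_ge0//.
    rewrite ler_pdivrMl// mulr1 ge_max ltW//=.
    have c0 := dissipation_threshold_gt0; rewrite -/c in c0.
    have := dissipation_le S (s0 t t1) (energy_le (s0 t t1)); lra.
  apply: gt0_ler_poweR => //; first exact: ltW.
  - by rewrite in_itv/= leey lee_fin b0.
  - by rewrite in_itv/= leey A0.
  - by apply: Ab => //; exact: ltW.
have -> : b * (D ^- 2 / 16 / Ct / (T2 - T1)) `^ kappa^-1 =
    ((T2 - T1)^-1 * (q * (D ^- 2 / 16))) `^ kappa^-1.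
  have -> : (T2 - T1)^-1 * (q * (D ^- 2 / 16)) = b `^ kappa * (D ^- 2 / 16 / Ct / (T2 - T1)).
    rewrite /q; move: (D ^- 2) (_^-1) => u v; ring.
  rewrite powRM ?powR_ge0//; last first.
    by rewrite !divr_ge0 ?exprn_ge0 ?(ltW D_gt0) ?(ltW Ct_gt0) ?(ltW T0)// invr_ge0 exprn_ge0// ltW.
  by rewrite -powRrM mulfV ?gt_eqF// powRr1.
rewrite /avg_moment -poweR_EFin; apply: gt0_ler_poweR => //; first by rewrite invr_ge0 ltW.
- rewrite in_itv/= leey lee_fin andbT.
  apply: mulr_ge0; first by rewrite invr_ge0 ltW.
  by apply: mulr_ge0 => //; rewrite divr_ge0// invr_ge0 exprn_ge0// ltW.
- rewrite in_itv/= leey andbT /time_avg mule_ge0 ?lee_fin ?invr_ge0 ?(ltW T0)//.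
  by apply: integral_ge0 => t _; exact: poweR_ge0.
- by rewrite EFinM /time_avg lee_pmul2l// ?lte_fin ?invr_gt0.
Qed.

End GoodTimes.

(** * From admissible solutions to the estimates *)

Section Admissible.
Context {R : realType}.
Implicit Types (alpha sigma D nu Ct kappa r : R) (f : R -> R) (u : R -> R -> R)
  (g : nat -> nat -> R -> R -> R).

Lemma smooth_jet_of (f : R -> R) : smooth f -> jet (fun j => derive1n j f).
Proof.
move=> sf j x; apply: DeriveDef; first exact: sf.
by rewrite -derive1E.
Qed.

Lemma derive1n_jet (G : nat -> R -> R) m : jet G -> derive1n m (G 0%N) = G m.
Proof.
move=> jG; elim: m => [//|m IH]; apply/funext => x.
by rewrite /= IH derive1E; exact: (@derive_val _ _ _ _ _ _ _ (jG m x)).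
Qed.

Lemma derive_from0_is_derive (w : R -> R) (t l : R) : 0 < t -> derive_from0 w t l ->
  is_derive t (1 : R) w l.
Proof.
move=> t0 H.
suff cv : h^-1 *: (w (h *: (1 : R) + t) - w t) @[h --> (0 : R)^'] --> l.
  by apply: DeriveDef; [apply/cvg_ex; exists l|exact/cvg_lim].
apply/cvgrPdist_le => e e0.
move/cvgrPdist_le: H => /(_ e e0); rewrite near_withinE => /nbhs_normP[d /= d0 Hd].
have m0 : 0 < Num.min d t by rewrite lt_min d0.
apply/nbhs_normP; exists (Num.min d t) => //= h; rewrite /ball_/= sub0r normrN lt_min.
move=> /andP[hd ht] h0.
have := Hd (h + t); rewrite /ball_/= opprD addrC subrK normrN => /(_ hd).
have hpos : 0 <= h + t by move: ht; rewrite ltr_norml => /andP[]; lra.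
have ne : h + t != t by rewrite -subr_eq0 addrK.
move=> /(_ ne hpos); rewrite addrK /GRing.scale/= mulr1 mulrC.
exact.
Qed.

(** By continuity a value above [c] persists on an interval, where [Lnorm_ge] contradicts the bound
    on the norm. *)
Lemma sup_of_sobolevW (v : R -> R) c : continuous v -> periodic v 1 ->
  ('N[circle_measure R]_+oo[EFin \o v] <= c%:E)%E -> forall x, `|v x| <= c.
Proof.
move=> cv pv vc x; rewrite leNgt; apply/negP => cx.
have c0 : 0 <= c by rewrite -lee_fin; apply: le_trans vc; exact: Lnorm_ge0.
pose e := (`|v x| - c) / 2; have e0 : 0 < e by rewrite divr_gt0// subr_gt0.
have [d /= d0 Hd] : exists2 d, 0 < d & forall y, `|x - y| < d -> `|v x - v y| <= e.
  have /cvgrPdist_le/(_ e e0)/nbhs_normP[d /= d0 Hd] := cv x.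
  by exists d => // y xy; exact: Hd.
pose l := Num.min 1 (d / 2).
have l01 : 0 < l <= 1 by rewrite lt_min ltr01 divr_gt0// ge_min lexx.
have ce0 : 0 <= c + e by rewrite addr_ge0// ltW.
have big y : x <= y <= x + l -> c + e <= `|v y|.
  move=> /andP[xy yl]; have ld : l <= d / 2 by rewrite ge_min lexx orbT.
  have xd : `|x - y| < d by rewrite ler0_norm ?subr_le0// opprB; lra.
  have h := Hd y xd; have ce : c + e = `|v x| - e by rewrite /e; lra.
  by have := lerB_dist (v x) (v y); lra.
have y1 : (1 <= +oo :> \bar R)%E by rewrite leey.
have := le_trans (Lnorm_ge y1 cv pv l01 ce0 big) vc.
rewrite invey powRr0 mul1r lee_fin; lra.
Qed.

Lemma admissible_burgers alpha sigma D nu f u : 1 < alpha < 2 -> flux sigma f -> 1 < D ->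
  admissible alpha f D nu u -> exists g,
  [/\ burgers alpha sigma D nu (fun j => derive1n j f) g,
      forall t, 0 <= t -> u t = g 0%N 0%N t &
      forall m t, 0 <= t -> derive1n m (u t) = g 0%N m t].
Proof.
move=> a12 [sf s0 f2 _] D1 [n1 [u0 [[pu0 su0 mu0 _] size0 [pu mu u0E [g [[gu gt gx gc] ueq]]]]]].
have D0 : 0 < D := lt_trans ltr01 D1.
have uE t : 0 <= t -> u t = g 0%N 0%N t by move=> t0; apply/funext => x; rewrite gu.
have jg i t : 0 <= t -> jet (fun j => g i j t) by move=> t0 j x; exact: gx.
have dE m t : 0 <= t -> derive1n m (u t) = g 0%N m t.
  by move=> t0; rewrite uE//; exact: (derive1n_jet m (jg 0%N t t0)).
have c0 t : 0 <= t -> continuous (g 0%N 0%N t) by move=> t0; exact: jet_continuous (jg 0%N t t0).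
have pg : pjet (fun j => g 0%N j 0) by split; [exact: jg|rewrite -uE//; exact: pu].
have W0 : ((sobolevW 0 1 u0)^-1 <= D%:E)%E.
  by rewrite -size0 /initial_size le_max lexx.
have W1 : (sobolevW 1 +oo u0 <= D%:E)%E by rewrite -size0 /initial_size le_max lexx orbT.
exists g; split => //; split => //.
- exact: smooth_jet_of.
- by move=> t t0; rewrite -uE//; exact: pu.
- by move=> t t0; rewrite -uE//; exact: mu.
- by move=> i j t x t0; exact: derive_from0_is_derive (gt i j t x (ltW t0)).
- move=> t x t0; have := ueq t x t0.
  rewrite frac_lapE ?uE//; last first.
  + exact: c0.
  + by case/andP: a12 => a1 _; exact: lt_trans a1.
  by rewrite /comp_jet/= /comp; lra.
- move=> x; apply: le_trans (ler_norm _) _; move: x; apply: sup_of_sobolevW.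
  + exact: (jet_continuous 1 pg.1).
  + exact: (pjet_periodic 1 pg).
  by move: W1; rewrite /sobolevW -u0E dE.
have cu : continuous (g 0%N 0%N 0) by exact: c0.
have cn : continuous (fun x => `|g 0%N 0%N 0 x|) by exact: continuous_norm.
pose M := cint (fun x => `|g 0%N 0%N 0 x|).
have ME : sobolevW 0 1 u0 = M%:E.
  rewrite /sobolevW -u0E dE// Lnorm1 EFin_cint//.
have M0 : 0 <= M by exact: cint_ge0.
have DM : D^-1 <= M.
  (* The extended inverse of 0 is +oo, which the bound by [D] rules out. *)
  move: W0; rewrite ME inver; case: eqVneq => [_|Mn]; first by rewrite leye_eq.
  have M1 : 0 < M by rewrite lt_neqAle eq_sym Mn.
  by rewrite lee_fin => h; rewrite -[M]invrK lef_pV2// posrE ?invr_gt0.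
(* Cauchy-Schwarz, as the integral of (|u| - M)^2 is nonnegative. *)
have cs : M ^+ 2 <= cint (fun x => g 0%N 0%N 0 x ^+ 2).
  have : 0 <= cint (fun x => g 0%N 0%N 0 x ^+ 2 - 2 * M * `|g 0%N 0%N 0 x| + M ^+ 2).
    apply: cint_ge0 => x; rewrite -[g 0%N 0%N 0 x ^+ 2]real_normK ?num_real//.
    rewrite (_ : _ + _ = (`|g 0%N 0%N 0 x| - M) ^+ 2) ?sqr_ge0//; ring.
  rewrite cintD; last exact: continuous_cst.
    rewrite cintB; [|exact: continuous_exp|exact: continuous_scale].
    by rewrite cintZ// cint_cst -/M; lra.
  by apply: continuous_sub; [exact: continuous_exp|exact: continuous_scale].
apply: le_trans cs; rewrite -exprVn lerXn2r ?nnegrE// invr_ge0; exact: ltW.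
Qed.

Lemma sobolevH_ge0 s (v : R -> R) : (0 <= sobolevH s v)%E.
Proof. by rewrite mule_ge0 ?poweR_ge0// lee_fin powR_ge0. Qed.

Lemma gamma_exp_ge0 m (p : \bar R) : 0 <= gamma_exp m p.
Proof. by rewrite le_max lexx. Qed.

Lemma wave_powR alpha nu r : wave alpha nu `^ r = nu `^ (- (beta_exp alpha * r)).
Proof. by rewrite -powRrM mulNr. Qed.

(** [A] is an arbitrary nonnegative functional of one function, so that the L_p and H^s norms are
    averaged by the same argument. *)
Lemma lesssim_avg_upper alpha sigma D Ct kappa r f (A : (R -> R) -> \bar R) C :
  1 < alpha < 2 -> flux sigma f -> 1 < D -> 0 < Ct -> 0 < kappa -> 0 <= r -> 0 < C ->
  (forall v, 0 <= A v)%E ->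
  (forall nu g (t : R), burgers alpha sigma D nu (fun j => derive1n j f) g -> 0 < t ->
     (A (g 0%N 0%N t) <= (C * scale alpha nu t `^ r)%:E)%E) ->
  lesssim alpha f D (fun _ u => avg_moment sigma D Ct kappa (fun t => A (u t)))
    (fun nu _ => (nu `^ (- (beta_exp alpha * r)))%:E).
Proof.
move=> a12 hf D1 Ct0 k0 r0 C0 A0 HA; have D0 : 0 < D := lt_trans ltr01 D1.
have a1 : 1 < alpha by case/andP: a12.
pose T := avg_start D Ct; have T0 : 0 < T by exact: avg_start_gt0.
pose B := Num.max T^-1 1; have B0 : 0 < B by rewrite lt_max ltr01 orbT.
exists (C * B `^ r) => [|nu u adm]; first by rewrite mulr_gt0// powR_gt0.
have [g [S uE _]] := admissible_burgers a12 hf D1 adm.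
rewrite -EFinM -wave_powR; apply: avg_moment_upper => //.
  by rewrite !mulr_ge0 ?powR_ge0// ltW.
move=> t Tt; have t0 : 0 < t := lt_le_trans T0 Tt.
rewrite uE ?(ltW t0)//; apply: le_trans (HA nu g t S t0) _.
have s1 := scale_ge1 t a1 (b_nu S).
rewrite lee_fin -mulrA ler_wpM2l ?(ltW C0)// -powRM ?powR_ge0 ?(ltW B0)//.
apply: powR_monol => //; first exact: le_trans s1.
exact: scale_le (b_nu S) T0 Tt.
Qed.

Lemma lesssim_avg_lower alpha sigma D Ct kappa r f (A : (R -> R) -> \bar R) d :
  1 < alpha < 2 -> flux sigma f -> 1 < D -> 0 < Ct -> energy_bound alpha f D Ct ->
  0 < kappa -> 0 < d -> (forall v, 0 <= A v)%E ->
  (forall nu g (t : R), burgers alpha sigma D nu (fun j => derive1n j f) g -> avg_start D Ct <= t ->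
     @dissipation_threshold R sigma D Ct <= dissipation alpha nu g t ->
     ((d * wave alpha nu `^ r)%:E <= A (g 0%N 0%N t))%E) ->
  lesssim alpha f D (fun nu _ => (nu `^ (- (beta_exp alpha * r)))%:E)
    (fun _ u => avg_moment sigma D Ct kappa (fun t => A (u t))).
Proof.
move=> a12 hf D1 Ct0 hE k0 d0 A0 HA; have D0 : 0 < D := lt_trans ltr01 D1.
pose T := avg_start D Ct; have T0 : 0 < T by exact: avg_start_gt0.
pose e := (D ^- 2 / 16 / Ct / (avg_end sigma D Ct - T)) `^ kappa^-1.
have e0 : 0 < e.
  rewrite powR_gt0// !divr_gt0 ?invr_gt0 ?exprn_gt0// subr_gt0.
  exact: avg_start_lt_end.
exists (d * e)^-1 => [|nu u adm]; first by rewrite invr_gt0 mulr_gt0.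
have [g [S uE _]] := admissible_burgers a12 hf D1 adm.
have hg t : 0 <= t -> (sobolevH (alpha / 2) (g 0%N 0%N t) ^+ 2 <= (Ct * nu^-1)%:E)%E.
  by move=> t0; rewrite -uE//; exact: hE.
rewrite lee_pdivlMl ?mulr_gt0// -EFinM -wave_powR.
have -> : d * e * wave alpha nu `^ r = d * wave alpha nu `^ r * e by ring.
apply: (avg_moment_lower S Ct0 hg k0) => [|//|t Tt ct].
  by rewrite mulr_ge0 ?powR_ge0// ltW.
rewrite uE; last exact: le_trans (ltW T0) Tt.
exact: HA S Tt ct.
Qed.

End Admissible.

Theorem theorem6p7 (R : realType) (alpha sigma D Ct : R) (f : R -> R)
    (halpha : 1 < alpha < 2) (hf : flux sigma f) (hD : 1 < D)
    (hCt : 0 < Ct) (hE : energy_bound alpha f D Ct) :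
  [/\ (* two-sided estimate, L_p-based norms *)
      (forall (m : nat) (p : \bar R) (kappa : R),
         upper_range m p -> 0 < kappa ->
         comparable_upto alpha f D
           (fun _ u => avg_moment sigma D Ct kappa (fun t => sobolevW m p (u t)))
           (fun nu _ => (nu `^ (- (beta_exp alpha * gamma_exp m p)))%:E)),
      (* two-sided estimate, H^s norms *)
      (forall s kappa : R,
         2^-1 < s -> 2^-1 < kappa ->
         comparable_upto alpha f D
           (fun _ u => avg_moment sigma D Ct kappa (fun t => sobolevH s (u t)))
           (fun nu _ => (nu `^ (- (beta_exp alpha * (s - 2^-1))))%:E)),
      (* upper estimates, pointwise in time *)
      (forall (m : nat) (p : \bar R),
         upper_range m p ->
         exists2 C : R, 0 < C &
           forall nu u, admissible alpha f D nu u -> forall t, 0 < t ->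
             (sobolevW m p (u t) <=
               (C * Num.max (t `^ (- gamma_exp m p))
                            (nu `^ (- (beta_exp alpha * gamma_exp m p))))%:E)%E),
      (* lower estimate for L_p-based norms, all m and p *)
      (forall (m : nat) (p : \bar R) (kappa : R),
         (1 <= p)%E -> 0 < kappa ->
         lesssim alpha f D
           (fun nu _ => (nu `^ (- (beta_exp alpha * gamma_exp m p)))%:E)
           (fun _ u => avg_moment sigma D Ct kappa (fun t => sobolevW m p (u t)))) &
      (* lower estimate for H^s norms, s = 1/2 *)
      (forall kappa : R,
         2^-1 < kappa ->
         lesssim alpha f D
           (fun nu _ => (nu `^ (- (beta_exp alpha * (2^-1 - 2^-1))))%:E)
           (fun _ u => avg_moment sigma D Ct kappa (fun t => sobolevH 2^-1 (u t))))].
Proof.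
have D0 : 0 < D := lt_trans ltr01 hD.
have T0 : 0 < avg_start D Ct by exact: avg_start_gt0.
have [sf s0 _ _] := hf; have jF := smooth_jet_of sf.
have thr0 : 0 < @dissipation_threshold R sigma D Ct.
  rewrite divr_gt0 ?invr_gt0 ?exprn_gt0// mulr_gt0// subr_gt0.
  exact: avg_start_lt_end.
have jetE nu g (t : R) m : burgers alpha sigma D nu (fun j => derive1n j f) g -> 0 <= t ->
    derive1n m (g 0%N 0%N t) = g 0%N m t.
  by move=> S t0; exact: (derive1n_jet m (sol_jet S 0 t0)).
have upW m p : upper_range m p -> exists2 C : R, 0 < C & forall nu g (t : R),
    burgers alpha sigma D nu (fun j => derive1n j f) g -> 0 < t ->
    (sobolevW m p (g 0%N 0%N t) <= (C * scale alpha nu t `^ gamma_exp m p)%:E)%E.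
  move=> mp; have [C C0 HC] := Lnorm_upper halpha D0 jF mp.
  exists C => // nu g t S t0; rewrite /sobolevW (jetE nu g t m S (ltW t0)); exact: HC S t0.
have W0 m p (v : R -> R) : (0 <= sobolevW m p v)%E by exact: Lnorm_ge0.
have lowW (m : nat) (p : \bar R) (kappa : R) : (1 <= p)%E -> 0 < kappa ->
    lesssim alpha f D (fun nu _ => (nu `^ (- (beta_exp alpha * gamma_exp m p)))%:E)
      (fun _ u => avg_moment sigma D Ct kappa (fun t => sobolevW m p (u t))).
  move=> p1 k0; have [d d0 Hd] := Lnorm_lower m halpha D0 jF thr0 T0 p1.
  apply: (lesssim_avg_lower halpha hf hD hCt hE k0 d0 (W0 m p)) => nu g t S Tt ct.
  rewrite /sobolevW (jetE nu g t m S (le_trans (ltW T0) Tt)); exact: Hd S Tt ct.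
have lowH (s kappa : R) : 2^-1 <= s -> 0 < kappa ->
    lesssim alpha f D (fun nu _ => (nu `^ (- (beta_exp alpha * (s - 2^-1))))%:E)
      (fun _ u => avg_moment sigma D Ct kappa (fun t => sobolevH s (u t))).
  move=> s2 k0; have s_gt0 : 0 < s by apply: lt_le_trans s2.
  have [d d0 Hd] := sobolev_lower halpha D0 jF thr0 T0 s_gt0.
  apply: (lesssim_avg_lower halpha hf hD hCt hE k0 d0 (sobolevH_ge0 s)) => nu g t S Tt ct.
  exact: Hd S Tt ct.
have k_gt0 (kappa : R) : 2^-1 < kappa -> 0 < kappa by apply: lt_trans.
split.
- move=> m p kappa mp k0; split; last by apply: lowW => //; case: mp => -[_ //] /ltW.
  have [C C0 HC] := upW m p mp.
  exact: (lesssim_avg_upper halpha hf hD hCt k0 (gamma_exp_ge0 m p) C0 (W0 m p) HC).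
- move=> s kappa s2 /k_gt0 k0; split; last by apply: lowH => //; exact: ltW.
  have [C C0 HC] := sobolev_spectral_decay halpha D0 jF s2.
  have r0 : 0 <= s - 2^-1 by rewrite subr_ge0 ltW.
  exact: (lesssim_avg_upper halpha hf hD hCt k0 r0 C0 (sobolevH_ge0 s) (HC sigma)).
- move=> m p mp; have [C C0 HC] := upW m p mp; exists C => // nu u adm t t0.
  have [g [S uE _]] := admissible_burgers halpha hf hD adm.
  rewrite uE ?(ltW t0)//; apply: le_trans (HC nu g t S t0) _.
  rewrite lee_fin ler_wpM2l ?(ltW C0)// -wave_powR /scale.
  have [h|h] := leP t^-1 (wave alpha nu); rewrite le_max; first by rewrite lexx orbT.
  by rewrite -(powR_inv1 (ltW t0)) -powRrM mulN1r lexx.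
- exact: lowW.
- by move=> kappa /k_gt0 k0; exact: lowH.
Qed.
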